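(* Let $k\ge 3$ be an odd integer and fix either choice of the sign $\pm$. For any $T_{0}>0$ and $E_{0}>0$ there exist $(\phi_{0},\phi_{1})\in C^{\infty}(\mathbb{R}^{3})\times C^{\infty}(\mathbb{R}^{3})$ such that the Cauchy problem $$\Box\phi=\pm|\phi|^{k-1}\phi \quad\text{in } [0,T_0]\times\mathbb{R}^{3},\qquad (\phi,\partial_t\phi)|_{t=0}=(\phi_{0},\phi_{1}),$$ has a unique solution $\phi\in C^{\infty}([0,T_{0}]\times\mathbb{R}^{3})$, and its energy $E(\phi(t))$ is at least $E_{0}$.
   Context: Here $\Box=-\partial_{tt}^{2}+\Delta_{x}$ on $\mathbb{R}\times\mathbb{R}^3$, functions are real-valued, and the (conserved) energy is $$E(\phi(t))=\frac{1}{2}\int_{\mathbb{R}^{3}}\Big(|\partial_{t}\phi(t,x)|^{2}+|\nabla_{x}\phi(t,x)|^{2}\pm\frac{2}{k+1}|\phi(t,x)|^{k+1}\Big)dx,$$ with the same choice of sign $\pm$ as in the equation (the plus sign is the defocusing case, the minus sign the focusing case). *)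

(* Defs.v *)
From HB Require Import structures.
From mathcomp Require Import all_boot all_order all_algebra.
From mathcomp Require Import all_classical all_reals all_analysis.

Set Implicit Arguments.
Unset Strict Implicit.
Unset Printing Implicit Defensive.
Import Order.TTheory GRing.Theory Num.Theory.
Import numFieldNormedType.Exports.

Local Open Scope classical_set_scope.
Local Open Scope ring_scope.

(* R^3 is the iterated product R * R * R: it carries both the normed-module
   structure used by 'D_v and the product measure used for the energy. The
   norm is the max norm, which induces the usual topology. *)
Notation space3 R := (R * R * R)%type.

Section WaveEquation.
Variable R : realType.
Implicit Types (f : space3 R -> R) (phi : R -> space3 R -> R).

Definition lebesgue3 :=
  ((@lebesgue_measure R \x @lebesgue_measure R) \x @lebesgue_measure R)%E.

Definition basis3 (j : 'I_3) : space3 R :=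
  ((j == 0 :> nat)%:R, (j == 1 :> nat)%:R, (j == 2 :> nat)%:R).

(* C^n(R^3): all iterated partial derivatives of order at most n exist and are
   continuous. *)
Fixpoint Cn (n : nat) f : Prop :=
  continuous f /\
  if n is m.+1 then
    forall j, (forall x, derivable f x (basis3 j)) /\ Cn m ('D_(basis3 j) f)
  else True.

Definition smooth f : Prop := forall n, Cn n f.

(* The difference quotients of g at t, along the nonzero increments h that keep
   h + t in [0, T]: the resulting derivative is two-sided for 0 < t < T,
   right-sided at t = 0 and left-sided at t = T. *)
Definition quotients (T : R) (g : R -> R) (t : R) : set_system R :=
  (fun h : R => h^-1 *: (g (h + t) - g t))
    @ within [set h | h + t \in `[0, T]] 0^'.

(* d/dt on the slab [0, T] x R^3; values at t outside [0, T] are irrelevant. *)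
Definition dt (T : R) phi : R -> space3 R -> R :=
  fun t x => lim (quotients T (phi^~ x) t).

Definition dx (j : 'I_3) phi : R -> space3 R -> R :=
  fun t => 'D_(basis3 j) (phi t).

(* C^n([0, T] x R^3), with one-sided time derivatives at t = 0 and t = T. *)
Fixpoint Cn_slab (T : R) (n : nat) phi : Prop :=
  {within [set z : R * space3 R | z.1 \in `[0, T]],
     continuous (fun z : R * space3 R => phi z.1 z.2)} /\
  if n is m.+1 then
    [/\ forall t x, t \in `[0, T] -> cvg (quotients T (phi^~ x) t),
        forall j t x, t \in `[0, T] -> derivable (phi t) x (basis3 j),
        Cn_slab T m (dt T phi) &
        forall j, Cn_slab T m (dx j phi)]
  else True.

Definition smooth_slab (T : R) phi : Prop := forall n, Cn_slab T n phi.

Definition box (T : R) phi : R -> space3 R -> R :=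
  fun t x => - dt T (dt T phi) t x + \sum_(j < 3) dx j (dx j phi) t x.

(* sg stands for the sign: 1 is the defocusing and -1 the focusing case. *)
Definition is_solution (sg : R) (k : nat) (T : R) (phi0 phi1 : space3 R -> R) phi
    : Prop :=
  [/\ smooth_slab T phi,
      forall t x, t \in `[0, T] ->
        box T phi t x = sg * (`|phi t x| ^+ k.-1 * phi t x),
      forall x, phi 0 x = phi0 x &
      forall x, dt T phi 0 x = phi1 x].

Definition energy_density (sg : R) (k : nat) (T : R) phi (t : R)
    : space3 R -> R := fun x =>
  `|dt T phi t x| ^+ 2 + \sum_(j < 3) `|dx j phi t x| ^+ 2
  + sg * (2 / k.+1%:R * `|phi t x| ^+ k.+1).

Definition finite_energy (sg : R) (k : nat) (T : R) phi (t : R) : Prop :=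
  lebesgue3.-integrable setT (EFin \o energy_density sg k T phi t).

(* Meaningful under finite_energy: the real-valued integral of a
   non-integrable function is a junk value. *)
Definition energy (sg : R) (k : nat) (T : R) phi (t : R) : R :=
  2^-1 * (\int[lebesgue3]_x energy_density sg k T phi t x).

End WaveEquation.

(* Main.v *)
Require Import Defs.
From HB Require Import structures.
From mathcomp Require Import all_boot all_order all_algebra.
From mathcomp Require Import all_classical all_reals all_analysis.
From mathcomp Require Import measurable_realfun ring lra zify.

(** Radial ansatz: [q = 1 / (1 + d^2 |x|^2)] satisfies [Delta B(q) = d^2 (L B)(q)]
    for a differential operator [L] with polynomial coefficients, so that
    [u(t, x) = q^2 \sum_n A_n(q) t^n] with polynomials [A_n] solves the equation with
    data [u = 0], [u_t = eps q^2] as soon as the [A_n] satisfy a recursion. Since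
    [deg A_n] is linear in [n], [L] costs at most [O(n^2)] on [A_n], which is what the
    two integrations in time gain; a majorant argument then gives convergence on
    [|t| <= 2 T0] when [eps] and [d] are small, and [u_t] stays within [eps q^2 / 2] of
    its initial value. Hence the energy is at least of the order of
    [eps^2 \int q^4 ~ eps^2 / d^3], which is as large as desired when [d -> 0] with
    [eps] fixed.

    Uniqueness is finite speed of propagation: the energy of the difference of two
    solutions, multiplied by a weight that is supported in a shrinking cube and
    decreases in time faster than it varies in space, is nonpositive. *)

Set Implicit Arguments.
Unset Strict Implicit.
Unset Printing Implicit Defensive.
Import Order.TTheory GRing.Theory Num.Theory.
Import numFieldNormedType.Exports.
Local Open Scope classical_set_scope.
Local Open Scope ring_scope.

(** * The l1 norm of polynomials *)

(** One polynomial variable suffices because $q$ closes on itself: $\nabla q = -2 d^2 x q^2$ and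
    $d^2 |x|^2 q = 1 - q$ give $|\nabla q|^2 = 4 d^2 (q^3 - q^4)$ and $\Delta q = d^2 (2 q^2 - 8
    q^3)$, so no $x$ survives. For odd $k$ the nonlinearity is the polynomial $u^k$, which keeps
    every Taylor coefficient a polynomial in $q$. The prefactor $q^2$ survives in both terms of the
    equation and supplies the decay that makes the energy finite. Since the lifespan is prescribed
    and the sign may be focusing, the amplitude is kept small; the energy is large only because the
    solution is spread over a region of size $1/d$. Hence [eps] depends on [T0] and [k] alone and is
    chosen before [d]. The small amplitude also keeps the potential energy below half of the kinetic
    lower bound, whatever its sign. For uniqueness, the competitor is merely smooth on the slab,
    with no growth condition, so only localized integrals are available; and as $C^n$ means iterated
    partial derivatives, the symmetry of mixed derivatives has to be proved, up to the end times. *)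

Section PolyNorm.
Variables (R : realFieldType) (A : comNzRingType) (nu : A -> R) (s : R).
Hypotheses (nu0 : nu 0 = 0) (nu1 : nu 1 <= 1) (nu_ge0 : forall a, 0 <= nu a)
  (nuD : forall a b, nu (a + b) <= nu a + nu b)
  (nuM : forall a b, nu (a * b) <= nu a * nu b) (s_ge0 : 0 <= s).
Implicit Types P Q : {poly A}.

(** Used at two levels: with [nu] the absolute value and [s = 1] for polynomials in the profile
    variable, then with [nu] that very norm and [s] a time radius for polynomials in time. *)
Definition pnorm P : R := \sum_(i < size P) nu P`_i * s ^+ i.

Lemma pnormE n P : (size P <= n)%N -> pnorm P = \sum_(i < n) nu P`_i * s ^+ i.
Proof.
move=> Pn; rewrite /pnorm (big_ord_widen n (fun i => nu P`_i * s ^+ i)) //.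
rewrite [RHS](bigID (fun i : 'I_n => (i < size P)%N)) /= [X in _ + X]big1 ?addr0 //.
by move=> i; rewrite -leqNgt => /(nth_default 0) ->; rewrite nu0 mul0r.
Qed.

Lemma pnorm_ge0 P : 0 <= pnorm P.
Proof. by apply: sumr_ge0 => i _; rewrite mulr_ge0 // exprn_ge0. Qed.

Lemma pnorm0 : pnorm 0 = 0.
Proof. by rewrite /pnorm size_poly0 big_ord0. Qed.

Lemma pnorm_trunc n P : \sum_(i < n) nu P`_i * s ^+ i <= pnorm P.
Proof.
rewrite (@pnormE (n + size P)) ?leq_addl // big_split_ord /= lerDl sumr_ge0 // => i _.
by rewrite mulr_ge0 // exprn_ge0.
Qed.

Lemma pnormD P Q : pnorm (P + Q) <= pnorm P + pnorm Q.
Proof.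
pose n := maxn (size P) (size Q).
rewrite (@pnormE n) ?size_polyD // (@pnormE n P) ?leq_maxl // (@pnormE n Q) ?leq_maxr //.
rewrite -big_split; apply: ler_sum => i _ /=.
by rewrite coefD -mulrDl ler_wpM2r // exprn_ge0.
Qed.

Lemma pnorm_sum I (r : seq I) (p : pred I) (F : I -> {poly A}) :
  pnorm (\sum_(i <- r | p i) F i) <= \sum_(i <- r | p i) pnorm (F i).
Proof.
elim/big_rec2 : _ => [|i x y _ h]; first by rewrite pnorm0.
by rewrite (le_trans (pnormD _ _)) // lerD2l.
Qed.

Lemma pnormXn n : pnorm 'X^n <= s ^+ n.
Proof.
rewrite /pnorm size_polyXn big_ord_recr /= coefXn eqxx big1 ?add0r.
  by rewrite ler_piMl // exprn_ge0.
by move=> i _; rewrite coefXn ltn_eqF ?nu0 ?mul0r.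
Qed.

Lemma pnormMXn P n : pnorm (P * 'X^n) = pnorm P * s ^+ n.
Proof.
rewrite (@pnormE (n + size P)); last first.
  by rewrite (leq_trans (size_polyMleq _ _)) // size_polyXn addnS addnC.
rewrite big_split_ord /= big1 ?add0r => [|i _]; last by rewrite coefMXn ltn_ord nu0 mul0r.
rewrite /pnorm mulr_suml; apply: eq_bigr => i _.
by rewrite coefMXn ltnNge leq_addr /= addKn exprD (mulrC (s ^+ n)) mulrA.
Qed.

Lemma pnormC a : pnorm a%:P = nu a.
Proof.
by rewrite (@pnormE 1) ?size_polyC_leq1 // big_ord1 coefC /= expr0 mulr1.
Qed.

Lemma pnormCM a P : pnorm (a%:P * P) <= nu a * pnorm P.
Proof.
rewrite (@pnormE (size P)) /pnorm; last first.
  rewrite mul_polyC; exact: size_scale_leq.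
rewrite mulr_sumr; apply: ler_sum => i _.
by rewrite coefCM mulrA ler_wpM2r ?exprn_ge0.
Qed.

(** Expanding [P] in monomials reduces the product to shifts by ['X^i], which scale the norm by
    exactly [s ^+ i]. *)
Lemma pnormM P Q : pnorm (P * Q) <= pnorm P * pnorm Q.
Proof.
rewrite -{1}[P]coefK poly_def.
rewrite mulr_suml (le_trans (pnorm_sum _ _ _)) // [pnorm P]/pnorm mulr_suml.
apply: ler_sum => i _.
rewrite -mul_polyC mulrAC pnormMXn [leRHS]mulrAC ler_wpM2r ?exprn_ge0 //.
exact: pnormCM.
Qed.

Lemma pnormX P n : pnorm (P ^+ n) <= pnorm P ^+ n.
Proof.
elim: n => [|n IHn]; first by rewrite expr0 pnormC.
by rewrite !exprS (le_trans (pnormM _ _)) // ler_wpM2l ?pnorm_ge0.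
Qed.

End PolyNorm.

Section L1.
Variable R : realFieldType.
Implicit Types p q : {poly R}.

Definition l1 p : R := pnorm (fun x : R => `|x|) 1 p.

Lemma l1E p n : (size p <= n)%N -> l1 p = \sum_(i < n) `|p`_i|.
Proof.
move=> pn; rewrite /l1 (pnormE _ _ pn) ?normr0 //.
by apply: eq_bigr => i _; rewrite expr1n mulr1.
Qed.

Lemma l1_0 : l1 0 = 0. Proof. exact: pnorm0. Qed.

Lemma l1_ge0 p : 0 <= l1 p.
Proof. by apply: pnorm_ge0 => //; exact: normr_ge0. Qed.

Lemma l1D p q : l1 (p + q) <= l1 p + l1 q.
Proof. by apply: pnormD => //; [exact: normr0|exact: ler_normD]. Qed.

Lemma l1M p q : l1 (p * q) <= l1 p * l1 q.
Proof.
apply: pnormM => //; [exact: normr0|exact: ler_normD|].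
by move=> *; rewrite normrM.
Qed.

Lemma l1C c : l1 c%:P = `|c|.
Proof. by apply: (pnormC (nu := fun x : R => `|x|)); exact: normr0. Qed.

Lemma l1_1 : l1 1 = 1.
Proof. by rewrite l1C normr1. Qed.

Lemma l1Z c p : l1 (c *: p) <= `|c| * l1 p.
Proof. by rewrite -mul_polyC (le_trans (l1M _ _)) // l1C. Qed.

Lemma l1N p : l1 (- p) = l1 p.
Proof. by rewrite /l1 /pnorm size_polyN; apply: eq_bigr => i _; rewrite coefN normrN. Qed.

Lemma l1B p q : l1 (p - q) <= l1 p + l1 q.
Proof. by rewrite -(l1N q) l1D. Qed.

Lemma l1Xn n : l1 'X^n <= 1.
Proof.
rewrite -[leRHS](expr1n R n); apply: pnormXn => //; first exact: normr0.
by rewrite normr1.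
Qed.

Lemma l1X : l1 'X <= 1.
Proof. by rewrite -['X]expr1 l1Xn. Qed.

(** A derivative costs the degree; as degrees grow linearly with the order in time, this becomes a
    factor of the order of [n]. *)
Lemma l1_deriv p n : (size p <= n.+1)%N -> l1 p^`() <= n%:R * l1 p.
Proof.
move=> pn; have pn' : (size p^`() <= n)%N by rewrite (leq_trans (size_poly _ _)) //; lia.
rewrite (l1E pn') (l1E pn) big_ord_recl /= mulrDr ler_wpDl ?mulr_ge0 //.
rewrite mulr_sumr; apply: ler_sum => i _; rewrite coef_deriv.
by rewrite normrMn -[leLHS]mulr_natl ler_wpM2r // ler_nat.
Qed.

Lemma l1_horner p x : 0 <= x <= 1 -> `|p.[x]| <= l1 p.
Proof.
move=> /andP[x0 x1]; rewrite horner_coef (le_trans (ler_norm_sum _ _ _)) //.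
rewrite (l1E (leqnn _)); apply: ler_sum => i _; rewrite normrM ler_piMr //.
by rewrite ger0_norm ?exprn_ge0 // exprn_ile1.
Qed.

Lemma normr_subrX (x y c : R) n : `|x| <= c -> `|y| <= c ->
  `|x ^+ n - y ^+ n| <= n%:R * c ^+ n.-1 * `|x - y|.
Proof.
move=> xc yc; have c0 : 0 <= c by exact: le_trans xc.
rewrite subrXX normrM mulrC ler_wpM2r // (le_trans (ler_norm_sum _ _ _)) //.
apply: (@le_trans _ _ (\sum_(i < n) c ^+ n.-1)); last first.
  by rewrite sumr_const card_ord mulr_natl.
apply: ler_sum => i _; rewrite normrM !normrX.
have -> : n.-1 = ((n - i.+1) + i)%N by have := ltn_ord i; lia.
by rewrite addnK exprD ler_pM ?exprn_ge0 // lerXn2r ?nnegrE.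
Qed.

Lemma l1_lipschitz p x y : 0 <= x <= 1 -> 0 <= y <= 1 ->
  `|p.[x] - p.[y]| <= l1 p^`() * `|x - y|.
Proof.
move=> /andP[x0 x1] /andP[y0 y1].
rewrite !horner_coef -sumrB (le_trans (ler_norm_sum _ _ _)) //.
rewrite (@l1E _ (size p).-1); last by rewrite (leq_trans (size_poly _ _)).
case: (size p) => [|n] /=; first by rewrite !big_ord0 mul0r.
rewrite big_ord_recl /= !expr0 subrr normr0 add0r mulr_suml.
apply: ler_sum => i _; rewrite -mulrBr normrM coef_deriv normrMn.
rewrite -[X in _ <= X * _]mulr_natr -mulrA ler_wpM2l //.
have := @normr_subrX x y 1 i.+1; rewrite expr1n mulr1; apply; by rewrite ger0_norm.
Qed.

End L1.

(** * The Laplacian on radial profiles *)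

Section Profile.
Variable R : realFieldType.
Implicit Types B : {poly R}.

(** The chain rule $B'(q) \Delta q + B''(q) |\nabla q|^2$ divided by $d^2$: the coefficients are $2
    q^2 - 8 q^3$ and $4 q^3 - 4 q^4$, see [horner_lap]. *)
Definition lap B : {poly R} :=
  4%:R *: (('X - 'X^2) * ('X^2 * B^`())^`()) - 6%:R *: ('X^2 * B^`()).

(** The conjugate of [lap] by multiplication by ['X^2], which acts on the coefficients once $q^2$ is
    factored out. *)
Definition lap2 B : {poly R} :=
  'X * (12%:R *: B - 24%:R *: ('X * B) + 18%:R *: ('X * B^`())
        - 24%:R *: ('X^2 * B^`()) + 4%:R *: ('X^2 * B^`()^`())
        - 4%:R *: ('X^3 * B^`()^`())).

Lemma lap_X2 B : lap ('X^2 * B) = 'X^2 * lap2 B.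
Proof.
rewrite /lap /lap2 !(derivM, derivD, derivXn, derivX, derivMn) /=.
rewrite -!mul_polyC !polyC_natr; ring.
Qed.

Lemma size_lap2 B : (size (lap2 B) <= size B + 4)%N.
Proof.
have dn (S : {poly R}) : (size S^`() <= size S)%N.
  by rewrite (leq_trans (size_poly _ _)) // leq_pred.
have d1 (S T : {poly R}) n : (size S <= n)%N -> (size T <= n)%N -> (size (S + T)%R <= n)%N.
  by move=> Sn Tn; rewrite (leq_trans (size_polyD _ _)) // geq_max Sn Tn.
have d2 (S T : {poly R}) n : (size S <= n)%N -> (size T <= n)%N -> (size (S - T)%R <= n)%N.
  by move=> Sn Tn; rewrite d1 // size_polyN.
have m (c : R) (S : {poly R}) r l : (size S <= r)%N -> (size (c *: ('X^l * S)) <= l + r)%N.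
  move=> Sr; rewrite (leq_trans (size_scale_leq _ _)) //.
  by rewrite (leq_trans (size_polyMleq _ _)) // size_polyXn addSn leq_add2l.
have m' (c : R) (S : {poly R}) l : (size S <= size B)%N -> (l <= 3)%N ->
    (size (c *: ('X^l * S)) <= size B + 3)%N.
  by move=> SB l3; rewrite (leq_trans (m _ _ _ _ SB)) // addnC leq_add2l.
have m1 (c : R) (S : {poly R}) : (size S <= size B)%N ->
    (size (c *: ('X * S)) <= size B + 3)%N by move=> SB; exact: (m' c S 1%N).
rewrite -[lap2 B]scale1r addnS -add1n; apply: (m 1 _ (size B + 3)%N 1%N).
have m0 (c : R) : (size (c *: B) <= size B + 3)%N.
  by rewrite (leq_trans (size_scale_leq _ _)) // leq_addr.
by repeat first [apply/d2|apply/d1]; (apply/m1 || apply/m' || apply/m0) => //;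
  rewrite ?(leq_trans (dn _)) ?dn.
Qed.

(** The constants add up the coefficients of [lap2] by order of derivative: 12 + 24, then 18 + 24,
    then 4 + 4. *)
Lemma l1_lap2 B n : (size B <= n.+1)%N ->
  l1 (lap2 B) <= (36%:R + 42%:R * n%:R + 8%:R * n%:R ^+ 2) * l1 B.
Proof.
move=> Bn; have b0 := l1_ge0 B.
have B1 : l1 B^`() <= n%:R * l1 B by exact: l1_deriv.
have B2 : l1 B^`()^`() <= n%:R * (n%:R * l1 B).
  rewrite (@le_trans _ _ (n%:R * l1 B^`())) ?ler_wpM2l ?l1_deriv //.
  by rewrite (leq_trans (size_poly _ _)) //; move: Bn; lia.
have Z (c : nat) (A : {poly R}) m : l1 (c%:R *: ('X^m * A)) <= c%:R * l1 A.
  rewrite (le_trans (l1Z _ _)) // normr_nat ler_wpM2l // (le_trans (l1M _ _)) //.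
  by rewrite ler_piMl ?l1_ge0 ?l1Xn.
have Z1 (c : nat) (A : {poly R}) : l1 (c%:R *: ('X * A)) <= c%:R * l1 A by have := Z c A 1%N; rewrite expr1.
have Z0 (c : nat) (A : {poly R}) : l1 (c%:R *: A) <= c%:R * l1 A by have := Z c A 0%N; rewrite expr0 mul1r.
rewrite /lap2 (le_trans (l1M _ _)) // (@le_trans _ _ (1 * (12%:R * l1 B + 24%:R * l1 B
  + 18%:R * l1 B^`() + 24%:R * l1 B^`() + 4%:R * l1 B^`()^`() + 4%:R * l1 B^`()^`()))) //.
  rewrite ler_pM ?l1_ge0 ?l1X //.
  repeat first [apply: (le_trans (l1B _ _)); apply: lerD|apply: (le_trans (l1D _ _)); apply: lerD]; first [exact: Z1|exact: Z|exact: Z0].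
nra.
Qed.

End Profile.

(** * The recursion for the Taylor coefficients *)

Section CoefPower.
Variable A : comNzRingType.
Implicit Types P Q : {poly A}.

(** Causality of the recursion: a coefficient of a power only sees coefficients of lower or equal
    order, so a truncation determines it exactly. *)
Lemma coefX_agree P Q k n : (forall i, (i <= n)%N -> P`_i = Q`_i) ->
  forall i, (i <= n)%N -> (P ^+ k)`_i = (Q ^+ k)`_i.
Proof.
move=> PQ; elim: k => [|k IH] i ik; first by rewrite !expr0.
rewrite !exprS !coefM; apply: eq_bigr => j _.
by rewrite PQ ?IH //; have := ltn_ord j; lia.
Qed.

End CoefPower.

Section SizeGrowth.
Variables (R : realFieldType) (D : nat).
Implicit Types P Q : {poly {poly R}}.

(** Size at most [D * n + 1] means degree at most [D * n]; degrees add up under products, so the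
    same [D] serves for every power. *)
Definition linear_size P := forall n, (size (P`_n)%R <= D * n + 1)%N.

Lemma linear_sizeM P Q : linear_size P -> linear_size Q -> linear_size (P * Q).
Proof.
move=> hP hQ n; rewrite coefM (leq_trans (size_sum _ _ _)) //.
apply/bigmax_leqP => i _; rewrite (leq_trans (size_polyMleq _ _)) //.
have := hP i; have := hQ (n - i)%N; have := ltn_ord i.
have -> : (D * n = D * i + D * (n - i))%N by rewrite -mulnDr subnKC // -ltnS ltn_ord.
by lia.
Qed.

Lemma linear_sizeX P k : linear_size P -> linear_size (P ^+ k).
Proof.
move=> hP; elim: k => [|k IH]; last by rewrite exprS; exact: linear_sizeM.
move=> n; rewrite expr0 coef1; case: (n == 0)%N; rewrite ?size_poly1 ?size_poly0 ?addn1 //.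
Qed.

End SizeGrowth.

Section Evaluation.
Variable R : realFieldType.

(** Every discarded term carries at least [M] factors [t], each of which gains [|t| / s] over the
    majorant at radius [s]. *)
Lemma horner_tail (P : {poly {poly R}}) (s t x : R) M :
  0 < s -> `|t| <= s -> 0 <= x <= 1 ->
  `|P.[t%:P].[x] - \sum_(n < M) (P`_n).[x] * t ^+ n| <=
  (`|t| / s) ^+ M * pnorm (@l1 R) s P.
Proof.
move=> s0 ts x01; pose K := (M + size P)%N.
have PK : (size P <= K)%N by rewrite leq_addl.
rewrite (horner_coef_wide _ PK) horner_sum (pnormE _ (@l1_0 R) PK) /K.
rewrite !big_split_ord /= mulrDr.
have E i : (P`_i * t%:P ^+ i).[x] = (P`_i).[x] * t ^+ i.
  by rewrite hornerM horner_exp hornerC.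
under eq_bigr do rewrite E.
under [X in _ + X - _]eq_bigr do rewrite E.
rewrite addrAC subrr add0r (le_trans (ler_norm_sum _ _ _)) //.
rewrite -[leLHS]add0r lerD //.
  rewrite mulr_ge0 ?exprn_ge0 ?divr_ge0 ?(ltW s0) //.
  by rewrite sumr_ge0 // => i _; rewrite mulr_ge0 ?l1_ge0 ?exprn_ge0 ?(ltW s0).
rewrite mulr_sumr; apply: ler_sum => i _; rewrite normrM normrX.
rewrite [leRHS]mulrCA ler_pM ?exprn_ge0 ?l1_horner //.
rewrite !exprD mulrA expr_div_n mulfVK ?expf_neq0 ?gt_eqF //.
by rewrite ler_wpM2l ?exprn_ge0 // lerXn2r ?nnegrE // ltW.
Qed.

End Evaluation.


(** * Taylor coefficients in time and their majorant *)

Section Recursion.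
Variables (R : realFieldType) (k : nat) (sg d2 eps : R).

(* The [n+2]-nd Taylor coefficient in time of the profile, computed from a
   truncation [S] of the Taylor series containing the orders at most [n]. *)
Definition next_coef (S : {poly {poly R}}) n : {poly R} :=
  (n.+1%:R * n.+2%:R)^-1 *:
    (d2 *: lap2 S`_n - sg *: ('X^(2 * k - 2) * (S ^+ k)`_n)).

(** Indices are shifted by one: the value is the coefficient of order [n.+1], so [n = 0] is the
    initial velocity and [n = m.+1] is the order [m.+2] given by [next_coef S m]. *)
Definition coef_of_trunc n S : {poly R} := if n is m.+1 then next_coef S m else eps%:P.

(** A coefficient depends on all earlier ones, so the recursion carries the whole truncation.
    Starting from 0 encodes the datum $u = 0$. *)
Fixpoint trunc n : {poly {poly R}} :=
  if n is m.+1 then trunc m + (coef_of_trunc m (trunc m))%:P * 'X^(m.+1) else 0.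

Definition profile n : {poly R} := (trunc n)`_n.

Lemma coef_trunc N n : (trunc N)`_n = if (n <= N)%N then profile n else 0.
Proof.
have gt0 M m : (M < m)%N -> (trunc M)`_m = 0.
  elim: M => [|M IH] Mm /=; first by rewrite coef0.
  rewrite coefD coefCM coefXn IH ?(ltnW Mm) //.
  by rewrite gtn_eqF // mulr0 addr0.
case: leqP => [|/gt0 //]; elim: N => [|N IH] nN.
  by move: nN; rewrite leqn0 => /eqP ->.
move: nN; rewrite leq_eqVlt => /orP[/eqP -> //|nN].
by rewrite /= coefD coefCM coefXn ltn_eqF // mulr0 addr0 IH.
Qed.

Lemma profile0 : profile 0 = 0. Proof. by rewrite /profile coef0. Qed.

Lemma profileS n : profile n.+1 = coef_of_trunc n (trunc n).
Proof.
by rewrite /profile /= coefD coef_trunc ltnn add0r coefCM coefXn eqxx mulr1.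
Qed.

Lemma profile1 : profile 1 = eps%:P. Proof. exact: profileS. Qed.

Definition power_coef n : {poly R} := (trunc n ^+ k)`_n.

Lemma coef_truncX N n : (n <= N)%N -> (trunc N ^+ k)`_n = power_coef n.
Proof.
move=> nN; apply: (@coefX_agree _ _ _ _ n) => // i iN.
by rewrite !coef_trunc iN (leq_trans iN).
Qed.

Lemma profileSS n : profile n.+2 = (n.+1%:R * n.+2%:R)^-1 *:
  (d2 *: lap2 (profile n) - sg *: ('X^(2 * k - 2) * power_coef n)).
Proof. by rewrite profileS [LHS]/(next_coef _ _) /next_coef coef_truncX ?leqnSn // coef_trunc leqnSn. Qed.

Hypothesis k_ge2 : (2 <= k)%N.

(** Two more orders allow a degree increase of [4 * k]: [lap2] uses at most 4 and the nonlinear term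
    [2 * k - 2], the [k]-th power itself obeying the same linear bound. *)
Lemma size_profile n : (size (profile n) <= 2 * k * n + 1)%N.
Proof.
suff: linear_size (2 * k) (trunc n) by apply.
elim: n => [|n IH] m /=; first by rewrite coef0 size_poly0.
rewrite coefD coefCM coefXn; have [->|mn] := eqVneq m n.+1; last by rewrite mulr0 addr0.
rewrite mulr1 coef_trunc ltnn add0r.
case: n IH => [|n] IH /=; first by rewrite (leq_trans (size_polyC_leq1 _)) // addn1.
rewrite /next_coef (leq_trans (size_scale_leq _ _)) //.
rewrite (leq_trans (size_polyD _ _)) // size_polyN geq_max; apply/andP; split.
  rewrite (leq_trans (size_scale_leq _ _)) // (leq_trans (size_lap2 _)) //.
  by apply: leq_trans (leq_add (IH n) (leqnn 4)) _; move: k_ge2; nia.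
rewrite (leq_trans (size_scale_leq _ _)) // (leq_trans (size_polyMleq _ _)) //.
rewrite size_polyXn addSn /=.
by apply: leq_trans (leq_add (leqnn _) (linear_sizeX k IH n)) _; move: k_ge2; nia.
Qed.

Variable s : R.
Hypotheses (s_gt0 : 0 < s) (eps_gt0 : 0 < eps) (d2_ge0 : 0 <= d2) (sg1 : `|sg| = 1).

Let a n := l1 (profile n).
(** A majorant of the time derivative on [|t| <= s]. It controls the velocity, which the energy
    bound needs, and the function itself up to a factor [s], since the order 0 vanishes. *)
Let W N := \sum_(i < N) i.+1%:R * a i.+1 * s ^+ i.

Let pn := pnorm (@l1 R) s.

Lemma pnorm_trunc_le N : pn (trunc N) <= s * W N.
Proof.
have sz : (size (trunc N) <= N.+1)%N.
  by apply/leq_sizeP => j Nj; rewrite coef_trunc leqNgt Nj.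
rewrite /pn (pnormE _ _ sz) ?l1_0 // big_ord_recl coef_trunc /= profile0 l1_0 mul0r add0r.
rewrite mulr_sumr; apply: ler_sum => i _; rewrite coef_trunc /= ltn_ord.
rewrite exprS mulrCA (ler_wpM2l (ltW s_gt0)) // ler_wpM2r ?exprn_ge0 ?(ltW s_gt0) //.
by rewrite ler_peMl ?l1_ge0 // ler1n.
Qed.

Lemma power_coef_sum N : \sum_(n < N.+1) l1 (power_coef n) * s ^+ n <= (s * W N) ^+ k.
Proof.
have s0 := ltW s_gt0.
apply: (@le_trans _ _ (pn (trunc N ^+ k))).
  apply: (le_trans _ (pnorm_trunc (@l1_0 R) (@l1_ge0 R) s0 N.+1 _)).
  by apply: ler_sum => i _; rewrite coef_truncX // -ltnS.
apply: (@le_trans _ _ (pn (trunc N) ^+ k)).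
  by apply: pnormX => //; [exact: l1_0|rewrite l1_1|exact: l1_ge0|exact: l1D|exact: l1M].
rewrite lerXn2r ?nnegrE ?pnorm_trunc_le ?pnorm_ge0 //; first exact: l1_ge0.
exact: le_trans (pnorm_ge0 (@l1_ge0 R) s0 _) (pnorm_trunc_le N).
Qed.

Let coef_ge0 : 0 <= 344%:R * k%:R ^+ 2 * d2 * s ^+ 2.
Proof.
exact: (mulr_ge0 (mulr_ge0 (mulr_ge0 (ler0n _ _) (sqr_ge0 _)) d2_ge0) (sqr_ge0 _)).
Qed.

(** Of the divisors [n.+1] and [n.+2], the second stays on the left as the weight of [W], and the
    first reduces the loss [n ^ 2] of the Laplacian to [n], the weight of [a n] in [W]: no
    derivative is lost. *)
Lemma profile_step n : n.+2%:R * a n.+2 * s ^+ n.+1 <=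
  344%:R * k%:R ^+ 2 * d2 * s ^+ 2 * (n%:R * a n * s ^+ n.-1) +
  s * (l1 (power_coef n) * s ^+ n).
Proof.
have n1 : 0 < n.+1%:R :> R by rewrite ltr0n.
have n2 : 0 < n.+2%:R :> R by rewrite ltr0n.
have a0 : 0 <= a n by exact: l1_ge0.
have c0 : 0 <= l1 (power_coef n) by exact: l1_ge0.
have s0 := ltW s_gt0.
(* With $x = 2 k n \ge 1$, $36 + 42 x + 8 x^2 \le 86 x^2 = 344 k^2 n^2$; for [n = 0] the profile is
   zero. *)
have lapn : l1 (lap2 (profile n)) <= 344%:R * k%:R ^+ 2 * n%:R ^+ 2 * a n.
  case: (posnP n) => [->|n_gt0]; first by rewrite /a profile0 /lap2 !(deriv0, mulr0, scaler0, subr0, addr0) l1_0 mulr0.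
  have := size_profile n; rewrite addn1 => /l1_lap2 /le_trans; apply.
  rewrite ler_wpM2r //; set x := (2 * k * n)%:R.
  have x1 : 1 <= x :> R by rewrite ler1n !muln_gt0 /= n_gt0; lia.
  have -> : 344%:R * k%:R ^+ 2 * n%:R ^+ 2 = 86%:R * x ^+ 2 :> R by rewrite /x !natrM; ring.
  by nra.
have hb : n.+1%:R * n.+2%:R * a n.+2 <= d2 * (344%:R * k%:R ^+ 2 * n%:R ^+ 2 * a n) + l1 (power_coef n).
  rewrite /a profileSS -ler_pdivlMl ?mulr_gt0 // (le_trans (l1Z _ _)) //.
  rewrite ger0_norm ?invr_ge0 ?mulr_ge0 // ler_wpM2l ?invr_ge0 ?mulr_ge0 //.
  rewrite (le_trans (l1B _ _)) // lerD //.
    by rewrite (le_trans (l1Z _ _)) // ger0_norm // ler_wpM2l.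
  by rewrite (le_trans (l1Z _ _)) // sg1 mul1r (le_trans (l1M _ _)) // ler_piMl // l1Xn.
rewrite -(ler_pM2l n1).
have sn := exprn_ge0 n.+1 s0.
apply: (@le_trans _ _ ((n.+1%:R * n.+2%:R * a n.+2) * s ^+ n.+1)); first by rewrite le_eqVlt; apply/orP; left; apply/eqP; ring.
apply: (le_trans (ler_wpM2r sn hb)); rewrite mulrDl mulrDr lerD //.
  (* For [n = 0] both sides vanish, which makes the truncated predecessor [n.-1] harmless. *)
  case: n n1 n2 a0 c0 lapn hb sn => [|n] n1 n2 a0 c0 lapn hb sn.
    by rewrite !(mulr0n, expr0n, mul0r, mulr0).
  rewrite [leLHS](_ : _ = 344%:R * k%:R ^+ 2 * d2 * s ^+ 2 * (n.+1%:R * a n.+1 * s ^+ n) * n.+1%:R); last first.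
    by rewrite !exprS; ring.
  have X0 := mulr_ge0 coef_ge0 (mulr_ge0 (mulr_ge0 (ler0n _ n.+1) a0) (exprn_ge0 n s0)).
  by rewrite mulrC; apply: (ler_wpM2r X0); rewrite ler_nat.
rewrite exprS [leLHS]mulrCA ler_peMl ?ler1n //.
by rewrite !mulr_ge0 ?exprn_ge0.
Qed.

Hypotheses (small_d2 : 344%:R * k%:R ^+ 2 * d2 * s ^+ 2 <= 8%:R^-1)
  (small_eps : s * (2 * s) ^+ k * eps ^+ k.-1 <= 4%:R^-1).

Let W_term_ge0 i : 0 <= i.+1%:R * a i.+1 * s ^+ i.
Proof. by rewrite !mulr_ge0 ?l1_ge0 // exprn_ge0 // ltW. Qed.

Lemma W_ge0 N : 0 <= W N.
Proof. exact: sumr_ge0. Qed.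

Lemma W_mono M N : (M <= N)%N -> W M <= W N.
Proof.
move=> MN; rewrite /W (big_ord_widen N (fun i => i.+1%:R * a i.+1 * s ^+ i)) //.
rewrite [leRHS](bigID (fun i : 'I_N => (i < M)%N)) /= lerDl.
exact: sumr_ge0.
Qed.

(** Under the bootstrap assumption the linear and the nonlinear terms contribute at most [eps / 4]
    each: this is the origin of the bounds 1/8 and 1/4 in the smallness hypotheses. *)
Lemma tail_step N : W N <= 2 * eps ->
  \sum_(i < N.+1) i.+2%:R * a i.+2 * s ^+ i.+1 <= eps / 2.
Proof.
move=> WN.
apply: (@le_trans _ _ (344%:R * k%:R ^+ 2 * d2 * s ^+ 2 * W N +
    s * \sum_(n < N.+1) l1 (power_coef n) * s ^+ n)).
  apply: (@le_trans _ _ (\sum_(i < N.+1) (344%:R * k%:R ^+ 2 * d2 * s ^+ 2 *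
      (i%:R * a i * s ^+ i.-1) + s * (l1 (power_coef i) * s ^+ i)))).
    by apply: ler_sum => i _; exact: profile_step.
  rewrite big_split /= -!mulr_sumr lerD2r big_ord_recl /= !mul0r add0r.
  by rewrite /W lexx.
have Wk : (s * W N) ^+ k <= (2 * s) ^+ k * eps ^+ k.
  rewrite -exprMn lerXn2r ?nnegrE ?mulr_ge0 ?W_ge0 ?(ltW s_gt0) ?(ltW eps_gt0) //.
  by have := ler_wpM2l (ltW s_gt0) WN; rewrite mulrA [s * 2]mulrC.
apply: (@le_trans _ _ (8%:R^-1 * (2 * eps) + s * ((2 * s) ^+ k * eps ^+ k))).
  apply: lerD; first exact: (ler_pM coef_ge0 (W_ge0 N) small_d2 WN).
  by rewrite ler_wpM2l ?(ltW s_gt0) // (le_trans (power_coef_sum N)).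
have -> : s * ((2 * s) ^+ k * eps ^+ k) = s * (2 * s) ^+ k * eps ^+ k.-1 * eps.
  have -> : eps ^+ k = eps ^+ k.-1 * eps by rewrite -exprSr prednK // ltnW.
  by ring.
have := ler_wpM2r (ltW eps_gt0) small_eps; lra.
Qed.

Lemma W_recl N : W N.+1 = eps + \sum_(i < N) i.+2%:R * a i.+2 * s ^+ i.+1.
Proof. by rewrite /W big_ord_recl /= /a profile1 l1C mul1r mulr1 gtr0_norm. Qed.

(** A bootstrap on the order: [2 * eps] at one order gives [eps + eps / 2] at the next. *)
Lemma W_bound N : W N <= 2 * eps.
Proof.
elim: N => [|[|N] IH]; first by rewrite /W big_ord0 mulr_ge0 ?ltW.
  by rewrite W_recl big_ord0; have := eps_gt0; lra.
have := tail_step (le_trans (W_mono (leqnSn N)) IH).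
by rewrite W_recl; have := eps_gt0; lra.
Qed.

Lemma profile_tail N : \sum_(i < N) i.+2%:R * l1 (profile i.+2) * s ^+ i.+1 <= eps / 2.
Proof.
case: N => [|N]; first by rewrite big_ord0 divr_ge0 ?ltW.
exact/tail_step/W_bound.
Qed.

Lemma pnorm_trunc_bound N : pn (trunc N) <= 2 * s * eps.
Proof.
rewrite (le_trans (pnorm_trunc_le N)) //.
by have := ler_wpM2l (ltW s_gt0) (W_bound N); rewrite mulrA [s * 2]mulrC.
Qed.

(** The power of a truncation and the truncation of the power differ only in orders above [N], which
    [horner_tail] makes geometrically small. This avoids Cauchy products of infinite series. *)
Lemma trunc_power t x N : `|t| <= s -> 0 <= x <= 1 ->
  `|(\sum_(n < N.+1) (profile n).[x] * t ^+ n) ^+ k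
    - \sum_(n < N.+1) (power_coef n).[x] * t ^+ n| <=
  (`|t| / s) ^+ N.+1 * (2 * s * eps) ^+ k.
Proof.
move=> ts x01.
have -> : \sum_(n < N.+1) (profile n).[x] * t ^+ n = (trunc N).[t%:P].[x].
  have sz : (size (trunc N) <= N.+1)%N.
    by apply/leq_sizeP => j Nj; rewrite coef_trunc leqNgt Nj.
  rewrite (horner_coef_wide _ sz) horner_sum; apply: eq_bigr => i _.
  by rewrite coef_trunc -ltnS ltn_ord hornerM horner_exp hornerC.
rewrite -!horner_exp.
have -> : \sum_(n < N.+1) (power_coef n).[x] * t ^+ n =
    \sum_(n < N.+1) ((trunc N ^+ k)`_n).[x] * t ^+ n.
  by apply: eq_bigr => i _; rewrite coef_truncX // -ltnS.
apply: (le_trans (horner_tail _ _ s_gt0 ts x01)).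
rewrite ler_wpM2l ?exprn_ge0 ?divr_ge0 ?(ltW s_gt0) //.
apply: (@le_trans _ _ (pn (trunc N) ^+ k)).
  by apply: pnormX; rewrite ?l1_1 ?(ltW s_gt0) //; [exact: l1_0|exact: l1_ge0|exact: l1D|exact: l1M].
rewrite lerXn2r ?nnegrE ?pnorm_trunc_bound ?pnorm_ge0 //; first exact: l1_ge0.
  by rewrite ltW.
by rewrite !mulr_ge0 ?(ltW s_gt0) ?(ltW eps_gt0).
Qed.

Lemma profile_sum N : \sum_(i < N) l1 (profile i) * s ^+ i <= 2 * s * eps.
Proof.
apply: (le_trans _ (pnorm_trunc_bound N)).
apply: (le_trans _ (pnorm_trunc (@l1_0 R) (@l1_ge0 R) (ltW s_gt0) N _)).
by apply: ler_sum => i _; rewrite coef_trunc ltnW.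
Qed.

End Recursion.

(** * Series of functions *)

Section Tannery.
Variable R : realType.
Implicit Types u M : R^nat.

Lemma dominated_cvg u M : (forall n, `|u n| <= M n) -> cvgn (series M) ->
  cvgn (series u).
Proof.
move=> uM cM; apply: normed_cvg; apply: series_le_cvg cM => n //=.
exact: le_trans (uM n).
Qed.

Lemma dominated_tail u M N : (forall n, `|u n| <= M n) -> cvgn (series M) ->
  `|limn (series u) - series u N| <= limn (series M) - series M N.
Proof.
move=> uM cM; have cu := dominated_cvg uM cM.
have M0 n : 0 <= M n by exact: le_trans (uM n).
have c1 : (fun m => `|series u m - series u N|) @ \oo --> `|limn (series u) - series u N|.
  by apply: cvg_norm; apply: cvgB => //; exact: cvg_cst.
rewrite -(cvg_lim _ c1) //; apply: limr_le; first by apply: cvgP c1.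
near=> m; have Nm : (N <= m)%N by near: m; exact: nbhs_infty_ge.
rewrite sub_series_geq // (le_trans (ler_norm_sum _ _ _)) //.
apply: (@le_trans _ _ (\sum_(N <= k < m) M k)); first by apply: ler_sum => i _.
rewrite -sub_series_geq // lerD2r; apply: nondecreasing_cvgn_le => //.
exact: nondecreasing_series.
Unshelve. all: by end_near. Qed.

(** Dominated convergence for series. The filter is arbitrary, so that it serves for continuity as
    well as for difference quotients. *)
Lemma tannery T (F : set_system T) {FF : ProperFilter F} (f : nat -> T -> R) (l M : R^nat) :
  (forall n, f n x @[x --> F] --> l n) ->
  (\forall x \near F, forall n, `|f n x| <= M n) -> cvgn (series M) ->
  limn (series (f^~ x)) @[x --> F] --> limn (series l).
Proof.
move=> fl fM cM.
have lM n : `|l n| <= M n.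
  have c1 : `|f n x| @[x --> F] --> `|l n| by exact: cvg_norm.
  rewrite -(cvg_lim _ c1) //; apply: limr_le; first by apply: cvgP c1.
  by apply: filterS fM => x; apply.
apply/cvgrPdist_le => e e0.
have e4 : 0 < e / 4 by rewrite divr_gt0.
have [N _ /(_ N (leqnn N))] : \forall N \near \oo, `|limn (series M) - series M N| <= e / 4.
  by move/cvgrPdist_le : cM; apply.
move=> /(le_trans (ler_norm _)) tailN.
have cs : series (f^~ x) N @[x --> F] --> series l N.
  rewrite /series /=.
  elim: (index_iota 0 N) => [|i r IH].
    by rewrite big_nil; under eq_fun do rewrite big_nil; exact: cvg_cst.
  by rewrite big_cons; under eq_fun do rewrite big_cons; exact: cvgD.
near=> x.
have -> : limn (series l) - limn (series (f^~ x)) =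
  (limn (series l) - series l N) - (limn (series (f^~ x)) - series (f^~ x) N)
  + (series l N - series (f^~ x) N) by ring.
apply: (@le_trans _ _ (e / 4 + e / 4 + e / 4)); last by move: e0; lra.
apply: (le_trans (ler_normD _ _)); apply: lerD.
  apply: (le_trans (ler_normB _ _)); apply: lerD.
    exact: (le_trans (dominated_tail N lM cM)).
  by apply: (le_trans (dominated_tail N _ cM)) => //; near: x.
near: x; move/cvgrPdist_le : cs; exact.
Unshelve. all: by end_near. Qed.

Lemma cvg_series_invsq : cvgn (series (fun n => (n.+1%:R ^+ 2)^-1 : R)).
Proof.
apply: nondecreasing_is_cvgn.
  by apply: nondecreasing_series => n _ _; rewrite invr_ge0 exprn_ge0.
exists 2%:R => _ [n _ <-].
(* Telescoping bound, from $1 / (n+2)^2 \le 1 / (n+1) - 1 / (n+2)$. *)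
suff : series (fun n => (n.+1%:R ^+ 2)^-1 : R) n.+1 <= 2 - n.+1%:R^-1.
  move=> h; apply: (@le_trans _ _ (2 - n.+1%:R^-1)); last by rewrite gerBl invr_ge0.
  by apply: le_trans h; rewrite /series /= big_nat_recr //= lerDl invr_ge0 exprn_ge0.
elim: n => [|n IH]; first by rewrite /series /= big_nat1 expr1n invr1; lra.
rewrite /series /= big_nat_recr //=.
apply: (le_trans (lerD IH (lexx _))).
have n1 : 0 < n.+1%:R :> R by rewrite ltr0n.
have n2 : 0 < n.+2%:R :> R by rewrite ltr0n.
have E : n.+2%:R = n.+1%:R + 1 :> R by rewrite -natr1.
rewrite -subr_ge0.
have -> : 2 - n.+2%:R^-1 - (2 - n.+1%:R^-1 + (n.+2%:R ^+ 2)^-1) =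
   (n.+1%:R * n.+2%:R ^+ 2)^-1 :> R.
  rewrite E; move: n1; clear; move: (n.+1%:R : R) => x x0.
  by field; rewrite !gt_eqF ?addr_gt0.
by rewrite invr_ge0 mulr_ge0 ?exprn_ge0.
Qed.

End Tannery.

(** * Power series in time with polynomial coefficients *)

Section RapidSeries.
Variables (R : realType) (r : R).
Hypothesis r_gt0 : 0 < r.
Implicit Types A B : nat -> {poly R}.

(** All derivatives and all polynomial weights are included, so that the class is stable under
    differentiation in both variables; boundedness at the weight [j.+2] gives summability at [j]. *)
Definition rapid A := forall i j, exists C, forall n,
  n.+1%:R ^+ j * r ^+ n * l1 (A n)^`(i) <= C.

Lemma rapid_term_ge0 A i j n : 0 <= n.+1%:R ^+ j * r ^+ n * l1 (A n)^`(i).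
Proof. by rewrite mulr_ge0 ?l1_ge0 // mulr_ge0 // exprn_ge0 // ltW. Qed.

Definition qdiff A n : {poly R} := (A n)^`().
Definition tdiff A n : {poly R} := n.+1%:R *: A n.+1.

Lemma rapid_qdiff A : rapid A -> rapid (qdiff A).
Proof. by move=> hA i j; have [C hC] := hA i.+1 j; exists C => n; rewrite /qdiff -derivSn. Qed.

Lemma rapid_tdiff A : rapid A -> rapid (tdiff A).
Proof.
move=> hA i j; have [C hC] := hA i j.+1; exists (C / r) => n.
rewrite ler_pdivlMr // (le_trans _ (hC n.+1)) //.
rewrite /tdiff derivnZ.
have l0 : 0 <= l1 (A n.+1)^`(i) by exact: l1_ge0.
apply: (@le_trans _ _ (n.+1%:R ^+ j * r ^+ n * (n.+1%:R * l1 (A n.+1)^`(i)) * r)).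
  rewrite ler_wpM2r ?(ltW r_gt0) // ler_wpM2l ?mulr_ge0 ?exprn_ge0 ?(ltW r_gt0) //.
  by rewrite (le_trans (l1Z _ _)) // normr_nat.
rewrite [leLHS](_ : _ = n.+1%:R ^+ j.+1 * r ^+ n.+1 * l1 (A n.+1)^`(i)); last by rewrite !exprS; ring.
rewrite ler_wpM2r // ler_wpM2r ?exprn_ge0 ?(ltW r_gt0) //.
by rewrite lerXn2r ?nnegrE // ler_nat.
Qed.

Lemma rapid_summable A i j : rapid A ->
  cvgn (series (fun n => n.+1%:R ^+ j * r ^+ n * l1 (A n)^`(i))).
Proof.
move=> hA; have [C hC] := hA i j.+2.
have C0 : 0 <= C by rewrite (le_trans _ (hC 0)) // rapid_term_ge0.
apply: (@dominated_cvg _ _ (fun n => C *: (n.+1%:R ^+ 2)^-1)); last first.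
  exact: (is_cvg_seriesZ (f := fun n => (n.+1%:R ^+ 2)^-1) (@cvg_series_invsq R)).
move=> n; have l0 : 0 <= l1 (A n)^`(i) by exact: l1_ge0.
rewrite ger0_norm ?rapid_term_ge0 //.
rewrite /GRing.scale /= ler_pdivlMr ?exprn_gt0 ?ltr0n //.
by apply: le_trans (hC n); rewrite le_eqVlt; apply/orP; left; apply/eqP; rewrite !exprS; ring.
Qed.

Definition coefs A x : R^nat := fun n => (A n).[x].
Definition serie A t x : R := limn (pseries (coefs A x) t).

Lemma coefs_tdiff A x : coefs (tdiff A) x = pseries_diffs (coefs A x).
Proof. by apply/funext => n; rewrite /coefs /tdiff hornerZ. Qed.

(** The trivial exponent and derivative of order 0 are kept so that the majorant is literally the
    term of [rapid_summable] for [i = j = 0]. *)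
Lemma serie_dominated A n t x : `|t| <= r -> 0 <= x <= 1 ->
  `|coefs A x n * t ^+ n| <= n.+1%:R ^+ 0 * r ^+ n * l1 (A n)^`(0).
Proof.
move=> tr x01; rewrite normrM expr0 mul1r mulrC ler_pM ?l1_horner //.
by rewrite normrX lerXn2r ?nnegrE ?(ltW r_gt0).
Qed.

Lemma serie_cvg A t x : rapid A -> `|t| <= r -> 0 <= x <= 1 ->
  cvgn (pseries (coefs A x) t).
Proof.
move=> hA tr x01.
apply: (dominated_cvg (u := fun n => coefs A x n * t ^+ n) _ (@rapid_summable A 0 0 hA)) => n.
exact: serie_dominated.
Qed.

Lemma is_derive_serie_t A (t x : R) : rapid A -> `|t| < r -> 0 <= x <= 1 ->
  is_derive t (1 : R) ((serie A)^~ x) (serie (tdiff A) t x).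
Proof.
move=> hA tr x01; rewrite /serie coefs_tdiff.
have rr : `|r| <= r by rewrite ger0_norm ?(ltW r_gt0).
apply: (@pseries_snd_diffs _ _ r); last by rewrite [ltRHS]gtr0_norm.
- exact: serie_cvg.
- by rewrite -coefs_tdiff; apply: serie_cvg => //; exact: rapid_tdiff.
- by rewrite -!coefs_tdiff; apply: serie_cvg => //; do 2 apply: rapid_tdiff.
Qed.

Lemma serie_continuous (V : topologicalType) A (tt qq : V -> R) v : rapid A ->
  `|tt v| < r -> (forall w, 0 <= qq w <= 1) ->
  {for v, continuous tt} -> {for v, continuous qq} ->
  {for v, continuous (fun w => serie A (tt w) (qq w))}.
Proof.
move=> hA tr q01 ct cq; rewrite /serie /pseries.
apply: (tannery (F := nbhs v) (f := fun n w => coefs A (qq w) n * tt w ^+ n)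
   (M := fun n => n.+1%:R ^+ 0 * r ^+ n * l1 (A n)^`(0))); last exact: rapid_summable.
  move=> n; apply: cvgM.
    apply: continuous_comp cq _; exact: continuous_horner.
  exact: (continuous_comp ct (@exprn_continuous _ n _)).
have : \forall w \near v, `|tt w| < r.
  exact: (cvgr_lt _ (cvg_norm ct) _ tr).
by apply: filterS => w /ltW tw n; exact: serie_dominated.
Qed.

(** Termwise differentiation by [tannery] along [h] tending to 0. Composition with [q] is built in
    because the series is only controlled for values in [0, 1]. *)
Lemma is_derive_serie_q (V : normedModType R) A (t : R) (q : V -> R) x v dq :
  rapid A -> `|t| <= r -> (forall y, 0 <= q y <= 1) -> is_derive x v q dq ->
  is_derive x v (fun y => serie A t (q y)) (dq * serie (qdiff A) t (q x)).
Proof.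
move=> hA tr q01 dqx.
have hB := rapid_qdiff hA.
pose dquot h := h^-1 *: (q (h *: v + x) - q x).
have cq : dquot h @[h --> 0^'] --> dq.
  by have := @ex_derive _ _ _ _ _ _ _ dqx; rewrite -(@derive_val _ _ _ _ _ _ _ dqx).
have bq : \forall h \near 0^', `|dquot h| <= `|dq| + 1.
  by apply: (cvgr_le _ (cvg_norm cq)); rewrite ltrDl.
suff H : (fun h => h^-1 *: (((fun y => serie A t (q y)) \o shift x) (h *: v) - serie A t (q x)))
    @ 0^' --> dq * serie (qdiff A) t (q x).
  by apply: DeriveDef; [apply: cvgP H|apply: cvg_lim H].
have E : dq * serie (qdiff A) t (q x) = limn (series (fun n => dq * (coefs (qdiff A) (q x) n * t ^+ n))).
  exact: (esym (lim_seriesZ dq (serie_cvg hB tr (q01 x)))).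
rewrite E.
have -> : (fun h => h^-1 *: (((fun y => serie A t (q y)) \o shift x) (h *: v) - serie A t (q x))) =
   fun h => limn (series (fun n => h^-1 *: ((A n).[q (h *: v + x)] - (A n).[q x]) * t ^+ n)).
  apply/funext => h /=; rewrite /serie.
  have c1 := serie_cvg hA tr (q01 (h *: v + x)); have c2 := serie_cvg hA tr (q01 x).
  rewrite -lim_seriesB // -lim_seriesZ; last exact: is_cvg_seriesB.
  congr (limn (series _)); apply/funext => n /=.
  by rewrite /coefs /GRing.scale /= !fctE /GRing.scale /=; ring.
(* The majorant: near [h = 0] the quotient of [q] is at most [|dq| + 1], and the norm of the
   derivative is a Lipschitz constant of [A n] on [0, 1]. *)
apply: (@tannery R R 0^' _ (fun n h => h^-1 *: ((A n).[q (h *: v + x)] - (A n).[q x]) * t ^+ n) _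
   ( fun n => (`|dq| + 1) *: (n.+1%:R ^+ 0 * r ^+ n * l1 (A n)^`(1) : R))); last first.
- apply: is_cvg_seriesZ; exact: rapid_summable.
- apply: filterS bq => h bh n.
  rewrite normrM /GRing.scale /= normrM.
  have L : `|(A n).[q (h *: v + x)] - (A n).[q x]| <= l1 (A n)^`(1) * `|q (h *: v + x) - q x|.
    by rewrite derivn1; exact: l1_lipschitz.
  rewrite expr0 mul1r [leRHS]mulrCA mulrC ler_pM //.
    by rewrite normrX lerXn2r ?nnegrE ?(ltW r_gt0).
  apply: (le_trans (ler_wpM2l (normr_ge0 _) L)).
  rewrite mulrCA mulrC ler_wpM2r ?l1_ge0 //.
  by apply: le_trans bh; rewrite /dquot normrM.
- move=> n; rewrite mulrA; apply: cvgM; last exact: cvg_cst.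
  have d1 : is_derive (0 : R) 1 (fun h : R => q (h *: v + x)) dq.
    have [dx1 dx2] := dqx.
    apply: DeriveDef; first by move: dx1 => /derivable1P.
    rewrite -dx2 /derive; set g1 := (X in lim (X @ _) = _); set g2 := (X in _ = lim (X @ _)).
    suff -> : g1 = g2 by [].
    by apply/funext => h; rewrite /g1 /g2 /= addr0 scale0r add0r [_%:A]mulr1.
  have d2 : is_derive (q (0 *: v + x)) (1 : R) (horner (A n)) (A n)^`().[q x].
    by rewrite scale0r add0r; exact: is_derive_poly.
  have [d3 d4] := is_derive1_comp d2 d1.
  rewrite mulrC -d4; move: d3; rewrite /derivable /derive.
  set g := (X in cvg (X @ _) -> _) => cg.
  have -> : (fun h : R => h^-1 *: ((A n).[q (h *: v + x)] - (A n).[q x])) = g; last exact: cg.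
  by apply/funext => h; rewrite /g /= scale0r !add0r addr0 [_%:A]mulr1.
Qed.

End RapidSeries.

(** * Smooth functions on the slab *)

Lemma continuous_fst (U V : topologicalType) : continuous (fst : U * V -> U).
Proof. by move=> [u v]; exact: cvg_fst. Qed.

Lemma continuous_snd (U V : topologicalType) : continuous (snd : U * V -> V).
Proof. by move=> [u v]; exact: cvg_snd. Qed.

Section Coordinates.
Variable R : realType.
Implicit Types x v : space3 R.

Definition coord (j : 'I_3) x : R := [:: x.1.1; x.1.2; x.2]`_j.

Lemma coordD j x v : coord j (x + v) = coord j x + coord j v.
Proof. by case: j => [[|[|[|j]]] Hj]. Qed.

Lemma coordZ j (h : R) v : coord j (h *: v) = h * coord j v.
Proof. by case: j => [[|[|[|j]]] Hj]. Qed.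

Lemma coord_basis3 i j : coord i (basis3 R j) = (i == j)%:R.
Proof. by case: i => [[|[|[|i]]] Hi]; case: j => [[|[|[|j]]] Hj]. Qed.

Lemma coord_continuous j : continuous (coord j).
Proof.
move=> x; case: j => [[|[|[|j]]] Hj] //; rewrite /coord /=.
- exact: (continuous_comp (@continuous_fst _ _ x) (@continuous_fst _ _ x.1)).
- exact: (continuous_comp (@continuous_fst _ _ x) (@continuous_snd _ _ x.1)).
- exact: continuous_snd.
Qed.

Lemma is_derive_coord j x v : is_derive x v (coord j) (coord j v).
Proof.
have H : (fun h : R => h^-1 *: ((coord j \o shift x) (h *: v) - coord j x)) @ 0^' --> coord j v.
  apply: cvg_trans (cvg_cst _ : (fun=> coord j v) @ 0^' --> coord j v).
  apply: near_eq_cvg; near=> h.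
  rewrite /= coordD coordZ addrK /GRing.scale /= mulKf //.
  by near: h; exact: nbhs_dnbhs_neq.
by apply: DeriveDef; [apply: cvgP H|apply: cvg_lim H].
Unshelve. all: by end_near. Qed.

Definition norm2 x : R := \sum_(j < 3) coord j x ^+ 2.

Lemma norm2_ge0 x : 0 <= norm2 x.
Proof. by apply: sumr_ge0 => j _; exact: sqr_ge0. Qed.

Lemma is_derive_norm2 i x : is_derive x (basis3 R i) norm2 (2 * coord i x).
Proof.
have -> : norm2 = \sum_(j < 3) (coord j) ^+ 2.
  by apply/funext => y; rewrite /norm2 fct_sumE.
have d j : is_derive x (basis3 R i) (coord j) ((j == i)%:R).
  by rewrite -coord_basis3; exact: is_derive_coord.
have -> : 2 * coord i x = \sum_(j < 3) (2%:R * coord j x ^+ 2.-1) *: ((j == i)%:R : R).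
  rewrite (bigD1 i) //= eqxx expr1 big1 ?addr0 => [|j /negbTE ->].
    by rewrite /GRing.scale /= mulr1.
  by rewrite /GRing.scale /= mulr0.
by apply: is_derive_sum => j; exact: is_deriveX.
Qed.

Variable d2 : R.
Hypothesis d2_ge0 : 0 <= d2.

Definition hump x : R := (1 + d2 * norm2 x)^-1.

Lemma hump_den_ge1 x : 1 <= 1 + d2 * norm2 x.
Proof. by rewrite lerDl mulr_ge0 ?norm2_ge0. Qed.

Lemma hump_den_gt0 x : 0 < 1 + d2 * norm2 x.
Proof. exact: lt_le_trans ltr01 (hump_den_ge1 x). Qed.

Lemma hump_gt0 x : 0 < hump x.
Proof. by rewrite invr_gt0 hump_den_gt0. Qed.

Lemma hump01 x : 0 <= hump x <= 1.
Proof. by rewrite ltW ?hump_gt0 //= invf_le1 ?hump_den_ge1 // hump_den_gt0. Qed.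

(** The relation that eliminates $|x|^2$ from the Laplacian and from the gradient. *)
Lemma hump_norm2 x : hump x * (d2 * norm2 x) = 1 - hump x.
Proof.
have : hump x * (1 + d2 * norm2 x) = 1 by rewrite mulVf // gt_eqF // hump_den_gt0.
by rewrite mulrDr mulr1 => <-; rewrite addrAC subrr add0r.
Qed.

Lemma is_derive_hump i x :
  is_derive x (basis3 R i) hump (- (2 * d2) * (coord i x * hump x ^+ 2)).
Proof.
have d1 : is_derive x (basis3 R i) (cst 1 + (d2 \*: norm2 : space3 R -> R)) (d2 * (2 * coord i x)).
  rewrite -[d2 * _]add0r.
  apply: is_deriveD; apply: is_deriveZ; exact: is_derive_norm2.
have nz : (cst 1 + (d2 \*: norm2 : space3 R -> R)) x != 0.
  by rewrite gt_eqF //; exact: hump_den_gt0.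
have [e1 e2] := d1.
apply: DeriveDef; first exact: (derivableV nz).
rewrite [LHS](deriveV nz) // e2 /hump /GRing.scale /= exprVn; ring.
Qed.

Lemma norm2_continuous : continuous norm2.
Proof.
move=> x; have E : norm2 = (fun x => coord 0 x ^+ 2 + coord 1 x ^+ 2 + coord 2%:R x ^+ 2).
  by apply/funext => y; rewrite /norm2 !big_ord_recl big_ord0 addr0 addrA.
rewrite E; have c j : {for x, continuous (fun y => coord j y ^+ 2)}.
  exact: (continuous_comp (@coord_continuous j x) (@exprn_continuous _ 2 _)).
by apply: cvgD; [apply: cvgD|]; exact: c.
Qed.

Lemma hump_continuous : continuous hump.
Proof.
move=> x; apply: cvgV; first by rewrite gt_eqF ?hump_den_gt0.
by apply: cvgD; [exact: cvg_cst|apply: cvgM; [exact: cvg_cst|exact: norm2_continuous]].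
Qed.

End Coordinates.

(** * A differential algebra containing the solution *)

Section SlabAlgebra.
Variables (R : realType) (d2 r : R).
Hypotheses (d2_ge0 : 0 <= d2) (r_gt0 : 0 < r).

Definition hump_serie (A : nat -> {poly R}) (t : R) (x : space3 R) : R := serie A t (hump d2 x).

(** Closed under the time derivative and all space derivatives, so that smoothness needs no formula
    for higher derivatives. Coordinates and the hump are included because the gradient of the hump
    produces them. *)
Inductive slab_alg : (R -> space3 R -> R) -> Prop :=
| slab_cst c : slab_alg (fun _ _ => c)
| slab_coord j : slab_alg (fun _ => coord j)
| slab_hump : slab_alg (fun _ => hump d2)
| slab_serie A : rapid r A -> slab_alg (hump_serie A)
| slab_add f g : slab_alg f -> slab_alg g -> slab_alg (fun t x => f t x + g t x)
| slab_mul f g : slab_alg f -> slab_alg g -> slab_alg (fun t x => f t x * g t x).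

Lemma slab_alg_continuous f : slab_alg f -> forall z : R * space3 R, `|z.1| < r ->
  {for z, continuous (fun z : R * space3 R => f z.1 z.2)}.
Proof.
elim=> {f} [c|j||A hA|f g _ hf _ hg|f g _ hf _ hg] z zr.
- exact: cvg_cst.
- exact: (continuous_comp (@continuous_snd _ _ z) (@coord_continuous R j z.2)).
- exact: (continuous_comp (@continuous_snd _ _ z) (@hump_continuous _ _ d2_ge0 z.2)).
- apply: (serie_continuous r_gt0 hA zr (fun w => hump01 d2_ge0 w.2)); first exact: continuous_fst.
  exact: (continuous_comp (@continuous_snd _ _ z) (@hump_continuous _ _ d2_ge0 z.2)).
- by apply: cvgD; [exact: hf|exact: hg].
- by apply: cvgM; [exact: hf|exact: hg].
Qed.

Lemma slab_alg_dt f : slab_alg f -> exists2 g, slab_alg g &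
  forall (t : R) x, `|t| < r -> is_derive t (1 : R) (f^~ x) (g t x).
Proof.
elim=> {f} [c|j||A hA|f g hf [f' hf' df] hg [g' hg' dg]|f g hf [f' hf' df] hg [g' hg' dg]].
- by exists (fun _ _ => 0); [exact: slab_cst|move=> t x _; exact: is_derive_cst].
- by exists (fun _ _ => 0); [exact: slab_cst|move=> t x _; exact: is_derive_cst].
- by exists (fun _ _ => 0); [exact: slab_cst|move=> t x _; exact: is_derive_cst].
- exists (hump_serie (tdiff A)); first exact/slab_serie/rapid_tdiff.
  by move=> t x tr; apply: (is_derive_serie_t r_gt0 hA tr); exact: hump01.
- exists (fun t x => f' t x + g' t x); first exact: slab_add.
  by move=> t x tr; exact: is_deriveD (df t x tr) (dg t x tr).
- exists (fun t x => f t x * g' t x + g t x * f' t x).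
    by apply: slab_add; exact: slab_mul.
  by move=> t x tr; exact: is_deriveM (df t x tr) (dg t x tr).
Qed.

Lemma slab_alg_dx i f : slab_alg f -> exists2 g, slab_alg g &
  forall (t : R) x, `|t| < r -> is_derive x (basis3 R i) (f t) (g t x).
Proof.
pose b := fun (_ : R) x => - (2 * d2) * (coord i x * hump d2 x ^+ 2).
have hb : slab_alg b.
  apply: slab_mul; first exact: slab_cst.
  apply: slab_mul; first exact: slab_coord.
  by apply: slab_mul; exact: slab_hump.
elim=> {f} [c|j||A hA|f g hf [f' hf' df] hg [g' hg' dg]|f g hf [f' hf' df] hg [g' hg' dg]].
- by exists (fun _ _ => 0); [exact: slab_cst|move=> t x _; exact: is_derive_cst].
- exists (fun _ _ => (j == i)%:R); first exact: slab_cst.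
  by move=> t x _; rewrite -coord_basis3; exact: is_derive_coord.
- by exists b => // t x _; exact: is_derive_hump.
- exists (fun t x => b t x * hump_serie (qdiff A) t x).
    by apply: slab_mul => //; apply: slab_serie; exact: rapid_qdiff.
  move=> t x /ltW tr; apply: (is_derive_serie_q r_gt0) => //; first by move=> y; exact: hump01.
  exact: is_derive_hump.
- exists (fun t x => f' t x + g' t x); first exact: slab_add.
  by move=> t x tr; exact: is_deriveD (df t x tr) (dg t x tr).
- exists (fun t x => f t x * g' t x + g t x * f' t x).
    by apply: slab_add; exact: slab_mul.
  by move=> t x tr; exact: is_deriveM (df t x tr) (dg t x tr).
Qed.

End SlabAlgebra.

(** * One-sided time derivatives on the slab *)

Section Slab.
Variables (R : realType) (T : R).
Hypothesis T_gt0 : 0 < T.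
Implicit Types (f g : R -> space3 R -> R).

(** Properness is what lets a limit of quotients be identified with [lim]. Small positive increments
    are admissible for [t < T], negative ones at [t = T]. *)
Lemma slab_filter t : t \in `[0, T] ->
  ProperFilter (within [set h : R | h + t \in `[0, T]] 0^').
Proof.
rewrite in_itv /= => /andP[t0 tT].
have half (m : R) : 0 < m -> m / 2 < m by move=> m0; lra.
apply: Build_ProperFilter_ex => A; rewrite /within /= => -[e /= e0 he].
have [tT'|Tt] := ltP t T.
  pose h := Num.min e (T - t) / 2.
  have h0 : 0 < h by rewrite divr_gt0 // lt_min e0 subr_gt0.
  have hm : h < Num.min e (T - t) by apply: half; rewrite lt_min e0 subr_gt0.
  move: hm; rewrite lt_min => /andP[h1 h2].
  exists h; apply: he => /=; [by rewrite sub0r normrN gtr0_norm|by rewrite gt_eqF|].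
  rewrite in_itv /=; apply/andP; split; first by rewrite addr_ge0 ?(ltW h0).
  by move: h2; rewrite ltrBrDr => /ltW.
pose h := Num.min e T / 2.
have h0 : 0 < h by rewrite divr_gt0 // lt_min e0.
have hm : h < Num.min e T by apply: half; rewrite lt_min e0.
move: hm; rewrite lt_min => /andP[h1 h2].
exists (- h); apply: he => /=; [by rewrite sub0r opprK gtr0_norm|by rewrite lt_eqF // oppr_lt0|].
by rewrite in_itv /=; apply/andP; split; move: h2 h0 Tt tT; lra.
Qed.

Lemma quotients_eq (g1 g2 : R -> R) t : t \in `[0, T] -> {in `[0, T], g1 =1 g2} ->
  quotients T g1 t = quotients T g2 t.
Proof.
move=> tT g12; apply/funext => A; apply/propext.
rewrite /quotients /= /within /=; split; rewrite !nbhs_simpl /=;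
  apply: filterS => h hA hT; move: (hA hT); by rewrite /= !g12.
Qed.

Lemma is_derive_quotients (g : R -> R) t l : is_derive t (1 : R) g l ->
  quotients T g t --> l.
Proof.
move=> [gt <-]; apply: cvg_within_filter.
move: gt; rewrite /derivable /derive.
set g1 := (X in cvg (X @ _) -> _) => cg.
have -> : (fun h : R => h^-1 *: (g (h + t) - g t)) = g1; last exact: cg.
by apply/funext => h; rewrite /g1 /= [_%:A]mulr1.
Qed.

Lemma is_derive_lim_quotients (g : R -> R) t l : t \in `[0, T] ->
  is_derive t (1 : R) g l -> lim (quotients T g t) = l.
Proof.
move=> tT dg; have F := slab_filter tT.
by apply: cvg_lim => //; exact: is_derive_quotients.
Qed.

Definition slab_eq f g := forall t x, t \in `[0, T] -> f t x = g t x.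

Lemma slab_eq_dt f g : slab_eq f g -> slab_eq (dt T f) (dt T g).
Proof.
by move=> fg t x tT; rewrite /dt (@quotients_eq _ (g^~ x)) // => s sT; exact: fg.
Qed.

Lemma slab_eq_dx j f g : slab_eq f g -> slab_eq (dx j f) (dx j g).
Proof.
move=> fg t x tT; rewrite /dx; have -> // : f t = g t by apply/funext => y; exact: fg.
Qed.

(** Formulas for [dt] hold only on the slab, where equality is all that regularity depends on. *)
Lemma Cn_slab_eq n f g : slab_eq f g -> Cn_slab T n f -> Cn_slab T n g.
Proof.
elim: n f g => [|n IH] f g fg /= [cf hf].
- split => //; move: cf; apply: subspace_eq_continuous => z /set_mem /= zT; exact: fg.
- split; first by move: cf; apply: subspace_eq_continuous => z /set_mem /= zT; exact: fg.
  case: hf => h1 h2 h3 h4; split.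
  + by move=> t x tT; rewrite -(@quotients_eq (f^~ x)) //; [exact: h1|move=> s sT; exact: fg].
  + move=> j t x tT; have <- : f t = g t by apply/funext => y; exact: fg.
    exact: h2.
  + by apply: IH h3; exact: slab_eq_dt.
  + by move=> j; apply: IH (h4 j); exact: slab_eq_dx.
Qed.

Lemma slab_slice_continuous f t : t \in `[0, T] ->
  {within [set z : R * space3 R | z.1 \in `[0, T]],
     continuous (fun z : R * space3 R => f z.1 z.2)} ->
  continuous (f t).
Proof.
move=> tT /subspace_continuousP /= cf x; apply: cvg_trans (cf (t, x) tT).
move=> B /= hB.
have ctx : (t, y) @[y --> x] --> nbhs (t, x).
  exact: (cvg_pair (f := fun _ : space3 R => t) (g := id) (cvg_cst t) cvg_id).
by move: (ctx _ hB) => /=; rewrite !nbhs_simpl /=; apply: filterS => y; apply.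
Qed.

Lemma Cn_slab_slice n f t : t \in `[0, T] -> Cn_slab T n f -> Cn n (f t).
Proof.
move=> tT; elim: n f => [|n IH] f /= [cf hf]; split => //; try exact: slab_slice_continuous.
move=> j; case: hf => h1 h2 h3 h4; split; first by move=> x; exact: h2.
exact: IH (h4 j).
Qed.

Lemma slab_norm (r t : R) : T < r -> t \in `[0, T] -> `|t| < r.
Proof. by move=> Tr; rewrite in_itv /= => /andP[t0 tT]; rewrite ger0_norm // (le_lt_trans tT). Qed.

(** Stated for the whole algebra, since the induction on the order passes from a function to its
    derivatives. *)
Lemma slab_alg_smooth (d2 r : R) f : 0 <= d2 -> T < r -> slab_alg d2 r f -> smooth_slab T f.
Proof.
move=> d20 Tr hf n; have r0 : 0 < r by exact: lt_trans Tr.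
elim: n f hf => [|n IH] f hf /=; split => //.
- apply: continuous_in_subspaceT => z /set_mem /= zT.
  by apply: (slab_alg_continuous d20 r0 hf); exact: slab_norm.
- apply: continuous_in_subspaceT => z /set_mem /= zT.
  by apply: (slab_alg_continuous d20 r0 hf); exact: slab_norm.
- have [g hg dg] := slab_alg_dt d20 r0 hf.
  have dxf j := slab_alg_dx d20 r0 j hf.
  split.
  + move=> t x tT; apply/cvg_ex; exists (g t x).
    by apply: is_derive_quotients; apply: dg; exact: slab_norm.
  + move=> j t x tT; have [gj _ dgj] := dxf j.
    by have [] := dgj t x (slab_norm Tr tT).
  + apply: Cn_slab_eq (IH _ hg) => t x tT.
    by rewrite /dt (is_derive_lim_quotients tT (dg t x (slab_norm Tr tT))).
  + move=> j; have [gj hgj dgj] := dxf j.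
    apply: Cn_slab_eq (IH _ hgj) => t x tT.
    by have [_ <-] := dgj t x (slab_norm Tr tT).
Qed.

End Slab.

(** * From geometric to rapid decay *)

Lemma bin_le_exp2 n m : ('C(n, m) <= 2 ^ n)%N.
Proof.
elim: n m => [|n IH] [|m]; rewrite ?bin0 ?bin0n ?expn_gt0 //.
by rewrite binS expnS mul2n -addnn leq_add.
Qed.

(** Compare with the falling factorial [(n + p) ^_ p], which is [p!] times a binomial
    coefficient. *)
Lemma exp_le_fact_exp2 n p : (n.+1 ^ p <= p`! * 2 ^ (n + p))%N.
Proof.
apply: (@leq_trans ((n + p) ^_ p)); last by rewrite -bin_ffact mulnC leq_mul2l bin_le_exp2 orbT.
elim: p => [|p IH] //; rewrite addnS ffactSS expnS leq_mul //.
by rewrite ltnS leq_addr.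
Qed.

Section SerieBounds.
Variables (R : realType) (r : R).
Hypothesis r_gt0 : 0 < r.
Implicit Types A B : nat -> {poly R}.

(** The [i]-th derivative costs [(D * n.+1) ^ i]; the factor [2 ^ n] between the radii [r] and
    [2 * r] absorbs all powers of [n.+1]. *)
Lemma rapid_geometric A C D :
  (forall n, l1 (A n) * (2 * r) ^+ n <= C) -> (forall n, (size (A n) <= D * n.+1)%N) ->
  rapid r A.
Proof.
move=> AC AD i j; exists (D%:R ^+ i * ((i + j)`! * 2 ^ (i + j))%:R * C) => n.
have l0 : 0 <= l1 (A n) by exact: l1_ge0.
have di : l1 (A n)^`(i) <= (D * n.+1)%:R ^+ i * l1 (A n).
  elim: i => [|i IH]; first by rewrite mul1r.
  rewrite derivnS exprS -mulrA.
  apply: (@le_trans _ _ ((D * n.+1)%:R * l1 (A n)^`(i))); last by rewrite ler_wpM2l.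
  apply: l1_deriv; rewrite ltnW // ltnS (leq_trans _ (AD n)) //.
  by elim: i {IH} => [|i IH] //; rewrite derivnS (leq_trans (size_poly _ _)) // (leq_trans (leq_pred _)).
apply: (@le_trans _ _ (n.+1%:R ^+ j * r ^+ n * ((D * n.+1)%:R ^+ i * l1 (A n)))).
  by rewrite ler_wpM2l // mulr_ge0 // exprn_ge0 // ltW.
apply: (@le_trans _ _ (D%:R ^+ i * (n.+1 ^ (i + j))%:R * (l1 (A n) * r ^+ n))).
  rewrite le_eqVlt; apply/orP; left; apply/eqP.
  by rewrite natrM exprMn natrX exprD; ring.
apply: (@le_trans _ _ (D%:R ^+ i * ((i + j)`! * 2 ^ (n + (i + j)))%:R * (l1 (A n) * r ^+ n))).
  rewrite ler_wpM2r ?mulr_ge0 ?exprn_ge0 ?(ltW r_gt0) // ler_wpM2l ?exprn_ge0 //.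
  by rewrite ler_nat exp_le_fact_exp2.
have -> : D%:R ^+ i * ((i + j)`! * 2 ^ (n + (i + j)))%:R * (l1 (A n) * r ^+ n) =
  D%:R ^+ i * ((i + j)`! * 2 ^ (i + j))%:R * (l1 (A n) * (2 * r) ^+ n).
  by rewrite expnD !natrM exprMn !natrX; ring.
by rewrite ler_wpM2l // mulr_ge0 // exprn_ge0.
Qed.

Lemma serie_bounded A : rapid r A -> exists2 C, 0 <= C &
  forall t x, `|t| <= r -> 0 <= x <= 1 -> `|serie A t x| <= C.
Proof.
move=> hA; pose M n := n.+1%:R ^+ 0 * r ^+ n * l1 (A n)^`(0).
have cM : cvgn (series M) by exact: rapid_summable.
have bnd t x : `|t| <= r -> 0 <= x <= 1 -> `|serie A t x| <= limn (series M).
  move=> tr x01; have h n : `|coefs A x n * t ^+ n| <= M n by exact: serie_dominated.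
  by have := dominated_tail 0 h cM; rewrite /series /= !big_geq // !subr0.
exists (limn (series M)) => //; apply: le_trans (bnd 0 0 _ _); rewrite ?normr0 ?lexx ?ler01 ?(ltW r_gt0) //.
Qed.

(** The relation is assumed at the single point [x], so [c1] and [c2] may depend on it. In this way
    multiplication by $q^2$ and [lap] pass through the sum, and convergence for [A] comes for
    free. *)
Lemma serie_lin A B C t x c1 c2 : rapid r B -> rapid r C -> `|t| <= r -> 0 <= x <= 1 ->
  (forall n, (A n).[x] = c1 * (B n).[x] + c2 * (C n).[x]) ->
  cvgn (pseries (coefs A x) t) /\ serie A t x = c1 * serie B t x + c2 * serie C t x.
Proof.
move=> hB hC tr x01 E.
have cB := serie_cvg r_gt0 hB tr x01; have cC := serie_cvg r_gt0 hC tr x01.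
have H : pseries (coefs A x) t @ \oo --> c1 * serie B t x + c2 * serie C t x.
  have -> : pseries (coefs A x) t =
      (fun N => c1 * pseries (coefs B x) t N + c2 * pseries (coefs C x) t N).
    apply/funext => N; rewrite /pseries /series /= !mulr_sumr -big_split /=.
    by apply: eq_bigr => n _; rewrite /coefs E; ring.
  by apply: cvgD; apply: cvgM => //; exact: cvg_cst.
by split; [apply: cvgP H|apply: cvg_lim H].
Qed.

End SerieBounds.

(** * The solution *)

Lemma horner_lap (R : realFieldType) (p : {poly R}) b :
  (lap p).[b] = (2 * b ^+ 2 - 8%:R * b ^+ 3) * p^`().[b]
    + (4%:R * b ^+ 3 - 4%:R * b ^+ 4) * p^`()^`().[b].
Proof.
rewrite /lap derivM derivXn /= !(hornerE, hornerMn, hornerXn) /=; ring.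
Qed.

Lemma linear_size_bound (m n c : nat) : (m * n + c <= (m + c) * n.+1)%N.
Proof. by rewrite mulnS mulnDl; lia. Qed.

Section Solution.
Variables (R : realType) (k : nat) (sg d2 eps r T : R).
Hypotheses (k_ge3 : (3 <= k)%N) (k_odd : odd k) (sg1 : `|sg| = 1) (T_gt0 : 0 < T) (Tr : T < r)
  (d2_gt0 : 0 < d2) (eps_gt0 : 0 < eps).
(** The majorant runs on twice the radius [r] of differentiation, as [rapid_geometric] requires. *)
Let s := 2 * r.
Hypotheses (small_d2 : 344%:R * k%:R ^+ 2 * d2 * s ^+ 2 <= 8%:R^-1)
  (small_eps : (2 * s) ^+ k.+1 * eps ^+ k.-1 <= 8%:R^-1).

Let r_gt0 : 0 < r := lt_trans T_gt0 Tr.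
Let s_gt0 : 0 < s. Proof. by rewrite mulr_gt0. Qed.
Let rs : r <= s. Proof. by rewrite /s; have := r_gt0; lra. Qed.
Let d2_ge0 := ltW d2_gt0.
Let k_ge2 : (2 <= k)%N := ltnW k_ge3.

(** The hypothesis [small_eps] is the stronger bound because it also has to control the potential
    energy in [density_lower]. *)
Let small_eps' : s * (2 * s) ^+ k * eps ^+ k.-1 <= 4%:R^-1.
Proof. by move: small_eps; rewrite exprS; lra. Qed.

Let V := profile k sg d2 eps.
Let B n : {poly R} := 'X^2 * V n.

Definition solution : R -> space3 R -> R := hump_serie d2 B.

Lemma rapid_profile : rapid r V.
Proof.
apply: (@rapid_geometric _ _ r_gt0 V (2 * s * eps) (2 * k + 1)) => n.
  have := profile_sum k_ge2 s_gt0 eps_gt0 d2_ge0 sg1 small_d2 small_eps' n.+1.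
  apply: le_trans; rewrite big_ord_recr /= lerDr sumr_ge0 // => i _.
  by rewrite mulr_ge0 ?l1_ge0 // exprn_ge0 // ltW.
exact: (leq_trans (size_profile _ _ _ k_ge2 n) (linear_size_bound _ _ _)).
Qed.

Lemma rapid_solution : rapid r B.
Proof.
apply: (@rapid_geometric _ _ r_gt0 B (2 * s * eps) (2 * k + 3)) => n.
  have := profile_sum k_ge2 s_gt0 eps_gt0 d2_ge0 sg1 small_d2 small_eps' n.+1.
  apply: le_trans; rewrite big_ord_recr /= ler_wpDl ?sumr_ge0 // => [i _|].
    by rewrite mulr_ge0 ?l1_ge0 // exprn_ge0 // ltW.
  rewrite ler_wpM2r ?exprn_ge0 ?(ltW s_gt0) // (le_trans (l1M _ _)) //.
  by rewrite ler_piMl ?l1_ge0 ?l1Xn.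
rewrite (leq_trans (size_polyMleq _ _)) // size_polyXn /=.
apply: (leq_trans (leq_add (leqnn 2) (size_profile sg d2 eps k_ge2 n))).
by rewrite addnCA linear_size_bound.
Qed.

Lemma slab_alg_solution : slab_alg d2 r solution.
Proof. exact: slab_serie rapid_solution. Qed.

Lemma solution_smooth : smooth_slab T solution.
Proof. exact: slab_alg_smooth d2_ge0 Tr slab_alg_solution. Qed.

Let time_in t : t \in `[0, T] -> `|t| < r.
Proof. exact: slab_norm. Qed.

Lemma solution_dt : slab_eq T (dt T solution) (hump_serie d2 (tdiff B)).
Proof.
move=> t x tT; apply: (is_derive_lim_quotients T_gt0 tT).
exact: (is_derive_serie_t r_gt0 rapid_solution (time_in tT) (hump01 d2_ge0 x)).
Qed.

Lemma solution_dtt : slab_eq T (dt T (dt T solution)) (hump_serie d2 (tdiff (tdiff B))).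
Proof.
move=> t x tT; rewrite (slab_eq_dt solution_dt x tT).
apply: (is_derive_lim_quotients T_gt0 tT).
exact: (is_derive_serie_t r_gt0 (rapid_tdiff r_gt0 rapid_solution) (time_in tT) (hump01 d2_ge0 x)).
Qed.

Let P := hump_serie d2 (qdiff B).
Let Q := hump_serie d2 (qdiff (qdiff B)).

Lemma solution_dx j : slab_eq T (dx j solution)
  (fun t x => - (2 * d2) * (coord j x * hump d2 x ^+ 2) * P t x).
Proof.
move=> t x tT; have [_ <- //] := is_derive_serie_q r_gt0 rapid_solution (ltW (time_in tT))
  (hump01 d2_ge0) (is_derive_hump d2_ge0 j x).
Qed.

Lemma solution_dxx j : slab_eq T (dx j (dx j solution))
  (fun t x => (- (2 * d2) * hump d2 x ^+ 2 + 8%:R * d2 ^+ 2 * coord j x ^+ 2 * hump d2 x ^+ 3) * P t x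
    + 4%:R * d2 ^+ 2 * coord j x ^+ 2 * hump d2 x ^+ 4 * Q t x).
Proof.
move=> t x tT; rewrite (slab_eq_dx j (solution_dx j) x tT).
have db := is_derive_hump d2_ge0 j x.
have dc : is_derive x (basis3 R j) (coord j) 1.
  by have := is_derive_coord j x (basis3 R j); rewrite coord_basis3 eqxx.
have dP := is_derive_serie_q r_gt0 (rapid_qdiff rapid_solution) (ltW (time_in tT))
  (hump01 d2_ge0) db.
have d1 := is_deriveM (is_deriveZ (- (2 * d2)) (is_deriveM dc (is_deriveX 2 db))) dP.
have [_ e] := d1; apply: etrans (etrans e _); first by [].
rewrite /GRing.scale /= /P /Q /hump_serie !fctE /GRing.scale /=.
by ring.
Qed.

Lemma laplacian_solution t x : t \in `[0, T] ->
  \sum_(j < 3) dx j (dx j solution) t x = d2 * hump_serie d2 (fun n => lap (B n)) t x.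
Proof.
move=> tT; under eq_bigr do rewrite solution_dxx //.
set b := hump d2 x; have bn : b * (d2 * norm2 x) = 1 - b := hump_norm2 d2_ge0 x.
have [_ E] := serie_lin r_gt0 (rapid_qdiff rapid_solution) (rapid_qdiff (rapid_qdiff rapid_solution))
  (ltW (time_in tT)) (hump01 d2_ge0 x) (fun n => horner_lap (B n) b).
rewrite [hump_serie _ _ _ _]E.
rewrite -/(hump_serie d2 (qdiff B) t x) -/(hump_serie d2 (qdiff (qdiff B)) t x) -/(P t x) -/(Q t x).
(* The terms in $|x|^2$ are grouped as [b * (d2 * norm2 x)], which [bn] turns into [1 - b]. *)
transitivity ((- (6%:R * d2) * b ^+ 2 + 8%:R * d2 * (b * (d2 * norm2 x)) * b ^+ 2) * P t x
  + 4%:R * d2 * (b * (d2 * norm2 x)) * b ^+ 3 * Q t x).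
  by rewrite /norm2 !big_ord_recl !big_ord0; ring.
by rewrite bn; ring.
Qed.

(** The partial sums are compared with the [k]-th powers of those of [V]; by [trunc_power] the
    difference tends to 0, as [|t| <= r < s]. *)
Lemma power_series_cvg t x : `|t| <= r -> 0 <= x <= 1 ->
  series (fun n => (power_coef k sg d2 eps n).[x] * t ^+ n) @ \oo --> serie V t x ^+ k.
Proof.
move=> tr x01; have ts : `|t| <= s by exact: le_trans rs.
have c1 : (fun N => series (fun n => coefs V x n * t ^+ n) N.+1 ^+ k) @ \oo --> serie V t x ^+ k.
  apply: (@cvg_comp _ _ _ (fun N => series (fun n => coefs V x n * t ^+ n) N.+1) (fun y : R => y ^+ k) _ (nbhs (serie V t x))); last exact: exprn_continuous.
  by rewrite (cvg_shiftS (series _)); exact: (serie_cvg r_gt0 rapid_profile tr x01).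
have c2 : (fun N => (`|t| / s) ^+ N.+1 * (2 * s * eps) ^+ k) @ \oo --> (0 : R).
  rewrite -[X in _ --> X](mul0r ((2 * s * eps) ^+ k)); apply: cvgM; last exact: cvg_cst.
  rewrite (cvg_shiftS (fun N => (`|t| / s) ^+ N)); apply: cvg_expr.
  rewrite ger0_norm ?divr_ge0 ?(ltW s_gt0) // ltr_pdivrMr // mul1r (le_lt_trans tr) //.
  by rewrite /s; have := r_gt0; lra.
rewrite -(cvg_shiftS (series _)).
apply/cvgrPdist_le => e e0.
have e2 : 0 < e / 2 by rewrite divr_gt0.
have n1 : \forall N \near \oo, `|serie V t x ^+ k - series (fun n => coefs V x n * t ^+ n) N.+1 ^+ k| <= e / 2.
  by move/cvgrPdist_le : c1; apply.
have n2 : \forall N \near \oo, `|0 - (`|t| / s) ^+ N.+1 * (2 * s * eps) ^+ k| <= e / 2.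
  by move/cvgrPdist_le : c2; apply.
near=> N.
have h1 : `|serie V t x ^+ k - series (fun n => coefs V x n * t ^+ n) N.+1 ^+ k| <= e / 2.
  by near: N.
have h2 : `|0 - (`|t| / s) ^+ N.+1 * (2 * s * eps) ^+ k| <= e / 2 by near: N.
have h3 := trunc_power k_ge2 s_gt0 eps_gt0 d2_ge0 sg1 small_d2 small_eps' N ts x01.
rewrite -[X in X - _](subrK (series (fun n => coefs V x n * t ^+ n) N.+1 ^+ k)) -addrA.
rewrite (le_trans (ler_normD _ _)) // (splitr e) lerD //.
rewrite sub0r normrN in h2; apply: le_trans (le_trans (ler_norm _) h2).
by move: h3; rewrite /series /= !big_mkord.
Unshelve. all: by end_near. Qed.

Lemma solutionE t x : `|t| <= r -> solution t x = hump d2 x ^+ 2 * hump_serie d2 V t x.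
Proof.
move=> tr; set b := hump d2 x.
have BV n : (B n).[b] = b ^+ 2 * (V n).[b] + 0 * (V n).[b].
  by rewrite /B hornerM hornerXn mul0r addr0.
have [_ E] := serie_lin r_gt0 rapid_profile rapid_profile tr (hump01 d2_ge0 x) BV.
by rewrite [solution _ _]E mul0r addr0.
Qed.

Lemma solution_pde t x : t \in `[0, T] ->
  box T solution t x = sg * (`|solution t x| ^+ k.-1 * solution t x).
Proof.
move=> tT; rewrite /box laplacian_solution // solution_dtt //.
have tr := ltW (time_in tT).
have -> : `|solution t x| ^+ k.-1 * solution t x = solution t x ^+ k.
  (* Since [k.-1] is even, the absolute value disappears and the nonlinearity is [u ^+ k]. *)
  have ke : ~~ odd k.-1 by have := k_odd; rewrite -{1}[k]prednK ?(ltnW k_ge2).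
  rewrite -normrX ger0_norm ?exprn_even_ge0 //.
  by rewrite -exprSr prednK // ltnW.
set b := hump d2 x; have b01 : 0 <= b <= 1 := hump01 d2_ge0 x.
have [cl _] := serie_lin r_gt0 (rapid_qdiff rapid_solution) (rapid_qdiff (rapid_qdiff rapid_solution))
  tr b01 (fun n => horner_lap (B n) b).
suff -> : hump_serie d2 (tdiff (tdiff B)) t x =
    d2 * hump_serie d2 (fun n => lap (B n)) t x - sg * solution t x ^+ k by ring.
rewrite solutionE // exprMn -/b -exprM.
apply: cvg_lim => //.
have HX n (p : {poly R}) : ('X^n * p).[b] = b ^+ n * p.[b] by rewrite hornerM hornerXn.
(* The recursion makes the equation hold exactly between partial sums; only their limits remain to
   be taken. *)
have -> : pseries (coefs (tdiff (tdiff B)) b) t = (fun N => d2 * pseries (coefs (fun n => lap (B n)) b) t N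
   - sg * (b ^+ (2 * k) * series (fun n => (power_coef k sg d2 eps n).[b] * t ^+ n) N)).
  apply/funext => N; rewrite /pseries /series /= !mulr_sumr -sumrB; apply: eq_bigr => n _.
  rewrite /coefs /tdiff /B lap_X2 !hornerZ !HX [V n.+2]profileSS -/V.
  rewrite hornerZ hornerD hornerN !hornerZ HX.
  have -> : b ^+ (2 * k) = b ^+ 2 * b ^+ (2 * k - 2) by rewrite -exprD subnKC // leq_pmulr // ltnW // ltnW.
  have n1 : n.+1%:R != 0 :> R by rewrite pnatr_eq0.
  have n2 : n.+2%:R != 0 :> R by rewrite pnatr_eq0.
  by move: n1 n2; move: (n.+1%:R : R) (n.+2%:R : R) => y1 y2 y10 y20; field; rewrite y10 y20.
apply: cvgB.
  by apply: cvgM; [exact: cvg_cst|exact: cl].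
apply: cvgM; first exact: cvg_cst.
apply: cvgM; first exact: cvg_cst.
exact: power_series_cvg.
Qed.

Lemma amplitude_bound t x : `|t| <= r -> `|hump_serie d2 V t x| <= 2 * s * eps.
Proof.
move=> tr; have x01 := hump01 d2_ge0 x; set b := hump d2 x in x01 *.
have c1 : (fun N => `|pseries (coefs V b) t N|) @ \oo --> `|hump_serie d2 V t x|.
  by apply: cvg_norm; exact: (serie_cvg r_gt0 rapid_profile tr x01).
rewrite -(cvg_lim _ c1) //; apply: limr_le; first by apply: cvgP c1.
near=> N; rewrite /pseries /series /= big_mkord (le_trans (ler_norm_sum _ _ _)) //.
apply: le_trans (profile_sum k_ge2 s_gt0 eps_gt0 d2_ge0 sg1 small_d2 small_eps' N).
apply: ler_sum => i _; rewrite normrM ler_pM ?l1_horner // normrX.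
by rewrite lerXn2r ?nnegrE ?(ltW s_gt0) // (le_trans tr).
Unshelve. all: by end_near. Qed.

(** The order 0 of the velocity is exactly [eps], and [profile_tail] bounds all the others
    together. *)
Lemma velocity_bound t x : `|t| <= r -> `|hump_serie d2 (tdiff V) t x - eps| <= eps / 2.
Proof.
move=> tr; have x01 := hump01 d2_ge0 x; set b := hump d2 x in x01 *.
have hV := rapid_tdiff r_gt0 rapid_profile.
have c1 : (fun N => `|pseries (coefs (tdiff V) b) t N - eps|) @ \oo -->
    `|hump_serie d2 (tdiff V) t x - eps|.
  apply: cvg_norm; apply: cvgB; last exact: cvg_cst.
  exact: (serie_cvg r_gt0 hV tr x01).
rewrite -(cvg_lim _ c1) //; apply: limr_le; first by apply: cvgP c1.
near=> N; have N0 : (0 < N)%N by near: N; exact: nbhs_infty_gt.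
rewrite /pseries /series /= -(prednK N0) big_mkord big_ord_recl /=.
rewrite {1}/coefs /tdiff [V 1]profile1 scale1r hornerC expr0 mulr1 addrAC subrr add0r.
rewrite (le_trans (ler_norm_sum _ _ _)) //.
apply: le_trans (profile_tail k_ge2 s_gt0 eps_gt0 d2_ge0 sg1 small_d2 small_eps' N.-1).
apply: ler_sum => i _; rewrite normrM ler_pM //.
  by rewrite /coefs /tdiff hornerZ normrM normr_nat ler_wpM2l // l1_horner.
by rewrite normrX lerXn2r ?nnegrE ?(ltW s_gt0) // (le_trans tr).
Unshelve. all: by end_near. Qed.

Lemma solution_dtE t x : t \in `[0, T] ->
  dt T solution t x = hump d2 x ^+ 2 * hump_serie d2 (tdiff V) t x.
Proof.
move=> tT; rewrite solution_dt //; set b := hump d2 x.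
have hV := rapid_tdiff r_gt0 rapid_profile.
have BV n : (tdiff B n).[b] = b ^+ 2 * (tdiff V n).[b] + 0 * (tdiff V n).[b].
  by rewrite /tdiff /B !hornerZ hornerM hornerXn mul0r addr0; ring.
have [_ E] := serie_lin r_gt0 hV hV (ltW (time_in tT)) (hump01 d2_ge0 x) BV.
by rewrite [hump_serie _ _ _ _]E mul0r addr0.
Qed.

(** The velocity contributes at least $(\epsilon/2)^2 q^4$. The potential term is at most
    $\epsilon^2 q^4 / 8$ in absolute value, which settles both signs at once, and the gradient is
    nonnegative. *)
Lemma density_lower t x : t \in `[0, T] ->
  eps ^+ 2 / 8%:R * hump d2 x ^+ 4 <= energy_density sg k T solution t x.
Proof.
move=> tT; have tr := ltW (time_in tT); rewrite /energy_density solution_dtE // solutionE //.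
have /andP[b0 b1] := hump01 d2_ge0 x; set b := hump d2 x in b0 b1 *.
have vb := velocity_bound x tr; have ab := amplitude_bound x tr.
set v := hump_serie d2 (tdiff V) t x in vb *; set a := hump_serie d2 V t x in ab *.
have b4 : 0 <= b ^+ 4 by exact: exprn_ge0.
have v2 : eps ^+ 2 / 4%:R <= v ^+ 2.
  move: vb; rewrite ler_norml => /andP[v1 _].
  have v1' : eps / 2 <= v by move: v1; lra.
  have -> : eps ^+ 2 / 4%:R = (eps / 2) ^+ 2 by field.
  by rewrite lerXn2r ?nnegrE ?divr_ge0 ?(ltW eps_gt0) // (le_trans _ v1') ?divr_ge0 ?(ltW eps_gt0).
have g1 : eps ^+ 2 / 4%:R * b ^+ 4 <= `|b ^+ 2 * v| ^+ 2.
  have -> : `|b ^+ 2 * v| ^+ 2 = v ^+ 2 * b ^+ 4.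
    by rewrite real_normK ?num_real // exprMn -exprM mulrC.
  exact: ler_wpM2r.
have g2 : 0 <= \sum_(j < 3) `|dx j solution t x| ^+ 2.
  by apply: sumr_ge0 => j _; exact: exprn_ge0.
have g3 : 2 / k.+1%:R * `|b ^+ 2 * a| ^+ k.+1 <= eps ^+ 2 / 8%:R * b ^+ 4.
  have k1 : 2 / k.+1%:R <= 1 :> R by rewrite ler_pdivrMr ?mul1r ?ltr0n // ler_nat ltnW.
  apply: (@le_trans _ _ (1 * `|b ^+ 2 * a| ^+ k.+1)).
    by rewrite ler_wpM2r ?exprn_ge0.
  rewrite mul1r normrM exprMn mulrC ler_pM ?exprn_ge0 //; last first.
    rewrite ger0_norm ?exprn_ge0 // -exprM.
    have -> : (2 * k.+1 = 4 + (2 * k.-1))%N by rewrite -[in LHS](prednK (ltnW k_ge2)) !mulnS addnA.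
    by rewrite exprD ler_piMr // exprn_ile1.
  apply: (@le_trans _ _ ((2 * s * eps) ^+ k.+1)).
    by rewrite lerXn2r ?nnegrE ?normr_ge0 // (le_trans _ ab).
  have -> : (2 * s * eps) ^+ k.+1 = (2 * s) ^+ k.+1 * eps ^+ k.-1 * eps ^+ 2.
    by rewrite exprMn -mulrA -exprD addn2 prednK // ltnW.
  by rewrite [leRHS]mulrC ler_wpM2r ?exprn_ge0 ?(ltW eps_gt0).
have g4 : `|sg * (2 / k.+1%:R * `|b ^+ 2 * a| ^+ k.+1)| <= eps ^+ 2 / 8%:R * b ^+ 4.
  by rewrite normrM sg1 mul1r ger0_norm // mulr_ge0 ?exprn_ge0 ?divr_ge0.
move: g4; rewrite ler_norml => /andP[g4 _].
have h : eps ^+ 2 / 4%:R * b ^+ 4 = eps ^+ 2 / 8%:R * b ^+ 4 + eps ^+ 2 / 8%:R * b ^+ 4 by field.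
rewrite h in g1; move: g1 g2 g4.
move: (eps ^+ 2 / 8%:R * b ^+ 4) (`|b ^+ 2 * v| ^+ 2) (\sum_(j < 3) _) (sg * _) => y1 y2 y3 y4.
by lra.
Qed.

(** The velocity decays like $q^4$, the potential like $q^{2k+2}$, and the gradient at least like
    $q^3$ once $|x|^2$ is eliminated. A cube is wanted because each of the three coordinates will
    use one factor. *)
Lemma density_upper : exists2 C, 0 <= C & forall t x, t \in `[0, T] ->
  `|energy_density sg k T solution t x| <= C * hump d2 x ^+ 3.
Proof.
have [C1 C10 hC1] := serie_bounded r_gt0 (rapid_tdiff r_gt0 rapid_profile).
have [C2 C20 hC2] := serie_bounded r_gt0 rapid_profile.
have [C3 C30 hC3] := serie_bounded r_gt0 (rapid_qdiff rapid_solution).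
exists (C1 ^+ 2 + 4%:R * d2 * C3 ^+ 2 + C2 ^+ k.+1).
  by rewrite !addr_ge0 ?mulr_ge0 ?exprn_ge0.
move=> t x tT; have tr := ltW (time_in tT).
rewrite /energy_density solution_dtE // solutionE //.
under eq_bigr do rewrite solution_dx //.
have b01 := hump01 d2_ge0 x; have /andP[b0 b1] := b01; set b := hump d2 x in b01 b0 b1 *.
have bn : b * (d2 * norm2 x) = 1 - b := hump_norm2 d2_ge0 x.
have h1 := hC1 t b tr b01; have h2 := hC2 t b tr b01; have h3 := hC3 t b tr b01.
rewrite -/(hump_serie d2 (tdiff V) t x) in h1; rewrite -/(hump_serie d2 V t x) in h2.
rewrite -/(P t x) in h3.
set v := hump_serie d2 (tdiff V) t x in h1 *; set a := hump_serie d2 V t x in h2 *.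
set p := P t x in h3 *.
have b3 : 0 <= b ^+ 3 by exact: exprn_ge0.
have b4 : b ^+ 4 <= b ^+ 3 by rewrite exprS ler_piMl.
rewrite [leRHS](_ : _ = C1 ^+ 2 * b ^+ 3 + 4%:R * d2 * C3 ^+ 2 * b ^+ 3 + C2 ^+ k.+1 * b ^+ 3); last by ring.
apply: (le_trans (ler_normD _ _)); apply: lerD.
  apply: (le_trans (ler_normD _ _)); apply: lerD.
    rewrite normrX normr_id normrM exprMn mulrC ler_pM ?exprn_ge0 //.
      by rewrite lerXn2r ?nnegrE.
    by rewrite ger0_norm ?exprn_ge0 // -exprM.
  rewrite ger0_norm; last by apply: sumr_ge0 => j _; exact: exprn_ge0.
  have -> : \sum_(j < 3) `|- (2 * d2) * (coord j x * b ^+ 2) * p| ^+ 2 =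
      4%:R * d2 * ((b * (d2 * norm2 x)) * b ^+ 3) * p ^+ 2.
    under eq_bigr do rewrite real_normK ?num_real //.
    by rewrite /norm2 !big_ord_recl !big_ord0; ring.
  rewrite bn [leRHS](_ : _ = 4%:R * d2 * b ^+ 3 * C3 ^+ 2); last by ring.
  rewrite ler_pM ?sqr_ge0 //.
  - by rewrite !mulr_ge0 ?subr_ge0.
  - by rewrite ler_wpM2l ?mulr_ge0 // ler_piMl // gerBl.
  - by rewrite -real_normK ?num_real // lerXn2r ?nnegrE.
rewrite normrM sg1 mul1r normrM ger0_norm ?divr_ge0 // normrX normr_id.
have k1 : 2 / k.+1%:R <= 1 :> R by rewrite ler_pdivrMr ?mul1r ?ltr0n // ler_nat ltnW.
apply: (@le_trans _ _ (1 * `|b ^+ 2 * a| ^+ k.+1)); first by rewrite ler_wpM2r ?exprn_ge0.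
rewrite mul1r normrM exprMn mulrC ler_pM ?exprn_ge0 //.
  by rewrite lerXn2r ?nnegrE.
rewrite ger0_norm ?exprn_ge0 // -exprM.
have -> : (2 * k.+1 = 3 + (2 * k.-1).+1)%N.
  by rewrite -[in LHS](prednK (ltnW k_ge2)) !mulnS addnA addnS.
by rewrite exprD ler_piMr // exprn_ile1.
Qed.

End Solution.

(** * Integration over boxes *)

Section Measurability.
Variable R : realType.

Let cell (n : nat) (y : R) : R := (Num.floor (n.+1%:R * y))%:~R / n.+1%:R.

Lemma cell_cvg y : cell n y @[n --> \oo] --> y.
Proof.
apply/cvgrPdist_le => e e0; near=> n.
have n1 : 0 < n.+1%:R :> R by rewrite ltr0n.
have h : y - cell n y = (n.+1%:R * y - (Num.floor (n.+1%:R * y))%:~R) / n.+1%:R.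
  by rewrite /cell mulrBl mulrAC mulfV ?mul1r // gt_eqF.
rewrite h ger0_norm; last first.
  by rewrite divr_ge0 ?(ltW n1) // subr_ge0 floor_le_tmp.
apply: (@le_trans _ _ n.+1%:R^-1).
  rewrite ler_piMl ?invr_ge0 ?(ltW n1) // lerBlDl.
  have := floorD1_gt (n.+1%:R * y); rewrite intrD => /ltW.
  by rewrite addrC.
by apply/ltW; near: n; exact: (near_infty_natSinv_lt (PosNum e0)).
Unshelve. all: by end_near. Qed.

(** A Carathéodory argument: the last variable is rounded down to a grid whose mesh tends to 0. It
    yields measurability of continuous functions for the product sigma-algebra, one coordinate at a
    time. *)
Lemma measurable_separately d (X : measurableType d) (f : X * R -> R) :
  (forall y, measurable_fun [set: X] (fun a => f (a, y))) ->
  (forall a, continuous (fun y => f (a, y))) -> measurable_fun [set: X * R] f.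
Proof.
move=> mf cf; apply: (measurable_fun_cvg (h := fun n (z : X * R) => f (z.1, cell n z.2))); last first.
  by move=> [a y] _ /=; apply: (continuous_cvg _ (cf a y)); exact: cell_cvg.
move=> n _ Y mY; rewrite setTI.
(* Grid cells are enumerated through [unpickle]; a number that codes no integer contributes the
   empty set. *)
pose E (o : option int) : set (X * R) := if o is Some z then
  [set a | Y (f (a, z%:~R / n.+1%:R))] `*` [set y : R | Num.floor (n.+1%:R * y) = z] else set0.
have -> : (fun z : X * R => f (z.1, cell n z.2)) @^-1` Y = \bigcup_k E (choice.unpickle k).
  apply/seteqP; split=> [[a y] /= Yay|[a y] [k _]].
    by exists (choice.pickle (Num.floor (n.+1%:R * y))); [exact: I|rewrite choice.pickleK].
  by rewrite /E; case: choice.unpickle => //= z [/= Yz yz]; rewrite /cell yz.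
apply: bigcup_measurable => k _; rewrite /E; case: choice.unpickle => // z.
apply: measurableX; first by have := mf (z%:~R / n.+1%:R) measurableT _ mY; rewrite setTI.
have -> : [set y : R | Num.floor (n.+1%:R * y) = z] = [set` `[z%:~R / n.+1%:R, (z + 1)%:~R / n.+1%:R[].
  have n1 : 0 < n.+1%:R :> R by rewrite ltr0n.
  apply/seteqP; split=> y /=; rewrite in_itv /= ler_pdivrMr // ltr_pdivlMr // mulrC.
    by move=> <-; rewrite floor_le_tmp floorD1_gt.
  by move=> h; exact: floor_def.
exact: measurable_itv.
Qed.

Lemma continuous_pairl (U V W : topologicalType) (f : U * V -> W) a :
  continuous f -> continuous (fun y => f (a, y)).
Proof.
move=> cf y; apply: (continuous_cvg _ (cf (a, y))).
exact: (cvg_pair (f := fun _ : V => a) (g := id) (cvg_cst a) cvg_id).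
Qed.

Lemma continuous_pairr (U V W : topologicalType) (f : U * V -> W) b :
  continuous f -> continuous (fun x => f (x, b)).
Proof.
move=> cf y; apply: (continuous_cvg _ (cf (y, b))).
exact: (cvg_pair (f := id) (g := fun _ : U => b) cvg_id (cvg_cst b)).
Qed.

Lemma continuous_measurable2 (f : R * R -> R) : continuous f ->
  measurable_fun [set: R * R] f.
Proof.
move=> cf; apply: measurable_separately => a; last exact: continuous_pairl.
by apply: continuous_measurable_fun; exact: continuous_pairr.
Qed.

Lemma continuous_measurable3 (f : space3 R -> R) : continuous f ->
  measurable_fun [set: space3 R] f.
Proof.
move=> cf; apply: measurable_separately => a; last exact: continuous_pairl.
by apply: continuous_measurable2; exact: continuous_pairr.
Qed.

Lemma continuous_measurable4 (f : space3 R * R -> R) : continuous f ->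
  measurable_fun [set: space3 R * R] f.
Proof.
move=> cf; apply: measurable_separately => a; last exact: continuous_pairl.
by apply: continuous_measurable3; exact: continuous_pairr.
Qed.

End Measurability.

Section BoxFubini.
Context d1 d2 (X : measurableType d1) (Y : measurableType d2) (R : realType).
Variables (m1 : {sigma_finite_measure set X -> \bar R}) (m2 : {sigma_finite_measure set Y -> \bar R}).
Variables (A : set X) (B : set Y) (f : X * Y -> R) (K : R).
Hypotheses (mA : measurable A) (mB : measurable B) (A_fin : (m1 A < +oo)%E) (B_fin : (m2 B < +oo)%E)
  (mf : measurable_fun [set: X * Y] f) (fK : forall z, (A `*` B) z -> `|f z| <= K).

Lemma bounded_integrable d (Z : measurableType d) (m : {measure set Z -> \bar R}) (D : set Z) (g : Z -> R) L :
  measurable D -> (m D < +oo)%E -> measurable_fun [set: Z] g -> (forall z, D z -> `|g z| <= L) ->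
  m.-integrable D (EFin \o g).
Proof.
move=> mD Dfin mg gL; apply: measurable_bounded_integrable => //.
  exact: measurable_funTS.
by exists L; split; [exact: num_real|move=> M LM z Dz; exact: (le_trans (gL _ Dz) (ltW LM))].
Qed.

Lemma box_fin : ((m1 \x m2)%E (A `*` B) < +oo)%E.
Proof.
by rewrite [ltLHS]product_measure1E // lte_mul_pinfty // ge0_fin_numE.
Qed.

Lemma box_integrable : (m1 \x m2)%E.-integrable (A `*` B) (EFin \o f).
Proof. by apply: (bounded_integrable (L := K)) => //; [exact: measurableX|exact: box_fin]. Qed.

Lemma integral_box12 : (\int[m1 \x m2]_(z in A `*` B) (f z)%:E =
  \int[m1]_(x in A) \int[m2]_(y in B) (f (x, y))%:E)%E.
Proof.
(* The function is extended by zero outside the box, and Fubini is applied on the whole product. *)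
have h := box_integrable; move/(integrable_mkcond _ (measurableX mA mB)) : h => h.
rewrite integral_mkcond -integral12_prod_meas1 // [RHS]integral_mkcond.
apply: eq_integral => x _; rewrite /fubini_F [RHS]patchE.
case: ifPn => [xA|xA]; last first.
  rewrite integral0_eq // => y _; rewrite patchE ifF //.
  by apply/negbTE; move: xA; apply: contra => /set_mem [/= /mem_set].
rewrite [RHS]integral_mkcond; apply: eq_integral => y _; rewrite !patchE.
by rewrite in_setX /= xA.
Qed.

Lemma integral_box21 : (\int[m1 \x m2]_(z in A `*` B) (f z)%:E =
  \int[m2]_(y in B) \int[m1]_(x in A) (f (x, y))%:E)%E.
Proof.
have h := box_integrable; move/(integrable_mkcond _ (measurableX mA mB)) : h => h.
rewrite integral_mkcond -integral21_prod_meas1 // [RHS]integral_mkcond.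
apply: eq_integral => y _; rewrite /fubini_G [RHS]patchE.
case: ifPn => [yB|yB]; last first.
  rewrite integral0_eq // => x _; rewrite patchE ifF //.
  by apply/negbTE; move: yB; apply: contra => /set_mem [_ /= /mem_set].
rewrite [RHS]integral_mkcond; apply: eq_integral => x _; rewrite !patchE.
by rewrite in_setX /= yB andbT.
Qed.

End BoxFubini.

(** Lets products be iterated: a product measure becomes an admissible factor in Fubini's
    theorem. *)
Lemma sigma_finite_product (R : realType) d1 d2 (X : measurableType d1) (Y : measurableType d2)
  (m1 : {sigma_finite_measure set X -> \bar R}) (m2 : {sigma_finite_measure set Y -> \bar R}) :
  sigma_finite setT (m1 \x m2)%E.
Proof.
have /sigma_finiteP[F [TF ndF Foo]] := sigma_finiteT m1.
have /sigma_finiteP[G [TG ndG Goo]] := sigma_finiteT m2.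
exists (fun n => F n `*` G n); last first.
  move=> n; have [mF fF] := Foo n; have [mG fG] := Goo n.
  by split; [exact: measurableX|exact: box_fin].
apply/seteqP; split => // -[x y] _.
have [i _ Fx] : (\bigcup_i F i) x by rewrite -TF.
have [j _ Gy] : (\bigcup_j G j) y by rewrite -TG.
exists (maxn i j) => //; split => /=.
  by move: Fx; apply/subsetPset/ndF/leq_maxl.
by move: Gy; apply/subsetPset/ndG/leq_maxr.
Qed.

Section ProductLebesgue.
Variable R : realType.
Notation mu := (@lebesgue_measure R).
Notation T1 := (measurableTypeR R).

(** The intermediate product is named so that the structure of sigma-finite measure can be attached
    to it. *)
Definition lebesgue2 : set (T1 * T1)%type -> \bar R := (mu \x mu)%E.

HB.instance Definition _ := Measure.on lebesgue2.
HB.instance Definition _ :=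
  Measure_isSigmaFinite.Build _ _ _ lebesgue2 (sigma_finite_product mu mu).
HB.instance Definition _ := Measure.on (@lebesgue3 R).
HB.instance Definition _ :=
  Measure_isSigmaFinite.Build _ _ _ (@lebesgue3 R) (sigma_finite_product lebesgue2 mu).

Definition lebesgue4 : set (T1 * T1 * T1 * T1)%type -> \bar R := (@lebesgue3 R \x mu)%E.

HB.instance Definition _ := Measure.on lebesgue4.

End ProductLebesgue.

Section Boxes.
Variable R : realType.
Notation mu := (@lebesgue_measure R).

Lemma compact_bound (V : topologicalType) (f : V -> R) (C : set V) : compact C -> continuous f ->
  exists K, forall z, C z -> `|f z| <= K.
Proof.
move=> cC cf; have : compact (f @` C).
  by apply: continuous_compact => //; exact: continuous_subspaceT.
move=> /compact_bounded [M [_ hM]]; exists (M + 1) => z Cz.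
by apply: hM; [rewrite ltrDl|exists z].
Qed.

Lemma itv_fin (a b : R) : (mu [set` `[a, b]%R] < +oo)%E.
Proof. by rewrite lebesgue_measure_itv /=; case: ifP => // _; rewrite -EFinB ltry. Qed.

Definition box3 (lo hi : space3 R) : set (space3 R) :=
  ([set` `[lo.1.1, hi.1.1]%R] `*` [set` `[lo.1.2, hi.1.2]%R]) `*` [set` `[lo.2, hi.2]%R].

Lemma measurable_box3 lo hi : measurable (box3 lo hi).
Proof. by apply: measurableX; [apply: measurableX|]; exact: measurable_itv. Qed.

Lemma compact_box3 lo hi : compact (box3 lo hi).
Proof. by do 2?[apply: compact_setX]; exact: segment_compact. Qed.

Lemma box3_prod lo hi : @lebesgue3 R (box3 lo hi) =
  (mu [set` `[lo.1.1, hi.1.1]%R] * mu [set` `[lo.1.2, hi.1.2]%R] * mu [set` `[lo.2, hi.2]%R])%E.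
Proof.
rewrite /lebesgue3 /box3 (@product_measure1E _ _ _ _ _ (mu \x mu)%E mu).
- by congr (_ * _)%E; apply: product_measure1E; exact: measurable_itv.
- by apply: measurableX; exact: measurable_itv.
- exact: measurable_itv.
Qed.

Lemma box3_fin lo hi : (@lebesgue3 R (box3 lo hi) < +oo)%E.
Proof.
have F a b : mu [set` `[a, b]%R] \is a fin_num by rewrite ge0_fin_numE // itv_fin.
by rewrite box3_prod -ge0_fin_numE ?mule_ge0 // !fin_numM.
Qed.

Lemma box3_measure lo hi : lo.1.1 <= hi.1.1 -> lo.1.2 <= hi.1.2 -> lo.2 <= hi.2 ->
  @lebesgue3 R (box3 lo hi) =
  ((hi.1.1 - lo.1.1) * (hi.1.2 - lo.1.2) * (hi.2 - lo.2))%:E.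
Proof.
move=> h1 h2 h3; rewrite box3_prod.
have L (a b : R) : a <= b -> mu [set` `[a, b]%R] = (b - a)%:E.
  rewrite lebesgue_measure_itv /= le_eqVlt => /predU1P[->|ab]; first by rewrite ltxx subrr.
  by rewrite lte_fin ab -EFinB.
by rewrite !L // -!EFinM.
Qed.

End Boxes.

(** * The divergence theorem on a cube *)

Section Divergence.
Variable R : realType.
Notation mu := (@lebesgue_measure R).
Notation e_ := (basis3 R).

(** The derivative is only required at interior points, because at the end times of the slab it is
    merely one-sided. *)
Lemma integral_is_derive (g F : R -> R) a b : a < b -> {within `[a, b], continuous g} ->
  {within `[a, b], continuous F} -> (forall y, y \in `]a, b[ -> is_derive y (1 : R) F (g y)) ->
  (\int[mu]_(y in `[a, b]) (g y)%:E = (F b - F a)%:E)%E.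
Proof.
move=> ab cg cF dF; rewrite (@continuous_FTC2 R g F) //.
- have [_ c1 c2] := (continuous_within_itvP F ab).1 cF; split => // y yab.
  by have [] := dF y yab.
- by move=> y yab; rewrite derive1E; have [] := dF y yab.
Qed.

Lemma is_derive_line (V : normedModType R) (F : V -> R) x v d :
  is_derive x v F d -> is_derive (0 : R) (1 : R) (fun h => F (h *: v + x)) d.
Proof.
move=> [dx1 dx2]; apply: DeriveDef; first by move: dx1 => /derivable1P.
rewrite -dx2 /derive; set g1 := (X in lim (X @ _) = _); set g2 := (X in _ = lim (X @ _)).
suff -> : g1 = g2 by [].
by apply/funext => h; rewrite /g1 /g2 /= addr0 scale0r add0r [_%:A]mulr1.
Qed.

Lemma is_derive_translate (G : R -> R) (c d : R) :
  is_derive (0 : R) (1 : R) (fun h => G (h + c)) d -> is_derive c (1 : R) G d.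
Proof.
move=> [dx1 dx2].
have E : (fun h : R => h^-1 *: (((fun h => G (h + c)) \o shift 0) (h *: 1) - G (0 + c))) =
  (fun h : R => h^-1 *: ((G \o shift c) (h *: 1) - G c)).
  by apply/funext => h /=; rewrite addr0 add0r.
by apply: DeriveDef; [move: dx1; rewrite /derivable E|move: dx2; rewrite /derive E].
Qed.

Lemma is_derive_coord2 (F : space3 R -> R) p c d :
  is_derive (p, c) (e_ (inord 2)) F d -> is_derive c (1 : R) (fun y => F (p, y)) d.
Proof.
move=> /is_derive_line dF; apply: is_derive_translate.
have <- // : (fun h : R => F (h *: e_ (inord 2) + (p, c))) = (fun h => F (p, h + c)).
apply/funext => h; congr F; case: p {dF} => a b.
by rewrite /basis3 inordK //= !pair_equal_spec /= /GRing.scale /= !mulr0 mulr1 !add0r.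
Qed.

Lemma is_derive_coord1 (F : space3 R -> R) a b c d :
  is_derive (a, b, c) (e_ (inord 1)) F d -> is_derive b (1 : R) (fun y => F (a, y, c)) d.
Proof.
move=> /is_derive_line dF; apply: is_derive_translate.
have <- // : (fun h : R => F (h *: e_ (inord 1) + (a, b, c))) = (fun h => F (a, h + b, c)).
apply/funext => h; congr F.
by rewrite /basis3 inordK //= !pair_equal_spec /= /GRing.scale /= !mulr0 mulr1 !add0r.
Qed.

Lemma is_derive_coord0 (F : space3 R -> R) a b c d :
  is_derive (a, b, c) (e_ (inord 0)) F d -> is_derive a (1 : R) (fun y => F (y, b, c)) d.
Proof.
move=> /is_derive_line dF; apply: is_derive_translate.
have <- // : (fun h : R => F (h *: e_ (inord 0) + (a, b, c))) = (fun h => F (h + a, b, c)).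
apply/funext => h; congr F.
by rewrite /basis3 inordK //= !pair_equal_spec /= /GRing.scale /= !mulr0 mulr1 !add0r.
Qed.

Variable M : R.
Hypothesis M_gt0 : 0 < M.

Definition cube : set (space3 R) := box3 (- M, - M, - M) (M, M, M).

Lemma integral_is_derive0 (g F : R -> R) : continuous g -> (forall y, is_derive y (1 : R) F (g y)) ->
  F (- M) = 0 -> F M = 0 -> (\int[mu]_(y in `[(- M)%R, M]) (g y)%:E = 0)%E.
Proof.
move=> cg dF F1 F2; rewrite (@integral_is_derive g F) ?F1 ?F2 ?subrr //.
- by have := M_gt0; lra.
- exact: continuous_subspaceT.
- apply: continuous_subspaceT => y; apply: differentiable_continuous.
  by apply/derivable1_diffP; have [] := dF y.
Qed.

(** Fubini brings the integral in the [j]-th coordinate innermost, where it is a difference of two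
    face values, both 0. The nesting of the product dictates a different order for each [j]. *)
Lemma integral_cube_derive0 j (g F : space3 R -> R) : continuous g ->
  (forall x, is_derive x (e_ j) F (g x)) -> (forall x, `|coord j x| = M -> F x = 0) ->
  (\int[@lebesgue3 R]_(x in cube) (g x)%:E = 0)%E.
Proof.
move=> cg dF F0.
have mI : measurable [set` `[(- M), M]%R] by exact: measurable_itv.
have fI := itv_fin (- M) M.
have mI2 := measurableX mI mI; have fI2 := @box_fin _ _ _ _ R mu mu _ _ mI mI fI fI.
have [K hK] := compact_bound (@compact_box3 R (- M, - M, - M) (M, M, M)) cg.
have mg := continuous_measurable3 cg.
have nM : `|M| = M by rewrite ger0_norm // ltW.
have nNM : `|- M| = M by rewrite normrN.
have ej : j = inord j :> 'I_3 by rewrite inord_val.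
case: j F0 dF ej => [[|[|[|j]]] Hj] F0 dF ej //.
- rewrite [LHS](@integral_box21 _ _ _ _ R (@lebesgue2 R) mu _ _ g K mI2 mI fI2 fI mg hK).
  apply: integral0_eq => c hc.
  have cgc : continuous (fun p : R * R => g (p, c)) by exact: continuous_pairr.
  rewrite (@integral_box21 _ _ _ _ R mu mu _ _ (fun p => g (p, c)) K mI mI fI fI (continuous_measurable2 cgc)); last first.
    by move=> p hp; apply: hK.
  apply: integral0_eq => b hb.
  apply: (@integral_is_derive0 _ (fun a => F (a, b, c))).
  + exact: (continuous_pairr (f := fun p : R * R => g (p, c))).
  + by move=> a; apply: is_derive_coord0; rewrite -ej; exact: dF.
  + exact: F0.
  + exact: F0.
- rewrite [LHS](@integral_box21 _ _ _ _ R (@lebesgue2 R) mu _ _ g K mI2 mI fI2 fI mg hK).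
  apply: integral0_eq => c hc.
  have cgc : continuous (fun p : R * R => g (p, c)) by exact: continuous_pairr.
  rewrite (@integral_box12 _ _ _ _ R mu mu _ _ (fun p => g (p, c)) K mI mI fI fI (continuous_measurable2 cgc)); last first.
    by move=> p hp; apply: hK.
  apply: integral0_eq => a ha.
  apply: (@integral_is_derive0 _ (fun b => F (a, b, c))).
  + exact: (continuous_pairl (f := fun p : R * R => g (p, c))).
  + by move=> b; apply: is_derive_coord1; rewrite -ej; exact: dF.
  + exact: F0.
  + exact: F0.
- rewrite [LHS](@integral_box12 _ _ _ _ R (@lebesgue2 R) mu _ _ g K mI2 mI fI2 fI mg hK).
  apply: integral0_eq => p hp.
  apply: (@integral_is_derive0 _ (fun c => F (p, c))).
  + exact: continuous_pairl.
  + by move=> c; apply: is_derive_coord2; rewrite -ej; exact: dF.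
  + exact: F0.
  + exact: F0.
Qed.

End Divergence.

(** * Derivatives along lines and in time *)

Section Lines.
Variable R : realType.

Lemma is_derive_of_line (V : normedModType R) (F : V -> R) x v d :
  is_derive (0 : R) (1 : R) (fun h => F (h *: v + x)) d -> is_derive x v F d.
Proof.
move=> [dx1 dx2]; apply: DeriveDef; first exact/derivable1P.
rewrite -dx2 /derive; set g1 := (X in lim (X @ _) = _); set g2 := (X in _ = lim (X @ _)).
suff -> : g2 = g1 by [].
by apply/funext => h; rewrite /g1 /g2 /= addr0 scale0r add0r [_%:A]mulr1.
Qed.

Lemma is_derive_line_at (V : normedModType R) (F : V -> R) x v (h d : R) :
  is_derive (h *: v + x) v F d -> is_derive h (1 : R) (fun s => F (s *: v + x)) d.
Proof.
move=> /is_derive_line dF; apply: is_derive_translate.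
have <- // : (fun s : R => F (s *: v + (h *: v + x))) = (fun s => F ((s + h) *: v + x)).
by apply/funext => s; rewrite scalerDl addrA.
Qed.

Lemma is_derive_comp_coord (g : R -> R) (j : 'I_3) (x v : space3 R) d :
  is_derive (coord j x) (1 : R) g d -> is_derive x v (g \o coord j) (d * coord j v).
Proof.
move=> dg; apply: is_derive_of_line.
have -> : (fun h : R => (g \o coord j) (h *: v + x)) = g \o (fun h => h * coord j v + coord j x).
  by apply/funext => h /=; rewrite coordD coordZ.
apply: is_derive1_comp; first by rewrite mul0r add0r.
have D := is_deriveD (is_deriveM (is_derive_id (0 : R) (1 : R)) (is_derive_cst (coord j v) (0 : R) (1 : R)))
  (is_derive_cst (coord j x) (0 : R) (1 : R)).
by apply: (is_derive_eq D); rewrite scaler0 add0r addr0 [_%:A]mulr1.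
Qed.

(** Differentiability from a quadratic remainder: a way around the kink of the absolute value inside
    [hinge]. *)
Lemma is_derive_quadratic (g : R -> R) z d C :
  (forall h, `|g (h + z) - g z - d * h| <= C * h ^+ 2) -> is_derive z (1 : R) g d.
Proof.
move=> gC; suff H : (fun h : R => h^-1 *: ((g \o shift z) (h *: 1) - g z)) @ 0^' --> d.
  by apply: DeriveDef; [apply: cvgP H|apply: cvg_lim H].
have c0 : (fun h : R => C * `|h|) @ 0^' --> (0 : R).
  rewrite -[X in _ --> X](mulr0 C) -[X in C * X](normr0 R); apply: cvgM; first exact: cvg_cst.
  by apply: cvg_norm; apply: cvg_within_filter; exact: cvg_id.
apply/cvgrPdist_le => e e0; near=> h.
have h0 : h != 0 by near: h; exact: nbhs_dnbhs_neq.
have he : `|0 - C * `|h| | <= e by near: h; move/cvgrPdist_le : c0; apply.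
apply: le_trans he; rewrite sub0r normrN.
apply: le_trans (ler_norm _); have hh : 0 < `|h| by rewrite normr_gt0.
rewrite -(ler_pM2r hh) -normrM mulrBl.
rewrite /GRing.scale /= mulr1 mulrAC mulVf // mul1r -normrN opprB.
by rewrite (le_trans (gC h)) // -mulrA -expr2 real_normK ?num_real.
Unshelve. all: by end_near. Qed.

(** Twice the square of the positive part: nonnegative, of class $C^1$, and zero for [z <= 0]. Its
    derivative [dhinge] is four times the positive part. *)
Definition hinge (z : R) : R := z * `|z| + z ^+ 2.
Definition dhinge (z : R) : R := 2 * (`|z| + z).

Lemma is_derive_hinge z : is_derive z (1 : R) hinge (dhinge z).
Proof.
apply: (@is_derive_quadratic _ _ _ 2) => h; rewrite /hinge /dhinge ler_norml.
by case: (ger0P z) => z0; case: (ger0P (h + z)) => hz; apply/andP; split; nra.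
Qed.

Lemma hinge_ge0 z : 0 <= hinge z.
Proof. by rewrite /hinge; case: (ger0P z) => z0; nra. Qed.

Lemma hinge_gt0 z : 0 < z -> 0 < hinge z.
Proof. by move=> z0; rewrite /hinge (gtr0_norm z0); nra. Qed.

Lemma hinge_eq0 z : z <= 0 -> hinge z = 0.
Proof. by move=> z0; rewrite /hinge (ler0_norm z0) mulrN expr2 addNr. Qed.

Lemma dhinge_ge0 z : 0 <= dhinge z.
Proof. by rewrite /dhinge; case: (ger0P z) => z0; lra. Qed.

Lemma continuous_hinge : continuous hinge.
Proof.
move=> z; apply: differentiable_continuous; apply/derivable1_diffP.
by have [] := is_derive_hinge z.
Qed.

Lemma continuous_dhinge : continuous dhinge.
Proof.
move=> z; apply: cvgM; first exact: cvg_cst.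
by apply: cvgD; [apply: cvg_norm; exact: cvg_id|exact: cvg_id].
Qed.

End Lines.

Section SubInterval.
Variable R : realType.

(** The point [c] may be an end point of [lo, hi], so the interval found need not be centred at it;
    this is what handles the end times. *)
Lemma subitv (lo hi c d : R) : lo < hi -> lo <= c <= hi -> 0 < d ->
  exists a b, [/\ a < b, lo <= a, b <= hi & forall y, a <= y <= b -> `|y - c| < d].
Proof.
move=> lh /andP[lc ch] d0.
exists (Num.max lo (c - d / 2)), (Num.min hi (c + d / 2)); split.
- by rewrite lt_min !gt_max lh; apply/and3P; split => //; try apply/andP; lra.
- by rewrite le_max lexx.
- by rewrite ge_min lexx.
- move=> y; rewrite ge_max le_min => /andP[/andP[_ y1] /andP[_ y2]].
  by rewrite ltr_norml; apply/andP; split; lra.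
Qed.

End SubInterval.

Lemma dist_lt_double (R : realFieldType) (p q u e : R) :
  `|p - u| < e -> `|q - u| < e -> `|p - q| < e + e.
Proof.
by move=> h1 h2; rewrite -(subrKA u) (le_lt_trans (ler_normD _ _)) // ltrD // distrC.
Qed.

Lemma ball_coord (R : realType) (x y : space3 R) d :
  (forall j, `|coord j y - coord j x| < d) -> ball x d y.
Proof.
move=> h; have h0 := h (inord 0); have h1 := h (inord 1); have h2 := h (inord 2).
move: h0 h1 h2; rewrite /coord !inordK //= => h0 h1 h2.
by split; [split|]; rewrite /ball /= distrC.
Qed.

(** * Calculus up to the end times *)

Section SlabCalculus.
Variables (R : realType) (T : R).
Hypothesis T_gt0 : 0 < T.
Implicit Types (f g : R -> space3 R -> R).

(** Freezing time outside [0, T] turns continuity within the slab into continuity everywhere, hence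
    into measurability and boundedness on compact sets. *)
Definition clamp (t : R) : R := Num.max 0 (Num.min t T).

Lemma clamp_in t : clamp t \in `[0, T].
Proof.
rewrite in_itv /= /clamp le_max lexx /= ge_max (ltW T_gt0) /=.
by rewrite ge_min lexx orbT.
Qed.

Lemma clamp_id t : t \in `[0, T] -> clamp t = t.
Proof.
by rewrite in_itv /= => /andP[t0 tT]; rewrite /clamp min_l // max_r.
Qed.

Lemma continuous_clamp : continuous clamp.
Proof.
move=> t; apply: (continuous_max (f := fun=> 0) (g := fun s => Num.min s T)); first exact: cvg_cst.
by apply: (continuous_min (f := id) (g := fun=> T)); [exact: cvg_id|exact: cvg_cst].
Qed.

(** Space comes first and time last, in the order of the factors of [lebesgue4]. *)
Definition slab_continuous f := continuous (fun z : space3 R * R => f (clamp z.2) z.1).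

Lemma within_slab_continuous f :
  {within [set z : R * space3 R | z.1 \in `[0, T]],
     continuous (fun z : R * space3 R => f z.1 z.2)} -> slab_continuous f.
Proof.
move=> /subspace_continuousP /= cf z.
apply: cvg_trans (cf (clamp z.2, z.1) (clamp_in _)).
move=> B /= hB.
have c1 : (clamp y.2, y.1) @[y --> z] --> nbhs (clamp z.2, z.1).
  have h1 : (clamp y.2) @[y --> z] --> nbhs (clamp z.2).
    exact: (continuous_comp (@continuous_snd _ _ z) (@continuous_clamp z.2)).
  exact: (cvg_pair h1 (@continuous_fst _ _ z)).
move: (c1 _ hB) => /=; rewrite !nbhs_simpl /=.
by apply: filterS => y; apply; exact: clamp_in.
Qed.

Lemma quotients_is_derive (g : R -> R) t : t \in `]0, T[ -> cvg (quotients T g t) ->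
  is_derive t (1 : R) g (lim (quotients T g t)).
Proof.
rewrite in_itv /= => /andP[t0 tT]; set l := lim _ => cg.
have cg' : quotients T g t --> l by exact: cg.
suff H : (fun h : R => h^-1 *: ((g \o shift t) (h *: 1) - g t)) @ 0^' --> l.
  by apply: DeriveDef; [apply: cvgP H|apply: cvg_lim H].
have -> : (fun h : R => h^-1 *: ((g \o shift t) (h *: 1) - g t)) =
    (fun h : R => h^-1 *: (g (h + t) - g t)).
  by apply/funext => h /=; rewrite [_%:A]mulr1.
move=> B hB; have := cg' B hB; rewrite /quotients /within /= !nbhs_simpl /= => hW.
have nT : \forall h \near 0^', h + t \in `[0, T].
  apply: nbhs_dnbhs; exists (Num.min t (T - t)) => /=; first by rewrite lt_min t0 subr_gt0.
  move=> h /=; rewrite sub0r normrN lt_min => /andP[/ltr_normlP[h1 h2] /ltr_normlP[h3 h4]].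
  by rewrite in_itv /=; apply/andP; split; lra.
by apply: filterS2 hW nT => h; apply.
Qed.

Lemma slab_continuous_time f x : slab_continuous f -> {within `[0, T], continuous (f^~ x)}.
Proof.
move=> cf; apply: (subspace_eq_continuous (f := fun t => f (clamp t) x)).
  by move=> t /set_mem /=; exact: clamp_id || (move=> tT; rewrite clamp_id).
apply: continuous_subspaceT; exact: (continuous_pairl (f := fun z : space3 R * R => f (clamp z.2) z.1)).
Qed.

Lemma slab_continuous_space f t : slab_continuous f -> continuous (f (clamp t)).
Proof.
by move=> cf; exact: (continuous_pairr (f := fun z : space3 R * R => f (clamp z.2) z.1)).
Qed.

Section Schwarz.
Variables (f : R -> space3 R -> R) (j : 'I_3).
Notation v := (basis3 R j).
Hypotheses (cf : slab_continuous f)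
  (ft : forall t x, t \in `[0, T] -> cvg (quotients T (f^~ x) t))
  (fx : forall t x, t \in `[0, T] -> derivable (f t) x v)
  (ftx : forall t x, t \in `[0, T] -> derivable (dt T f t) x v)
  (cfx : slab_continuous (dx j f))
  (fxt : forall t x, t \in `[0, T] -> cvg (quotients T (dx j f ^~ x) t))
  (cftx : slab_continuous (dx j (dt T f))) (cfxt : slab_continuous (dt T (dx j f))).

Let sub_slab a b t : 0 <= a -> b <= T -> t \in `[a, b] -> t \in `[0, T].
Proof. by move=> a0 bT; rewrite !in_itv /= => /andP[h1 h2]; rewrite (le_trans a0) // (le_trans h2). Qed.

Let mvt_time (g : R -> space3 R -> R) a b x : a < b -> 0 <= a -> b <= T -> slab_continuous g ->
  (forall t, t \in `[0, T] -> cvg (quotients T (g^~ x) t)) ->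
  exists2 c, c \in `]a, b[ & g b x - g a x = dt T g c x * (b - a).
Proof.
move=> ab a0 bT cg gq; apply: (@MVT R (g^~ x) (fun t => dt T g t x)) => // [t|].
  rewrite in_itv /= => /andP[at_ tb].
  apply: quotients_is_derive; last by apply: gq; rewrite in_itv /= ?(ltW (le_lt_trans a0 at_)) ?(ltW (lt_le_trans tb bT)).
  by rewrite in_itv /= (le_lt_trans a0 at_) (lt_le_trans tb bT).
apply: continuous_subspaceW (slab_continuous_time (x := x) cg).
by move=> t /=; exact: sub_slab.
Qed.

Let mvt_space (F dF : space3 R -> R) x (k : R) : 0 < k ->
  (forall y, is_derive y v F (dF y)) ->
  exists2 c, c \in `]0, k[ & F (k *: v + x) - F x = dF (c *: v + x) * k.
Proof.
move=> k0 dFy.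
have dl c : is_derive c (1 : R) (fun s : R => F (s *: v + x)) (dF (c *: v + x)).
  exact/is_derive_line_at.
have [|c ck e] := @MVT R (fun s => F (s *: v + x)) (fun s => dF (s *: v + x)) 0 k k0 (fun c _ => dl c).
  apply: continuous_subspaceT => c; apply: differentiable_continuous.
  by apply/derivable1_diffP; have [] := dl c.
by exists c => //; move: e; rewrite scale0r add0r subr0.
Qed.

(** The second difference of [f] over a small rectangle is evaluated by the mean value theorem in
    both orders. The two mixed derivatives thus agree up to nearby points, and their continuity
    excludes a gap at [(x, t)], including at the end times. *)
Lemma schwarz t x : t \in `[0, T] -> dt T (dx j f) t x = dx j (dt T f) t x.
Proof.
move=> tT; apply: contrapT => /eqP ne.
pose a := fun z : space3 R * R => dt T (dx j f) (clamp z.2) z.1.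
pose b := fun z : space3 R * R => dx j (dt T f) (clamp z.2) z.1.
have aE y s : s \in `[0, T] -> a (y, s) = dt T (dx j f) s y.
  by move=> sT; rewrite -[in RHS](clamp_id sT).
have bE y s : s \in `[0, T] -> b (y, s) = dx j (dt T f) s y.
  by move=> sT; rewrite -[in RHS](clamp_id sT).
pose e := `|dt T (dx j f) t x - dx j (dt T f) t x| / 2.
have e0 : 0 < e by rewrite divr_gt0 // normr_gt0 subr_eq0.
have na : \forall z \near ((x, t) : space3 R * R), `|a (x, t) - a z| < e.
  by have /cvgrPdist_lt := @cfxt (x, t); apply.
have nb : \forall z \near ((x, t) : space3 R * R), `|b (x, t) - b z| < e.
  by have /cvgrPdist_lt := @cftx (x, t); apply.
have /nbhs_ballP[d /= d0 hd] : \forall z \near ((x, t) : space3 R * R),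
    `|a (x, t) - a z| < e /\ `|b (x, t) - b z| < e by exact: filterI na nb.
(* The time side of the rectangle only has to be close to [t]; it lies inside [0, T] even if [t] is
   an end point. *)
have [al [be [ab al0 beT hab]]] : exists a0 b0, [/\ a0 < b0, 0 <= a0, b0 <= T &
    forall y, a0 <= y <= b0 -> `|y - t| < d] by apply: subitv.
pose k := d / 2; have k0 : 0 < k by rewrite divr_gt0.
have near_z c s : c \in `]0, k[ -> s \in `]al, be[ -> ball ((x, t) : space3 R * R) d (c *: v + x, s).
  rewrite !in_itv /= => /andP[c0 ck] /andP[s1 s2]; split => /=; last first.
    by rewrite /ball /= distrC hab // !ltW.
  apply: ball_coord => i; rewrite coordD coordZ addrK coord_basis3 normrM.
  rewrite normr_nat gtr0_norm // (le_lt_trans _ (_ : c < d)) //.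
    by rewrite ler_piMr ?(ltW c0) // lern1 leq_b1.
  by rewrite (lt_trans ck) // /k; lra.
have slab_t s : s \in `]al, be[ -> s \in `[0, T].
  rewrite !in_itv /= => /andP[s1 s2].
  by rewrite (le_trans al0 (ltW s1)) (le_trans (ltW s2) beT).
have alT : al \in `[0, T] by rewrite in_itv /= al0 (le_trans (ltW ab)).
have beT' : be \in `[0, T] by rewrite in_itv /= beT (le_trans al0 (ltW ab)).
(* Time increment of the space increment: with [E2] it produces a value of [dx j (dt T f)]. *)
have [xi xi1 E1] : exists2 s, s \in `]al, be[ &
    (f be (k *: v + x) - f be x) - (f al (k *: v + x) - f al x) =
    (dt T f s (k *: v + x) - dt T f s x) * (be - al).
  pose G := fun s => f s (k *: v + x) - f s x.
  apply: (@MVT R G (fun s => dt T f s (k *: v + x) - dt T f s x)) => // [s sab|].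
    have s0 : s \in `]0, T[.
      move: sab; rewrite !in_itv /= => /andP[s1 s2].
      by rewrite (le_lt_trans al0 s1) (lt_le_trans s2 beT).
    apply: is_deriveB; apply: quotients_is_derive => //; apply: ft; exact: slab_t.
  apply: (continuous_subspaceW (B := [set` `[0, T]])).
    by move=> s /=; exact: sub_slab.
  move=> s; apply: cvgB; [exact: (slab_continuous_time (x := k *: v + x) cf)|
    exact: (slab_continuous_time (x := x) cf)].
have [c1 c1k E2] := mvt_space x k0 (fun y => derivableP (@ftx xi y (slab_t _ xi1))).
(* The same second difference in the other order: with [E4] it produces a value of
   [dt T (dx j f)]. *)
have [c2 c2k E3] : exists2 c, c \in `]0, k[ &
    (f be (k *: v + x) - f al (k *: v + x)) - (f be x - f al x) =
    (dx j f be (c *: v + x) - dx j f al (c *: v + x)) * k.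
  apply: (@mvt_space (fun y => f be y - f al y) (fun y => dx j f be y - dx j f al y)) => // y.
  by apply: is_deriveB; apply: derivableP; exact: fx.
have [xi2 xi2k E4] := mvt_time (x := c2 *: v + x) ab al0 beT cfx
  (fun s sT => @fxt s (c2 *: v + x) sT).
have ba : be - al != 0 by rewrite subr_eq0 gt_eqF.
have E : b (c1 *: v + x, xi) = a (c2 *: v + x, xi2).
  rewrite (aE _ _ (slab_t _ xi2k)) (bE _ _ (slab_t _ xi1)).
  apply: (mulIf (lt0r_neq0 k0)); apply: (mulIf ba).
  have E5 := etrans (congr1 ( *%R^~ (be - al)) (esym E2)) (esym E1).
  rewrite [LHS]E5 [RHS]mulrAC -E4 -E3.
  by move: (f be _) (f be _) (f al _) (f al _) => z1 z2 z3 z4; ring.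
have [_ hb] := hd _ (near_z _ _ c1k xi1); have [ha _] := hd _ (near_z _ _ c2k xi2k).
rewrite E in hb; move: ha hb; rewrite (aE _ _ tT) (bE _ _ tT) => ha hb.
by have := dist_lt_double ha hb; rewrite /e -splitr ltxx.
Qed.

End Schwarz.

End SlabCalculus.

(** * Uniqueness *)

Section SlabContinuousClosure.
Variables (R : realType) (T : R).
Implicit Types f g : R -> space3 R -> R.
Notation sc := (slab_continuous T).

Lemma slab_continuous_cst c : sc (fun _ _ => c).
Proof. by move=> z; exact: cvg_cst. Qed.

Lemma slab_continuousD f g : sc f -> sc g -> sc (fun t x => f t x + g t x).
Proof. by move=> cf cg z; apply: cvgD; [exact: cf|exact: cg]. Qed.

Lemma slab_continuousN f : sc f -> sc (fun t x => - f t x).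
Proof. by move=> cf z; apply: cvgN; exact: cf. Qed.

Lemma slab_continuousM f g : sc f -> sc g -> sc (fun t x => f t x * g t x).
Proof. by move=> cf cg z; apply: cvgM; [exact: cf|exact: cg]. Qed.

Lemma slab_continuous_sum n (F : 'I_n -> R -> space3 R -> R) :
  (forall i, sc (F i)) -> sc (fun t x => \sum_(i < n) F i t x).
Proof.
elim: n F => [|n IH] F cF.
  have -> : (fun t x => \sum_(i < 0) F i t x) = (fun _ _ => 0).
    by apply/funext => t; apply/funext => x; rewrite big_ord0.
  exact: slab_continuous_cst.
have -> : (fun t x => \sum_(i < n.+1) F i t x) =
    (fun t x => F ord0 t x + \sum_(i < n) F (lift ord0 i) t x).
  by apply/funext => t; apply/funext => x; rewrite big_ord_recl.
by apply: slab_continuousD; [exact: cF|apply: IH].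
Qed.

Lemma slab_continuous_comp (u : R -> R) f : continuous u -> sc f -> sc (fun t x => u (f t x)).
Proof. by move=> cu cf z; exact: (continuous_comp (cf z) (cu _)). Qed.

Lemma slab_continuous_coord j : sc (fun _ => coord j).
Proof.
move=> z; exact: (continuous_comp (@continuous_fst _ _ z) (@coord_continuous R j z.1)).
Qed.

Lemma slab_continuous_t : sc (fun t _ => t).
Proof.
move=> z; exact: (continuous_comp (@continuous_snd _ _ z) (@continuous_clamp R T z.2)).
Qed.

End SlabContinuousClosure.

(** * A weight supported in a shrinking cube *)

Section Weight.
Variables (R : realType) (M lam : R).
Notation e_ := (basis3 R).

(** Positive exactly for [|y| < M - t], and of class $C^1$ across the boundary. *)
Definition wedge (t y : R) : R := hinge (M - t - y) * hinge (M - t + y).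
Definition wedge_t (t y : R) : R :=
  - (dhinge (M - t - y) * hinge (M - t + y) + hinge (M - t - y) * dhinge (M - t + y)).
Definition wedge_y (t y : R) : R :=
  hinge (M - t - y) * dhinge (M - t + y) - dhinge (M - t - y) * hinge (M - t + y).

Lemma is_derive_affine (c b y : R) : is_derive y (1 : R) (fun s => c * s + b) c.
Proof.
have D := is_deriveD (is_deriveZ c (is_derive_id y (1 : R))) (is_derive_cst b y (1 : R)).
by apply: (is_derive_eq D); rewrite addr0 [_%:A]mulr1.
Qed.

Lemma is_derive_hinge_affine (c b y : R) :
  is_derive y (1 : R) (fun s => hinge (c * s + b)) (dhinge (c * y + b) * c).
Proof.
exact: (is_derive1_comp (f := @hinge R) (g := fun s => c * s + b) (is_derive_hinge _) (is_derive_affine c b y)).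
Qed.

Lemma is_derive_wedge_t t y : is_derive t (1 : R) (wedge^~ y) (wedge_t t y).
Proof.
have D := is_deriveM (is_derive_hinge_affine (-1) (M - y) t) (is_derive_hinge_affine (-1) (M + y) t).
have -> : wedge^~ y = (fun s => hinge (-1 * s + (M - y))) * (fun s => hinge (-1 * s + (M + y))).
  by apply/funext => s; rewrite /wedge !fctE; congr (hinge _ * hinge _); ring.
apply: (is_derive_eq D); rewrite /wedge_t /GRing.scale /= (_ : -1 * t + (M - y) = M - t - y); last by ring.
by rewrite (_ : -1 * t + (M + y) = M - t + y); ring.
Qed.

Lemma is_derive_wedge_y t y : is_derive y (1 : R) (wedge t) (wedge_y t y).
Proof.
have D := is_deriveM (is_derive_hinge_affine (-1) (M - t) y) (is_derive_hinge_affine 1 (M - t) y).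
have -> : wedge t = (fun s => hinge (-1 * s + (M - t))) * (fun s => hinge (1 * s + (M - t))).
  by apply/funext => s; rewrite /wedge !fctE; congr (hinge _ * hinge _); ring.
apply: (is_derive_eq D); rewrite /wedge_y /GRing.scale /= (_ : -1 * y + (M - t) = M - t - y); last by ring.
by rewrite (_ : 1 * y + (M - t) = M - t + y); ring.
Qed.

Lemma wedge_ge0 t y : 0 <= wedge t y.
Proof. by rewrite mulr_ge0 ?hinge_ge0. Qed.

(** Unit propagation speed: [wedge_y] is the difference, and [- wedge_t] the sum, of the same two
    nonnegative terms. *)
Lemma norm_wedge_y t y : `|wedge_y t y| <= - wedge_t t y.
Proof.
rewrite /wedge_y /wedge_t opprK.
have a0 := mulr_ge0 (hinge_ge0 (M - t - y)) (dhinge_ge0 (M - t + y)).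
have b0 := mulr_ge0 (dhinge_ge0 (M - t - y)) (hinge_ge0 (M - t + y)).
by rewrite ler_norml; apply/andP; split; lra.
Qed.

Lemma wedge_eq0 t y : 0 <= t -> `|y| = M -> wedge t y = 0.
Proof.
move=> t0; rewrite /wedge; case: (ger0P y) => _ <-.
  by rewrite hinge_eq0 ?mul0r //; lra.
by rewrite [X in _ * X]hinge_eq0 ?mulr0 //; lra.
Qed.

Lemma wedge_gt0 t y : t + `|y| < M -> 0 < wedge t y.
Proof.
move=> h; rewrite mulr_gt0 // hinge_gt0 //; move: h (ler_norm y) (ler_norm (- y)); rewrite normrN; lra.
Qed.

(** The exponential is the Gronwall factor: its derivative supplies [- lam * weight], which absorbs
    the terms of order zero. *)
Definition weight (t : R) (x : space3 R) : R :=
  expR (- lam * t) * \prod_(i < 3) wedge t (coord i x).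
Definition weight_t (t : R) (x : space3 R) : R := - lam * weight t x +
  expR (- lam * t) * \sum_(i < 3) wedge_t t (coord i x) * \prod_(l < 3 | l != i) wedge t (coord l x).
Definition weight_x (j : 'I_3) (t : R) (x : space3 R) : R :=
  expR (- lam * t) * (wedge_y t (coord j x) * \prod_(l < 3 | l != j) wedge t (coord l x)).

Lemma ord3P (P : 'I_3 -> Prop) : P 0 -> P 1 -> P 2%:R -> forall j, P j.
Proof.
move=> p0 p1 p2 [[|[|[|j]]] Hj] //.
- by rewrite (_ : Ordinal Hj = 0) //; exact: val_inj.
- by rewrite (_ : Ordinal Hj = 1) //; exact: val_inj.
- by rewrite (_ : Ordinal Hj = 2%:R) //; exact: val_inj.
Qed.

Lemma big_ord3 (F : 'I_3 -> R) : \sum_(i < 3) F i = F 0 + F 1 + F 2%:R.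
Proof.
rewrite !big_ord_recl big_ord0 addr0 addrA; congr (F _ + F _ + F _); exact: val_inj.
Qed.

Lemma prod_ord3 (F : 'I_3 -> R) : \prod_(i < 3) F i = F 0 * F 1 * F 2%:R.
Proof.
rewrite !big_ord_recl big_ord0 mulr1 mulrA; congr (F _ * F _ * F _); exact: val_inj.
Qed.

(** A tuple of equations, meant as a multi-rule for [rewrite]. *)
Lemma prod_ord3D1 (F : 'I_3 -> R) : (\prod_(i < 3 | i != 0) F i = F 1 * F 2%:R) *
  (\prod_(i < 3 | i != 1) F i = F 0 * F 2%:R) * (\prod_(i < 3 | i != 2%:R) F i = F 0 * F 1).
Proof. by split; [split|]; rewrite big_mkcond prod_ord3 /= ?mulr1 ?mul1r. Qed.

Lemma is_derive_prod3 (V : normedModType R) (F : 'I_3 -> V -> R) (dF : 'I_3 -> R) x v :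
  (forall i, is_derive x v (F i) (dF i)) ->
  is_derive x v (fun y => \prod_(i < 3) F i y)
    (\sum_(i < 3) dF i * \prod_(l < 3 | l != i) F l x).
Proof.
move=> dFi; have -> : (fun y => \prod_(i < 3) F i y) = F 0 * F 1 * F 2%:R.
  by apply/funext => y; rewrite prod_ord3.
apply: (is_derive_eq (is_deriveM (is_deriveM (dFi 0) (dFi 1)) (dFi 2%:R))).
by rewrite big_ord3 !prod_ord3D1 /GRing.scale /= !fctE; ring.
Qed.

Lemma is_derive_weight_t t x : is_derive t (1 : R) (weight^~ x) (weight_t t x).
Proof.
have dE : is_derive t (1 : R) (fun s => expR (- lam * s)) (expR (- lam * t) * - lam).
  have := is_derive1_comp (f := expR) (g := fun s => - lam * s + 0) (is_derive_expR _)
    (is_derive_affine (- lam) 0 t).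
  by under eq_fun do rewrite addr0; rewrite addr0.
have dP := is_derive_prod3 (F := fun i s => wedge s (coord i x)) (fun i => is_derive_wedge_t t (coord i x)).
apply: (is_derive_eq (is_deriveM dE dP)).
by rewrite /weight_t /weight /GRing.scale /=; ring.
Qed.

Lemma is_derive_weight_x j t x : is_derive x (e_ j) (weight t) (weight_x j t x).
Proof.
have dP := is_derive_prod3 (F := fun i (y : space3 R) => wedge t (coord i y))
  (fun i => is_derive_comp_coord (e_ j) (is_derive_wedge_y t (coord i x))).
apply: (is_derive_eq (is_deriveM (is_derive_cst (expR (- lam * t)) x (e_ j)) dP)).
rewrite /weight_x /GRing.scale /= mulr0 addr0; congr (_ * _).
rewrite (bigD1 j) //= coord_basis3 eqxx mulr1 [X in _ + X]big1 ?addr0 // => i /negbTE ij.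
by rewrite coord_basis3 ij mulr0 mul0r.
Qed.

Lemma weight_ge0 t x : 0 <= weight t x.
Proof. by rewrite mulr_ge0 ?expR_ge0 // prodr_ge0 // => i _; exact: wedge_ge0. Qed.

(** Direction by direction this is [norm_wedge_y]. The sum over the directions is what the flux
    bound needs, since each component of the flux is estimated separately. *)
Lemma weight_dissipation t x : \sum_(j < 3) `|weight_x j t x| <= - lam * weight t x - weight_t t x.
Proof.
rewrite /weight_t opprD addrA subrr add0r -mulrN -sumrN mulr_sumr.
apply: ler_sum => j _; rewrite normrM ger0_norm ?expR_ge0 // ler_wpM2l ?expR_ge0 //.
rewrite normrM -mulNr ler_pM ?norm_wedge_y // ger0_norm // prodr_ge0 // => i _; exact: wedge_ge0.
Qed.

Lemma weight_eq0 j t x : 0 <= t -> `|coord j x| = M -> weight t x = 0.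
Proof. by move=> t0 xM; rewrite /weight (bigD1 j) //= wedge_eq0 // mul0r mulr0. Qed.

Lemma weight_gt0 t x : (forall j, t + `|coord j x| < M) -> 0 < weight t x.
Proof.
by move=> h; rewrite mulr_gt0 ?expR_gt0 // prodr_gt0 // => i _; exact: wedge_gt0.
Qed.

Variable T : R.
Notation sc := (slab_continuous T).

Let sc_hinge_l i : sc (fun t x => M - t - coord i x).
Proof.
apply: slab_continuousD; [apply: slab_continuousD; [exact: slab_continuous_cst|]|].
  by apply: slab_continuousN; exact: slab_continuous_t.
by apply: slab_continuousN; exact: slab_continuous_coord.
Qed.

Let sc_hinge_r i : sc (fun t x => M - t + coord i x).
Proof.
apply: slab_continuousD; [apply: slab_continuousD; [exact: slab_continuous_cst|]|exact: slab_continuous_coord].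
by apply: slab_continuousN; exact: slab_continuous_t.
Qed.

Let sc_wedge i : sc (fun t x => wedge t (coord i x)).
Proof.
by apply: slab_continuousM; apply: (slab_continuous_comp (@continuous_hinge R)).
Qed.

Let sc_wedge_t i : sc (fun t x => wedge_t t (coord i x)).
Proof.
apply: slab_continuousN.
by apply: slab_continuousD; apply: slab_continuousM;
  (apply: (slab_continuous_comp (@continuous_hinge R)) || apply: (slab_continuous_comp (@continuous_dhinge R))).
Qed.

Let sc_wedge_y i : sc (fun t x => wedge_y t (coord i x)).
Proof.
apply: slab_continuousD; last apply: slab_continuousN;
  by apply: slab_continuousM;
  (apply: (slab_continuous_comp (@continuous_hinge R)) || apply: (slab_continuous_comp (@continuous_dhinge R))).
Qed.

Let sc_exp : sc (fun t _ => expR (- lam * t)).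
Proof.
apply: (slab_continuous_comp (u := expR)); first exact: continuous_expR.
by apply: slab_continuousM; [exact: slab_continuous_cst|exact: slab_continuous_t].
Qed.

Let sc_prod (P : pred 'I_3) : sc (fun t x => \prod_(i < 3 | P i) wedge t (coord i x)).
Proof.
have -> : (fun t x => \prod_(i < 3 | P i) wedge t (coord i x)) = (fun t x =>
   (if P 0 then wedge t (coord 0 x) else 1) * (if P 1 then wedge t (coord 1 x) else 1) *
   (if P 2%:R then wedge t (coord 2%:R x) else 1)).
  by apply/funext => t; apply/funext => x; rewrite big_mkcond prod_ord3.
case: (P 0); case: (P 1); case: (P 2%:R);
  (apply: slab_continuousM; [apply: slab_continuousM|]; first [exact: sc_wedge|exact: slab_continuous_cst]).
Qed.

Lemma slab_continuous_weight : sc weight.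
Proof.
have := slab_continuousM (@sc_exp) (@sc_prod xpredT).
exact.
Qed.

Lemma slab_continuous_weight_t : sc weight_t.
Proof.
apply: slab_continuousD.
  by apply: slab_continuousM; [exact: slab_continuous_cst|exact: slab_continuous_weight].
apply: slab_continuousM => //; apply: slab_continuous_sum => i.
exact: (slab_continuousM (@sc_wedge_t i) (@sc_prod (fun l => l != i))).
Qed.

Lemma slab_continuous_weight_x j : sc (weight_x j).
Proof.
exact: (slab_continuousM (T := T) (@sc_exp) (slab_continuousM (@sc_wedge_y j) (@sc_prod (fun l => l != j)))).
Qed.

End Weight.

Section PointwiseInequality.
Variable R : realFieldType.

(* The weighted energy density is [g * e] with [e = u^2 + \sum p_j^2 + w^2]; the
   weight satisfies [\sum |gx_j| <= - lam * g - gt]. *)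
Lemma energy_flux_le (g gt lam K w u a e : R) (gx p q s : 'I_3 -> R) :
  0 <= g -> \sum_(j < 3) `|gx j| <= - lam * g - gt -> lam = K + 2 -> 0 <= K ->
  `|- a + \sum_(j < 3) s j| <= K * `|w| ->
  e = u ^+ 2 + \sum_(j < 3) p j ^+ 2 + w ^+ 2 ->
  gt * e + g * (2 * (u * a) + \sum_(j < 3) 2 * (p j * q j) + 2 * (w * u)) +
  \sum_(j < 3) (- 2 * (gx j * (u * p j) + g * (q j * p j + u * s j))) <= - (g * e).
Proof.
move=> g0 gx_le lamE K0 bK eE; set b := - a + _ in bK.
have e0 : 0 <= e by rewrite eE !addr_ge0 ?sqr_ge0 // sumr_ge0 // => j _; exact: sqr_ge0.
have pe j : p j ^+ 2 <= \sum_(j < 3) p j ^+ 2.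
  by rewrite (bigD1 j) //= lerDl sumr_ge0 // => i _; exact: sqr_ge0.
(* Flux through the moving boundary: $2 |u p_j| \le u^2 + p_j^2 \le e$. *)
have h1 : \sum_(j < 3) (- 2 * (gx j * (u * p j))) <= (\sum_(j < 3) `|gx j|) * e.
  rewrite mulr_suml; apply: ler_sum => j _.
  apply: (@le_trans _ _ (`|gx j| * (u ^+ 2 + p j ^+ 2))); last first.
    by rewrite ler_wpM2l // eE; have := pe j; have := sqr_ge0 w; lra.
  have n0 := normr_ge0 (gx j); have n1 := ler_norm (gx j); have n2 := ler_norm (- gx j).
  rewrite normrN in n2; have s1 := sqr_ge0 (u + p j); have s2 := sqr_ge0 (u - p j); nra.
(* Source terms: $2 w u \le e$, and the wave operator applied to [w] costs at most $2 K |u| |w| \le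
   K e$. *)
have h2 : g * (2 * (w * u) - 2 * (u * b)) <= g * ((K + 1) * e).
  rewrite ler_wpM2l //.
  have ub : - (u * b) <= K * (`|u| * `|w|).
    apply: (le_trans (ler_norm _)); rewrite normrN normrM.
    by rewrite mulrCA ler_wpM2l.
  have uw : w * u <= `|u| * `|w| by rewrite -normrM mulrC ler_norm.
  have sq : 2 * (`|u| * `|w|) <= e.
    have := sqr_ge0 (`|u| - `|w|); rewrite sqrrB !real_normK ?num_real //.
    by have : 0 <= \sum_(j < 3) p j ^+ 2 by [apply: sumr_ge0 => j _; exact: sqr_ge0]; rewrite eE; lra.
  by have := ler_wpM2l K0 sq; lra.
have -> : gt * e + g * (2 * (u * a) + \sum_(j < 3) 2 * (p j * q j) + 2 * (w * u)) +
  \sum_(j < 3) (- 2 * (gx j * (u * p j) + g * (q j * p j + u * s j))) =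
  gt * e + \sum_(j < 3) (- 2 * (gx j * (u * p j))) + g * (2 * (w * u) - 2 * (u * b)).
  by rewrite /b !big_ord_recl !big_ord0; ring.
(* Of [lam = K + 2], the part [K + 1] pays for [h2] and the remaining 1 leaves [- (g * e)]. *)
have h3 := ler_wpM2r e0 gx_le; rewrite lamE in h3; lra.
Qed.

End PointwiseInequality.

(** * The weighted energy identity *)

Section EnergyUniqueness.
Variables (R : realType) (T : R) (w : R -> space3 R -> R).
Hypotheses (T_gt0 : 0 < T) (w_smooth : Cn_slab T 2 w).
Notation sc := (slab_continuous T).
Notation e_ := (basis3 R).
Notation wt := (dt T w).
Notation wx j := (dx j w).

Let w2 := w_smooth.

Lemma reg_w : sc w. Proof. by case: w2 => c _; exact: within_slab_continuous. Qed.
Lemma reg_q t x : t \in `[0, T] -> cvg (quotients T (w^~ x) t).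
Proof. by case: w2 => _ [+ _ _ _]; apply. Qed.
Lemma reg_x j t x : t \in `[0, T] -> derivable (w t) x (e_ j).
Proof. by case: w2 => _ [_ + _ _]; apply. Qed.
Lemma reg_wt : sc wt.
Proof. by case: w2 => _ [_ _ [c _] _]; exact: within_slab_continuous. Qed.
Lemma reg_wt_q t x : t \in `[0, T] -> cvg (quotients T (wt^~ x) t).
Proof. by case: w2 => _ [_ _ [_ [+ _ _ _]] _]; apply. Qed.
Lemma reg_wt_x j t x : t \in `[0, T] -> derivable (wt t) x (e_ j).
Proof. by case: w2 => _ [_ _ [_ [_ + _ _]] _]; apply. Qed.
Lemma reg_wtt : sc (dt T wt).
Proof. by case: w2 => _ [_ _ [_ [_ _ [c _] _]] _]; exact: within_slab_continuous. Qed.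
Lemma reg_wtx j : sc (dx j wt).
Proof. by case: w2 => _ [_ _ [_ [_ _ _ /(_ j) [c _]]] _]; exact: within_slab_continuous. Qed.
Lemma reg_wx j : sc (wx j).
Proof. by case: w2 => _ [_ _ _ /(_ j) [c _]]; exact: within_slab_continuous. Qed.
Lemma reg_wx_q j t x : t \in `[0, T] -> cvg (quotients T (wx j ^~ x) t).
Proof. by case: w2 => _ [_ _ _ /(_ j) [_ [+ _ _ _]]]; apply. Qed.
Lemma reg_wx_x j t x : t \in `[0, T] -> derivable (wx j t) x (e_ j).
Proof. by case: w2 => _ [_ _ _ /(_ j) [_ [_ + _ _]]]; apply. Qed.
Lemma reg_wxt j : sc (dt T (wx j)).
Proof. by case: w2 => _ [_ _ _ /(_ j) [_ [_ _ [c _] _]]]; exact: within_slab_continuous. Qed.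
Lemma reg_wxx j : sc (dx j (wx j)).
Proof. by case: w2 => _ [_ _ _ /(_ j) [_ [_ _ _ /(_ j) [c _]]]]; exact: within_slab_continuous. Qed.

Lemma mixed j t x : t \in `[0, T] -> dt T (wx j) t x = dx j wt t x.
Proof.
apply: schwarz => //.
- exact: reg_w.
- exact: reg_q.
- exact: reg_x.
- exact: reg_wt_x.
- exact: reg_wx.
- exact: reg_wx_q.
- exact: reg_wtx.
- exact: reg_wxt.
Qed.

Variables (M lam : R).
Notation G := (weight M lam).

(** The term in [w] itself is added to the wave energy so that a source bounded by [K * |w|] can be
    absorbed. *)
Definition edens (t : R) (x : space3 R) : R := wt t x ^+ 2 + \sum_(j < 3) wx j t x ^+ 2 + w t x ^+ 2.
Definition energy_t (t : R) (x : space3 R) : R := weight_t M lam t x * edens t x +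
  G t x * (2 * (wt t x * dt T wt t x) + \sum_(j < 3) 2 * (wx j t x * dt T (wx j) t x) + 2 * (w t x * wt t x)).
(** The energy flux, with the sign for which its divergence cancels the second space derivatives of
    [w] against those coming from [energy_t]. *)
Definition flux (j : 'I_3) (t : R) (x : space3 R) : R := - 2 * (G t x * (wt t x * wx j t x)).
Definition flux_x (j : 'I_3) (t : R) (x : space3 R) : R :=
  - 2 * (weight_x M lam j t x * (wt t x * wx j t x) +
         G t x * (dx j wt t x * wx j t x + wt t x * dx j (wx j) t x)).

Lemma slab_continuousX f n : sc f -> sc (fun t x => f t x ^+ n).
Proof. by move=> cf; apply: (slab_continuous_comp (u := fun y => y ^+ n)) => //; exact: exprn_continuous. Qed.

Lemma edens_continuous : sc edens.
Proof.
apply: slab_continuousD; last by apply: slab_continuousX; exact: reg_w.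
apply: slab_continuousD; first by apply: slab_continuousX; exact: reg_wt.
by apply: slab_continuous_sum => j; apply: slab_continuousX; exact: reg_wx.
Qed.

Lemma energy_t_continuous : sc energy_t.
Proof.
have c2 : sc (fun _ _ => 2) by exact: slab_continuous_cst.
apply: slab_continuousD; apply: slab_continuousM.
- exact: slab_continuous_weight_t.
- exact: edens_continuous.
- exact: slab_continuous_weight.
- apply: slab_continuousD; [apply: slab_continuousD|].
  + apply: slab_continuousM => //; apply: slab_continuousM; [exact: reg_wt|exact: reg_wtt].
  + apply: slab_continuous_sum => j.
    apply: slab_continuousM => //; apply: slab_continuousM; [exact: reg_wx|exact: reg_wxt].
  + apply: slab_continuousM => //; apply: slab_continuousM; [exact: reg_w|exact: reg_wt].
Qed.

Lemma flux_x_continuous j : sc (flux_x j).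
Proof.
apply: slab_continuousM; first exact: slab_continuous_cst.
apply: slab_continuousD; apply: slab_continuousM.
- exact: slab_continuous_weight_x.
- apply: slab_continuousM; [exact: reg_wt|exact: reg_wx].
- exact: slab_continuous_weight.
- apply: slab_continuousD; apply: slab_continuousM;
  [exact: reg_wtx|exact: reg_wx|exact: reg_wt|exact: reg_wxx].
Qed.

Lemma wedens_continuous : sc (fun t x => G t x * edens t x).
Proof. apply: slab_continuousM; [exact: slab_continuous_weight|exact: edens_continuous]. Qed.

Lemma is_derive_flux j t x : t \in `[0, T] -> is_derive x (e_ j) (flux j t) (flux_x j t x).
Proof.
move=> tT; have d1 := derivableP (@reg_wt_x j t x tT); have d2 := derivableP (@reg_wx_x j t x tT).
have D := is_deriveZ (- 2) (is_deriveM (is_derive_weight_x M lam j t x) (is_deriveM d1 d2)).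
apply: (is_derive_eq D); rewrite /flux_x /dx /GRing.scale /= !fctE /GRing.scale /=.
move: (weight_x _ _ _ _ _) ('D_ _ _ _) ('D_ _ _ _) => a b c.
ring.
Qed.

Lemma is_derive_wedens t x : t \in `]0, T[ ->
  is_derive t (1 : R) (fun s => G s x * edens s x) (energy_t t x).
Proof.
move=> tT; have tT' : t \in `[0, T] by apply: subset_itv_oo_cc.
have d0 := quotients_is_derive tT (@reg_q t x tT').
have d1 := quotients_is_derive tT (@reg_wt_q t x tT').
have d2 j := quotients_is_derive tT (@reg_wx_q j t x tT').
have dsum : is_derive t (1 : R) (fun s => \sum_(j < 3) wx j s x ^+ 2)
    (\sum_(j < 3) 2 * (wx j t x * dt T (wx j) t x)).
  have -> : (fun s => \sum_(j < 3) wx j s x ^+ 2) = \sum_(j < 3) (wx j ^~ x) ^+ 2.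
    by apply/funext => s; rewrite fct_sumE.
  apply: is_derive_eq (is_derive_sum (fun j => is_deriveX 2 (d2 j))) _.
  by apply: eq_bigr => j _; rewrite /GRing.scale /= expr1 mulrA.
have D := is_deriveM (is_derive_weight_t M lam t x)
  (is_deriveD (is_deriveD (is_deriveX 2 d1) dsum) (is_deriveX 2 d0)).
apply: (is_derive_eq D); rewrite /energy_t /edens /GRing.scale /= !fctE /=.
rewrite -!/(dt T _ t x) -/(dt T wt t x) !expr1 /GRing.scale /=; ring.
Qed.

End EnergyUniqueness.

Lemma integral_lower_bound (R : realType) d (Z : measurableType d) (m : {measure set Z -> \bar R})
    (D B : set Z) (f : Z -> R) (c : R) :
  measurable D -> measurable B -> B `<=` D -> measurable_fun [set: Z] f ->
  (forall z, D z -> 0 <= f z) -> 0 <= c -> (forall z, B z -> c <= f z) ->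
  (c%:E * m B <= \int[m]_(z in D) (f z)%:E)%E.
Proof.
move=> mD mB BD mf f0 c0 cf; rewrite -integral_cst //.
apply: (@le_trans _ _ (\int[m]_(z in B) (f z)%:E)%E).
  apply: ge0_le_integral => //.
  by apply/measurable_EFinP; exact: measurable_funTS.
apply: ge0_subset_integral => //.
by apply/measurable_EFinP; exact: measurable_funTS.
Qed.

(* The measures only fix the measurable structures of [X] and [Y]: two convertible
   structures on the reals differ by their displays. *)
Lemma measurable_box d1 d2 (X : measurableType d1) (Y : measurableType d2) (R : realType)
  (m1 : {measure set X -> \bar R}) (m2 : {measure set Y -> \bar R}) (A : set X) (B : set Y) :
  measurable A -> measurable B -> measurable (A `*` B).
Proof. exact: measurableX. Qed.

Section RealValuedIntegral.
Context d (Z : measurableType d) (R : realType) (m : {measure set Z -> \bar R}) (D : set Z).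
Hypothesis mD : measurable D.
Variables f g : Z -> R.
Hypotheses (intf : m.-integrable D (EFin \o f)) (intg : m.-integrable D (EFin \o g)).

Lemma EFin_integrableD : m.-integrable D (EFin \o (fun z => f z + g z)).
Proof.
rewrite (_ : EFin \o _ = (EFin \o f) \+ (EFin \o g))%E; first exact: integrableD.
by apply/funext => z /=; rewrite EFinD.
Qed.

Lemma EFin_integralD : (\int[m]_(z in D) (f z + g z)%:E =
  \int[m]_(z in D) (f z)%:E + \int[m]_(z in D) (g z)%:E)%E.
Proof.
rewrite -(integralD mD intf intg); apply: eq_integral => z _.
by rewrite /= EFinD.
Qed.

End RealValuedIntegral.

Lemma integral_le0_of_sum d (Z : measurableType d) (R : realType) (m : {measure set Z -> \bar R})
    (D : set Z) (f0 h : Z -> R) (f : 'I_3 -> Z -> R) :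
  measurable D -> m.-integrable D (EFin \o f0) -> (forall j, m.-integrable D (EFin \o f j)) ->
  m.-integrable D (EFin \o h) -> (0 <= \int[m]_(z in D) (f0 z)%:E)%E ->
  (forall j, \int[m]_(z in D) (f j z)%:E = 0)%E ->
  (forall z, D z -> f0 z + \sum_(j < 3) f j z <= - h z) ->
  (\int[m]_(z in D) (h z)%:E <= 0)%E.
Proof.
move=> mD i0 i1 ih f0_ge0 f_eq0 f_le.
have i12 := EFin_integrableD mD (i1 0) (i1 1).
have i012 := EFin_integrableD mD i12 (i1 2%:R).
have iS := EFin_integrableD mD i0 i012.
have ES : (\int[m]_(z in D) (f0 z + (f 0 z + f 1 z + f 2%:R z))%:E =
    \int[m]_(z in D) (f0 z)%:E)%E.
  by rewrite (EFin_integralD mD i0 i012) (EFin_integralD mD i12 (i1 2%:R))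
    (EFin_integralD mD (i1 0) (i1 1)) !f_eq0 !adde0.
have iN : m.-integrable D (EFin \o (fun z => - h z)).
  rewrite (_ : EFin \o _ = -%E \o (EFin \o h)); first exact: integrableN.
  by apply/funext => z /=; rewrite EFinN.
have le : (\int[m]_(z in D) (f0 z + (f 0 z + f 1 z + f 2%:R z))%:E <=
    \int[m]_(z in D) (- h z)%:E)%E.
  apply: (le_integral mD iS iN) => z /set_mem Dz.
  by rewrite lee_fin -(big_ord3 (fun j => f j z)); exact: f_le.
have EN : (\int[m]_(z in D) (- h z)%:E = - \int[m]_(z in D) (h z)%:E)%E.
  by rewrite -integralN //; exact: integrable_add_def.
by rewrite ES EN in le; rewrite -oppe_ge0; exact: le_trans f0_ge0 le.
Qed.


(** * Integration over the space-time box *)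

Section EnergyUniqueness.
Variables (R : realType) (T : R) (w : R -> space3 R -> R).
Hypotheses (T_gt0 : 0 < T) (w_smooth : Cn_slab T 2 w).
Hypotheses (w0 : forall x, w 0 x = 0) (wt0 : forall x, dt T w 0 x = 0).
Notation mu := (@lebesgue_measure R).
Notation sc := (slab_continuous T).

Variables (M lam K : R).
Hypotheses (M_gt0 : 0 < M) (K_ge0 : 0 <= K) (lamE : lam = K + 2)
  (boxK : forall t x, t \in `[0, T] -> cube M x -> `|box T w t x| <= K * `|w t x|).

Let I : set R := [set` `[0, T]].
Notation m4 := (@lebesgue4 R).
Let Q := cube M `*` I.

Let mI : measurable I. Proof. exact: measurable_itv. Qed.
Let mC : measurable (cube M). Proof. exact: measurable_box3. Qed.
Let fI : (mu I < +oo)%E. Proof. exact: itv_fin. Qed.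
Let fC : (@lebesgue3 R (cube M) < +oo)%E. Proof. exact: box3_fin. Qed.

Let mQ := @measurable_box _ _ _ _ R (@lebesgue3 R) mu _ _ mC mI.

Let cl (f : R -> space3 R -> R) (z : space3 R * R) : R := f (clamp T z.2) z.1.

Let cl_bound f : sc f -> exists L, forall z, Q z -> `|cl f z| <= L.
Proof.
move=> cf; apply: compact_bound => //.
by apply: compact_setX; [exact: compact_box3|exact: segment_compact].
Qed.

Let cl_integrable f : sc f -> m4.-integrable Q (EFin \o cl f).
Proof.
move=> cf; have [L hL] := cl_bound cf.
exact: (@box_integrable _ _ _ _ R (@lebesgue3 R) mu _ _ (cl f) L mC mI fC fI (continuous_measurable4 (@cf)) hL).
Qed.

(** At each fixed time the divergence theorem applies: the weight vanishes on the faces of the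
    cube. *)
Lemma integral_flux j : (\int[m4]_(z in Q) (cl (flux_x T w M lam j) z)%:E = 0)%E.
Proof.
have cf := @flux_x_continuous R T w T_gt0 w_smooth M lam j; have [L hL] := cl_bound cf.
rewrite [LHS](@integral_box21 _ _ _ _ R (@lebesgue3 R) mu _ _ (cl _) L mC mI fC fI
  (continuous_measurable4 (@cf)) hL).
apply: integral0_eq => t tI; rewrite /cl /=.
apply: (integral_cube_derive0 M_gt0 (j := j) (F := flux T w M lam j (clamp T t))).
- exact: slab_continuous_space.
- by move=> x; apply: is_derive_flux => //; exact: clamp_in.
- move=> x xM; rewrite /flux (@weight_eq0 _ _ _ j) ?mul0r ?mulr0 //.
  by have := clamp_in T_gt0 t; rewrite in_itv => /andP[].
Qed.

(** Here time is integrated first. The result is the weighted density at time [T], which is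
    nonnegative, minus its value at time 0, which the zero data cancel. *)
Lemma integral_energy_t : (0 <= \int[m4]_(z in Q) (cl (energy_t T w M lam) z)%:E)%E.
Proof.
have cf := @energy_t_continuous R T w T_gt0 w_smooth M lam; have [L hL] := cl_bound cf.
rewrite [leRHS](@integral_box12 _ _ _ _ R (@lebesgue3 R) mu _ _ (cl _) L mC mI fC fI
  (continuous_measurable4 (@cf)) hL).
apply: integral_ge0 => x xC.
pose A := fun t => weight M lam t x * edens T w t x.
have wx0 j : dx j w 0 x = 0.
  rewrite /dx (_ : w 0 = cst 0); first by rewrite derive_cst.
  by apply/funext => y; rewrite w0.
have -> : (\int[mu]_(t in [set` `[0%R, T]]) (cl (energy_t T w M lam) (x, t))%:E = (A T - A 0)%:E)%E.
  apply: (@integral_is_derive R (fun t => cl (energy_t T w M lam) (x, t)) A) => //.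
  - apply: continuous_subspaceT.
    exact: (continuous_pairl (f := cl (energy_t T w M lam)) (a := x)).
  - exact: (slab_continuous_time (f := fun t x => weight M lam t x * edens T w t x) (@wedens_continuous R T w T_gt0 w_smooth M lam)).
  - move=> t tT; rewrite /cl /= clamp_id; last exact: subset_itv_oo_cc.
    exact: is_derive_wedens.
rewrite /A [X in _ - X](_ : _ = 0); last first.
  by rewrite /edens w0 wt0 big1 ?expr0n ?addr0 ?mulr0 // => j _; rewrite wx0 expr0n.
rewrite subr0 lee_fin mulr_ge0 ?weight_ge0 // !addr_ge0 ?sqr_ge0 //.
by apply: sumr_ge0 => j _; exact: sqr_ge0.
Qed.

Lemma wedens_integral_le0 :
  (\int[m4]_(z in Q) (cl (fun t x => weight M lam t x * edens T w t x) z)%:E <= 0)%E.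
Proof.
have ce := @energy_t_continuous R T w T_gt0 w_smooth M lam.
have cf j := @flux_x_continuous R T w T_gt0 w_smooth M lam j.
have ch := @wedens_continuous R T w T_gt0 w_smooth M lam.
set h := fun t x => _ in ch *.
have i0 := cl_integrable ce.
have i1 j := cl_integrable (@cf j).
have ih := cl_integrable ch.
apply: (integral_le0_of_sum mQ i0 i1 ih integral_energy_t integral_flux) => -[x t] [/= xC tI].
rewrite /cl /= clamp_id //.
(* Symmetry of the mixed derivatives brings [energy_t] to the form in which the flux compensates
   it. *)
have E : \sum_(j < 3) 2 * (dx j w t x * dt T (dx j w) t x) =
    \sum_(j < 3) 2 * (dx j w t x * dx j (dt T w) t x).
  by apply: eq_bigr => j _; rewrite (mixed T_gt0 w_smooth j x tI).
rewrite /energy_t E.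
exact: (@energy_flux_le R (weight M lam t x) (weight_t M lam t x) lam K (w t x) (dt T w t x)
  (dt T (dt T w) t x) (edens T w t x) (fun j => weight_x M lam j t x) (fun j => dx j w t x)
  (fun j => dx j (dt T w) t x) (fun j => dx j (dx j w) t x)
  (weight_ge0 M lam t x) (weight_dissipation M lam t x) lamE K_ge0 (boxK tI xC) (erefl _)).
Qed.

End EnergyUniqueness.

Lemma lebesgue_measure_segment (R : realType) (a b : R) : a <= b ->
  @lebesgue_measure R [set` `[a, b]] = (b - a)%:E.
Proof.
rewrite lebesgue_measure_itv /= le_eqVlt => /predU1P[->|ab]; first by rewrite ltxx subrr.
by rewrite lte_fin ab -EFinB.
Qed.

Lemma lebesgue4_box_gt0 (R : realType) (lo hi : space3 R) (a b : R) :
  lo.1.1 < hi.1.1 -> lo.1.2 < hi.1.2 -> lo.2 < hi.2 -> a < b ->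
  (0 < @lebesgue4 R (box3 lo hi `*` [set` `[a, b]]))%E.
Proof.
move=> h0 h1 h2 ab.
rewrite [ltRHS](@product_measure1E _ _ _ _ _ (@lebesgue3 R) (@lebesgue_measure R)); last 2 first.
- exact: measurable_box3.
- exact: measurable_itv.
rewrite mule_gt0 //.
  by rewrite [ltRHS](box3_measure (ltW h0) (ltW h1) (ltW h2)) lte_fin !mulr_gt0 ?subr_gt0.
by rewrite [ltRHS](lebesgue_measure_segment (ltW ab)) lte_fin subr_gt0.
Qed.

(** If [w t x] were nonzero, the weighted density would exceed a positive constant on a small box of
    positive measure, against [wedens_integral_le0]. The constant [K] may depend on [M], so no
    global bound on [w] is assumed. *)
Lemma vanishing (R : realType) (T : R) (w : R -> space3 R -> R) : 0 < T -> Cn_slab T 2 w ->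
  (forall x, w 0 x = 0) -> (forall x, dt T w 0 x = 0) ->
  (forall M, 0 < M -> exists2 K, 0 <= K &
    forall t x, t \in `[0, T] -> cube M x -> `|box T w t x| <= K * `|w t x|) ->
  forall t x, t \in `[0, T] -> w t x = 0.
Proof.
move=> T0 w2 w0 wt0 box_le t x tT; apply: contrapT => /eqP w_neq0.
have /andP[t_ge0 t_leT] : 0 <= t <= T by move: tT; rewrite in_itv.
(* Large enough for the shrinking cube to contain [x] in its interior up to time [T]. *)
pose M := T + 1 + \sum_(j < 3) `|coord j x|.
have xM j : t + `|coord j x| < M.
  rewrite /M -addrA ler_ltD // addrC ltr_pwDr // (bigD1 j) //= lerDl.
  by apply: sumr_ge0 => i _; exact: normr_ge0.
have M0 : 0 < M by rewrite (le_lt_trans _ (xM 0)) // addr_ge0.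
have [K K0 boxK] := box_le M M0.
have le0 := wedens_integral_le0 T0 w2 w0 wt0 M0 K0 (erefl (K + 2)) boxK.
have ch := @wedens_continuous R T w T0 w2 M (K + 2).
pose h (z : space3 R * R) := weight M (K + 2) (clamp T z.2) z.1 * edens T w (clamp T z.2) z.1.
have hE y s : s \in `[0, T] -> h (y, s) = weight M (K + 2) s y * edens T w s y.
  by move=> sT; rewrite -[in RHS](clamp_id sT).
have e_ge0 s y : 0 <= edens T w s y.
  by rewrite !addr_ge0 ?sqr_ge0 // sumr_ge0 // => j _; exact: sqr_ge0.
have h_gt0 : 0 < h (x, t).
  rewrite hE // mulr_gt0 ?weight_gt0 // ltr_wpDl //.
    by rewrite addr_ge0 ?sqr_ge0 // sumr_ge0 // => j _; exact: sqr_ge0.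
  by rewrite lt_neqAle sqr_ge0 andbT eq_sym sqrf_eq0.
pose c := h (x, t) / 2; have c_gt0 : 0 < c by rewrite divr_gt0.
have c_lt : c < h (x, t) by rewrite /c; move: h_gt0; lra.
have /nbhs_ballP[d /= d0 hd] : \forall z \near ((x, t) : space3 R * R), c < h z.
  exact: (cvgr_gt _ (@ch (x, t)) _ c_lt).
have coordM j : - M <= coord j x <= M.
  by have := xM j; move: t_ge0 (ler_norm (coord j x)) (ler_norm (- coord j x));
    rewrite normrN => h1 h2 h3 h4; apply/andP; split; lra.
have NMM : - M < M by move: M0; lra.
have [a [b [ab a0 bT hab]]] := subitv T0 (introT andP (conj t_ge0 t_leT)) d0.
have [a0' [b0 [ab0 l0 u0 hab0]]] := subitv NMM (coordM 0) d0.
have [a1 [b1 [ab1 l1 u1 hab1]]] := subitv NMM (coordM 1) d0.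
have [a2 [b2 [ab2 l2 u2 hab2]]] := subitv NMM (coordM 2%:R) d0.
pose B := box3 (a0', a1, a2) (b0, b1, b2) `*` [set` `[a, b]].
have B_gt0 : (0 < @lebesgue4 R B)%E by apply: lebesgue4_box_gt0.
have mB := @measurable_box _ _ _ _ R (@lebesgue3 R) (@lebesgue_measure R) _ _
  (measurable_box3 (a0', a1, a2) (b0, b1, b2)) (measurable_itv `[a, b]).
have mQ := @measurable_box _ _ _ _ R (@lebesgue3 R) (@lebesgue_measure R) _ _
  (measurable_box3 (- M, - M, - M) (M, M, M)) (measurable_itv `[0, T]).
have := @integral_lower_bound R _ _ (@lebesgue4 R) _ _ h c mQ mB.
have mem (lo hi y : R) : lo <= y -> y <= hi -> [set` `[lo, hi]] y.
  by move=> h1 h2; rewrite /= in_itv /= h1.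
have BQ : B `<=` cube M `*` [set` `[0, T]].
  move=> -[[[y0 y1] y2] s] [[[p0 p1] p2] p3]; move: p0 p1 p2 p3; rewrite /= !in_itv /= => /andP[p0 q0] /andP[p1 q1] /andP[p2 q2] /andP[p3 q3].
  split; [split; [split|]|].
  - exact: mem (le_trans l0 p0) (le_trans q0 u0).
  - exact: mem (le_trans l1 p1) (le_trans q1 u1).
  - exact: mem (le_trans l2 p2) (le_trans q2 u2).
  - exact: mem (le_trans a0 p3) (le_trans q3 bT).
move=> /(_ BQ (continuous_measurable4 (@ch))).
have h_ge0 z : 0 <= h z by rewrite /h mulr_ge0 ?weight_ge0.
have hB z : B z -> c <= h z.
  move=> Bz; apply/ltW/hd; move: Bz.
  case: z => -[[y0 y1] y2] s [[[p0 p1] p2] p3]; move: p0 p1 p2 p3; rewrite /= !in_itv /= => r0 r1 r2 r3.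
  split => /=; last by rewrite /ball /= distrC hab.
  by apply: ball_coord; apply: ord3P; rewrite {1}/coord /=; [exact: hab0|exact: hab1|exact: hab2].
move=> /(_ (fun z _ => h_ge0 z) (ltW c_gt0) hB) le1.
have := le_trans le1 le0; apply/negP; rewrite -ltNge.
by rewrite mule_gt0 // lte_fin.
Qed.

(** * The difference of two solutions *)

Section Difference.
Variables (R : realType) (T : R).
Hypothesis T_gt0 : 0 < T.
Implicit Types f g : R -> space3 R -> R.

Lemma quotientsB (f g : R -> R) t lf lg :
  quotients T f t --> lf -> quotients T g t --> lg ->
  quotients T (fun s => f s - g s) t --> lf - lg.
Proof.
move=> cf cg; rewrite /quotients.
have -> : (fun h : R => h^-1 *: (f (h + t) - g (h + t) - (f t - g t))) =
   (fun h => h^-1 *: (f (h + t) - f t) - h^-1 *: (g (h + t) - g t)).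
  by apply/funext => h; rewrite -scalerBr; congr (_ *: _); ring.
exact: cvgB.
Qed.

Lemma slab_dtB f g : (forall t x, t \in `[0, T] -> cvg (quotients T (f^~ x) t)) ->
  (forall t x, t \in `[0, T] -> cvg (quotients T (g^~ x) t)) ->
  slab_eq T (dt T (fun t x => f t x - g t x)) (fun t x => dt T f t x - dt T g t x).
Proof.
move=> cf cg t x tT; have F := slab_filter T_gt0 tT.
by apply: cvg_lim => //; exact: (quotientsB (cf t x tT) (cg t x tT)).
Qed.

Lemma slab_dxB j f g : (forall t x, t \in `[0, T] -> derivable (f t) x (basis3 R j)) ->
  (forall t x, t \in `[0, T] -> derivable (g t) x (basis3 R j)) ->
  slab_eq T (dx j (fun t x => f t x - g t x)) (fun t x => dx j f t x - dx j g t x).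
Proof. by move=> cf cg t x tT; exact: deriveB (cf t x tT) (cg t x tT). Qed.

Lemma Cn_slabB n f g : Cn_slab T n f -> Cn_slab T n g -> Cn_slab T n (fun t x => f t x - g t x).
Proof.
elim: n f g => [|n IH] f g [cf hf] [cg hg]; split => //.
- by move=> z; exact: (cvgB (cf z) (cg z)).
- by move=> z; exact: (cvgB (cf z) (cg z)).
- case: hf => f1 f2 f3 f4; case: hg => g1 g2 g3 g4; split.
  + move=> t x tT; apply/cvg_ex; eexists.
    exact: (quotientsB (f1 t x tT) (g1 t x tT)).
  + by move=> j t x tT; exact: derivableB (f2 j t x tT) (g2 j t x tT).
  + apply: (@Cn_slab_eq _ _ _ _ _ _ (IH _ _ f3 g3)) => t x tT.
    exact: (esym (slab_dtB f1 g1 x tT)).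
  + move=> j; apply: (@Cn_slab_eq _ _ _ _ _ _ (IH _ _ (f4 j) (g4 j))) => t x tT.
    exact: (esym (slab_dxB (f2 j) (g2 j) x tT)).
Qed.

Lemma boxB f g t x : Cn_slab T 2 f -> Cn_slab T 2 g -> t \in `[0, T] ->
  box T (fun t x => f t x - g t x) t x = box T f t x - box T g t x.
Proof.
move=> [_ [f1 f2 [_ [f3 _ _ _]] f4]] [_ [g1 g2 [_ [g3 _ _ _]] g4]] tT.
have Et := etrans (slab_eq_dt (slab_dtB f1 g1) x tT) (slab_dtB f3 g3 x tT).
have Ex j : dx j (dx j (fun t x => f t x - g t x)) t x = dx j (dx j f) t x - dx j (dx j g) t x.
  have [_ [_ f5 _ _]] := f4 j; have [_ [_ g5 _ _]] := g4 j.
  exact: (etrans (slab_eq_dx j (slab_dxB (f2 j) (g2 j)) x tT) (slab_dxB (f5 j) (g5 j) x tT)).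
have ES := etrans (eq_bigr _ (fun j _ => Ex j)) (sumrB _ xpredT (fun j => dx j (dx j f) t x) (fun j => dx j (dx j g) t x)).
have rearrange (a b c d : R) : - (a - b) + (c - d) = (- a + c) - (- b + d) by ring.
have H : box T (fun t x => f t x - g t x) t x = - (dt T (dt T f) t x - dt T (dt T g) t x) +
   (\sum_(j < 3) dx j (dx j f) t x - \sum_(j < 3) dx j (dx j g) t x).
  by rewrite -Et -ES.
exact: etrans H (rearrange _ _ _ _).
Qed.

Lemma slab_bounded f M : slab_continuous T f -> exists L, forall t x, t \in `[0, T] -> cube M x ->
  `|f t x| <= L.
Proof.
move=> cf; have [|L hL] := @compact_bound R _ (fun z : space3 R * R => f (clamp T z.2) z.1)
   (cube M `*` [set` `[0, T]]) _ cf.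
  by apply: compact_setX; [exact: compact_box3|exact: segment_compact].
by exists L => t x tT xM; have := hL (x, t) (conj xM tT); rewrite /= clamp_id.
Qed.

(** Both solutions are bounded on each compact cube, where $u^k$ is Lipschitz; the difference
    therefore satisfies the hypothesis of [vanishing]. *)
Lemma solution_unique (sg : R) k phi0 phi1 f g : odd k -> `|sg| = 1 ->
  is_solution sg k T phi0 phi1 f -> is_solution sg k T phi0 phi1 g ->
  forall t x, t \in `[0, T] -> f t x = g t x.
Proof.
move=> k_odd sg1 [fs fe f0 f1] [gs ge g0 g1] t x tT.
have zT : 0 \in `[0, T] by rewrite in_itv /= lexx ltW.
pose w := fun t x => f t x - g t x.
suff : w t x = 0 by move/eqP; rewrite subr_eq0 => /eqP.
have [_ [fq _ _ _]] := fs 1%N; have [_ [gq _ _ _]] := gs 1%N.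
apply: (@vanishing R T w T_gt0 _ _ _ _ t x tT).
- exact: (Cn_slabB (fs 2%N) (gs 2%N)).
- by move=> y; rewrite /w f0 g0 subrr.
- by move=> y; rewrite [LHS](slab_dtB fq gq y zT) f1 g1 subrr.
- move=> M M0.
  have [Lf hf] := slab_bounded M (within_slab_continuous T_gt0 (fs 0%N).1).
  have [Lg hg] := slab_bounded M (within_slab_continuous T_gt0 (gs 0%N).1).
  (* The maximum with 0 makes [K] nonnegative even if the bounds [Lf] and [Lg] are not. *)
  pose L := Num.max 0 (Num.max Lf Lg).
  exists (k%:R * L ^+ k.-1); first by rewrite mulr_ge0 // exprn_ge0 // /L le_max lexx.
  move=> s y sT yM; rewrite [X in `|X|](boxB y (fs 2%N) (gs 2%N) sT) (fe s y sT) (ge s y sT).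
  have absX (a : R) : `|a| ^+ k.-1 * a = a ^+ k.
    case: k k_odd {fe ge} => // n; rewrite /= => n_even.
    by rewrite -normrX ger0_norm ?exprn_even_ge0 // -exprSr.
  rewrite !absX -mulrBr normrM sg1 mul1r; apply: normr_subrX.
    by rewrite (le_trans (hf s y sT yM)) // /L !le_max lexx !orbT.
  by rewrite (le_trans (hg s y sT yM)) // /L !le_max lexx !orbT.
Qed.

End Difference.

(** * Energy of the solution *)

Lemma tensor_integrable (R : realType) d1 d2 (X : measurableType d1) (Y : measurableType d2)
    (m1 : {sigma_finite_measure set X -> \bar R}) (m2 : {sigma_finite_measure set Y -> \bar R})
    (f : X -> R) (g : Y -> R) :
  m1.-integrable setT (EFin \o f) -> m2.-integrable setT (EFin \o g) ->
  (m1 \x m2)%E.-integrable setT (EFin \o (fun z : X * Y => f z.1 * g z.2)).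
Proof.
move=> /integrableP[mf If] /integrableP[mg Ig].
have mf' := (measurable_EFinP _ f).1 mf; have mg' := (measurable_EFinP _ g).1 mg.
have mfg : measurable_fun [set: X * Y] (EFin \o (fun z : X * Y => f z.1 * g z.2)).
  apply/measurable_EFinP; apply: measurable_funM.
    exact: (measurableT_comp mf' measurable_fst).
  exact: (measurableT_comp mg' measurable_snd).
apply: (integrable12ltyP m1 m2 mfg).2.
have E x : (\int[m2]_y `|(f x * g y)%R%:E| =
    `|f x|%:E * \int[m2]_y `|(g y)%:E|)%E.
  rewrite -ge0_integralZl_EFin //; last exact: measurableT_comp.
  by apply: eq_integral => y _; rewrite /= normrM EFinM.
rewrite /=; under eq_integral do rewrite E.
set J := (\int[m2]_y _)%E.
have J0 : (0 <= J)%E by exact: integral_ge0.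
have -> : (\int[m1]_x (`|f x|%:E * J) = J * \int[m1]_x `|(f x)%:E|)%E.
  rewrite -ge0_integralZl //; last exact: measurableT_comp.
  by apply: eq_integral => x _; rewrite muleC.
rewrite lte_mul_pinfty ?ge0_fin_numE //.
Qed.

Section FiniteEnergy.
Variable R : realType.
Notation mu := (@lebesgue_measure R).

Definition lorentzian (y : R) : R := (oneDsqr y)^-1.

Lemma lorentzian_integrable : mu.-integrable setT (EFin \o lorentzian).
Proof.
have mL : measurable_fun [set: R] lorentzian.
  by apply: continuous_measurable_fun; exact: continuous_oneDsqrV.
have L0 y : 0 <= lorentzian y by rewrite invr_ge0 ltW // (lt_le_trans ltr01) // oneDsqr_ge1.
apply/integrableP; split; first exact/measurable_EFinP.
have -> : (\int[mu]_y `|(EFin \o lorentzian) y| = \int[mu]_y (lorentzian y)%:E)%E.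
  by apply: eq_integral => y _ /=; rewrite ger0_norm.
rewrite (@ge0_symfun_integralT R lorentzian) //; last 2 first.
- exact: continuous_oneDsqrV.
- by move=> y; rewrite /lorentzian /oneDsqr /= sqrrN.
by rewrite -set_itvcy [X in (_ * X)%E](integral0y_oneDsqr R) -EFinM ltry.
Qed.

Lemma lorentzian3_integrable : (@lebesgue3 R).-integrable setT
  (EFin \o (fun x : space3 R => lorentzian x.1.1 * lorentzian x.1.2 * lorentzian x.2)).
Proof.
have h := lorentzian_integrable.
have h2 := @tensor_integrable R _ _ _ _ mu mu _ _ h h.
exact: (@tensor_integrable R _ _ _ _ (@lebesgue2 R) mu _ _ h2 h).
Qed.

(** For [d2 <= 1], $1 + d^2 |x|^2 \ge d^2 (1 + x_i^2)$ for each coordinate; one factor of the cube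
    is spent on each, and the product of Lorentzians is integrable. *)
Lemma hump_le_lorentzian (d2 : R) x : 0 < d2 <= 1 ->
  hump d2 x ^+ 3 <= d2 ^- 3 * (lorentzian x.1.1 * lorentzian x.1.2 * lorentzian x.2).
Proof.
move=> /andP[d0 d1].
have n2E : norm2 x = x.1.1 ^+ 2 + x.1.2 ^+ 2 + x.2 ^+ 2 by rewrite /norm2 !big_ord_recl big_ord0 addr0 addrA.
have L0 y : 0 < oneDsqr y by rewrite (lt_le_trans ltr01) // oneDsqr_ge1.
have H y : y ^+ 2 <= norm2 x -> hump d2 x <= d2^-1 * lorentzian y.
  move=> yx; rewrite /hump /lorentzian -invfM lef_pV2 ?posrE ?mulr_gt0 //; last first.
    by apply: hump_den_gt0; exact: ltW.
  rewrite /oneDsqr mulrDr mulr1 lerD // ler_wpM2l // ltW //.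
have h0 := ltW (hump_gt0 (ltW d0) x).
have s0 := sqr_ge0 x.1.1; have s1 := sqr_ge0 x.1.2; have s2 := sqr_ge0 x.2.
have H0 : hump d2 x <= d2^-1 * lorentzian x.1.1 by apply: H; rewrite n2E; lra.
have H1 : hump d2 x <= d2^-1 * lorentzian x.1.2 by apply: H; rewrite n2E; lra.
have H2 : hump d2 x <= d2^-1 * lorentzian x.2 by apply: H; rewrite n2E; lra.
rewrite [leRHS](_ : _ = d2^-1 * lorentzian x.1.1 * (d2^-1 * lorentzian x.1.2) * (d2^-1 * lorentzian x.2)).
  by rewrite !exprS expr0 mulr1 mulrA ler_pM ?mulr_ge0 // ler_pM.
by rewrite -exprVn; ring.
Qed.

(** On this box $|x|^2 \le 3 L^2$, so that $1 + d^2 |x|^2 \le 4$. *)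
Lemma hump_ge (d2 L : R) x : 0 < L -> d2 = (L ^+ 2)^-1 -> box3 (0, 0, 0) (L, L, L) x ->
  4%:R^-1 <= hump d2 x.
Proof.
move=> L0 dE [[p0 p1] p2]; move: p0 p1 p2.
rewrite /= !in_itv /= => /andP[a0 a1] /andP[b0 b1] /andP[c0 c1].
have d0 : 0 < d2 by rewrite dE invr_gt0 exprn_gt0.
rewrite /hump lef_pV2 ?posrE ?hump_den_gt0 ?(ltW d0) //.
have -> : norm2 x = x.1.1 ^+ 2 + x.1.2 ^+ 2 + x.2 ^+ 2 by rewrite /norm2 !big_ord_recl big_ord0 addr0 addrA.
have sq y : 0 <= y -> y <= L -> y ^+ 2 <= L ^+ 2 by move=> y0 yL; rewrite lerXn2r ?nnegrE // ltW.
have := sq _ a0 a1; have := sq _ b0 b1; have := sq _ c0 c1 => h0 h1 h2.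
have dL : d2 * L ^+ 2 = 1 by rewrite dE mulVf // expf_neq0 // gt_eqF.
have : d2 * (x.1.1 ^+ 2 + x.1.2 ^+ 2 + x.2 ^+ 2) <= d2 * (3%:R * L ^+ 2).
  by rewrite ler_wpM2l ?(ltW d0) //; lra.
rewrite mulrCA dL; lra.
Qed.

End FiniteEnergy.

Section EnergyOfSmooth.
Variables (R : realType) (sg T : R) (k : nat) (f : R -> space3 R -> R).
Hypotheses (T_gt0 : 0 < T) (f_smooth : smooth_slab T f).

Lemma energy_density_continuous t : t \in `[0, T] -> continuous (energy_density sg k T f t).
Proof.
move=> tT.
have slice g : Cn_slab T 0 g -> continuous (g t) by move=> [cg _]; exact: (slab_slice_continuous tT cg).
have [_ [_ _ f3 f4]] := f_smooth 1%N.
have cX (g : space3 R -> R) n : continuous g -> continuous (fun x => `|g x| ^+ n).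
  move=> cg x; apply: (@continuous_comp _ _ _ (fun x => `|g x|) (fun y => y ^+ n)).
    by apply: cvg_norm; exact: cg.
  exact: exprn_continuous.
have c0 := cX _ k.+1 (slice _ (f_smooth 0%N)).
have c1 := cX _ 2%N (slice _ f3).
have c2 j := cX _ 2%N (slice _ (f4 j)).
move=> x; apply: cvgD; last first.
  by apply: cvgM; [exact: cvg_cst|apply: cvgM; [exact: cvg_cst|exact: c0]].
apply: cvgD; first exact: c1.
have E : (fun x => \sum_(j < 3) `|dx j f t x| ^+ 2) =
  (fun x => `|dx 0 f t x| ^+ 2 + `|dx 1 f t x| ^+ 2 + `|dx 2%:R f t x| ^+ 2).
  by apply/funext => y; rewrite big_ord3.
rewrite E [X in _ --> X]big_ord3.
by apply: cvgD; [apply: cvgD|]; exact: c2.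
Qed.

Variables (d2 : R).
Hypothesis d2_bnd : 0 < d2 <= 1.

Lemma finite_energy_of_decay t C : t \in `[0, T] -> 0 <= C ->
  (forall x, `|energy_density sg k T f t x| <= C * hump d2 x ^+ 3) ->
  finite_energy sg k T f t.
Proof.
move=> tT C0 hC; rewrite /finite_energy.
pose F := fun x : space3 R => lorentzian x.1.1 * lorentzian x.1.2 * lorentzian x.2.
have iF := integrableZl measurableT (C * d2 ^- 3) (@lorentzian3_integrable R).
apply: (le_integrable measurableT _ _ iF).
  apply/measurable_EFinP; apply: continuous_measurable3.
  exact: energy_density_continuous.
move=> x _; rewrite /= lee_fin.
have b := hump_le_lorentzian x d2_bnd.
rewrite (le_trans (hC x)) // (le_trans _ (ler_norm _)) //.
by have := ler_wpM2l C0 b; rewrite [leRHS]mulrA.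
Qed.

Lemma energy_lower t c L : t \in `[0, T] -> finite_energy sg k T f t -> 0 <= c -> 0 <= L ->
  (forall x, 0 <= energy_density sg k T f t x) ->
  (forall x, box3 (0, 0, 0) (L, L, L) x -> c <= energy_density sg k T f t x) ->
  2^-1 * (c * L ^+ 3) <= energy sg k T f t.
Proof.
move=> tT fin c0 L0 e_ge0 e_ge; rewrite /energy ler_wpM2l ?invr_ge0 //.
have md := continuous_measurable3 (energy_density_continuous tT).
have := @integral_lower_bound R _ _ (@lebesgue3 R) setT (box3 (0, 0, 0) (L, L, L))
  (energy_density sg k T f t) c measurableT (measurable_box3 _ _) (@subsetT _ _) md
  (fun x _ => e_ge0 x) c0 e_ge.
rewrite [X in (_ * X)%E](@box3_measure R (0, 0, 0) (L, L, L)) //= !subr0 -EFinM.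
(* Integrability makes the extended integral finite, so that the real-valued one is its true
   value. *)
have fI : (\int[@lebesgue3 R]_x (energy_density sg k T f t x)%:E)%E \is a fin_num.
  exact: integrable_fin_num.
rewrite /Rintegral -[X in (_ <= X)%E -> _](fineK fI) lee_fin.
by rewrite !exprS expr0 mulr1 !mulrA.
Qed.

End EnergyOfSmooth.

(** Parameters are fixed in the order [r], [s], [eps], [L], [d2]. Only [L], and [d2] through it,
    depend on [E0], so the energy can be raised without affecting the smallness of the amplitude. *)
Theorem mainTheorem1 (R : realType) (k : nat) (hk3 : (3 <= k)%N) (hkodd : odd k)
    (sg : R) (hsg : sg = 1 \/ sg = -1)
    (T0 E0 : R) (hT0 : 0 < T0) (hE0 : 0 < E0) :
  exists phi0 phi1 : space3 R -> R,
    [/\ smooth phi0, smooth phi1 &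
      exists phi : R -> space3 R -> R,
        [/\ is_solution sg k T0 phi0 phi1 phi,
            forall psi : R -> space3 R -> R,
              is_solution sg k T0 phi0 phi1 psi ->
              forall (t : R) (x : space3 R), t \in `[0, T0] -> psi t x = phi t x &
            forall t : R, t \in `[0, T0] ->
              finite_energy sg k T0 phi t /\ E0 <= energy sg k T0 phi t]].
Proof.
have sg1 : `|sg| = 1 by case: hsg => ->; rewrite ?normrN normr1.
pose r := 2 * T0; pose s := 2 * r.
have r0 : 0 < r by rewrite mulr_gt0.
have s0 : 0 < s by rewrite mulr_gt0.
have Tr : T0 < r by rewrite /r; move: hT0; lra.
pose a := (2 * s) ^+ k.+1; have a0 : 0 <= a by rewrite exprn_ge0 // mulr_ge0 // ltW.
(* Chosen so that [a * eps <= 1 / 8]; as [eps <= 1], the power [eps ^+ k.-1] is at most [eps]. *)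
pose eps := (1 + 8%:R * a)^-1.
have den0 : 0 < 1 + 8%:R * a by rewrite ltr_pwDl // mulr_ge0.
have eps0 : 0 < eps by rewrite invr_gt0.
have eps1 : eps <= 1 by rewrite invf_le1 // lerDl mulr_ge0.
have small_eps : (2 * s) ^+ k.+1 * eps ^+ k.-1 <= 8%:R^-1.
  have le_eps : eps ^+ k.-1 <= eps.
    have -> : k.-1 = k.-2.+1 by case: (k) hk3 => [|[|n]].
    by rewrite exprS ler_piMr ?(ltW eps0) // exprn_ile1 // ltW.
  apply: (le_trans (ler_wpM2l a0 le_eps)).
  rewrite /eps ler_pdivrMr // mulrDr mulr1 mulrA mulVf ?mul1r ?pnatr_eq0 //.
  by rewrite lerDr invr_ge0.
pose b := 8%:R * (344%:R * k%:R ^+ 2 * s ^+ 2).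
have b0 : 0 <= b by exact: (mulr_ge0 (ler0n _ _) (mulr_ge0 (mulr_ge0 (ler0n _ _) (sqr_ge0 _)) (sqr_ge0 _))).
(* The bound of [density_lower] at points where the hump is at least 1/4. *)
pose c := eps ^+ 2 / 8%:R * 4%:R^-1 ^+ 4.
have c0 : 0 < c by rewrite mulr_gt0 // ?divr_gt0 ?exprn_gt0 ?invr_gt0 ?ltr0n.
(* The summands give [L >= 1], [L ^+ 2 >= b] for the smallness of [d2], and [c * L >= 2 * E0]; with
   [L ^+ 3 >= L] the last one yields the energy bound. *)
pose L := 1 + b + 2 * E0 / c.
have E0c : 0 <= 2 * E0 / c by rewrite divr_ge0 ?mulr_ge0 // ltW.
have L1 : 1 <= L by rewrite /L -addrA lerDl addr_ge0.
have L0 : 0 < L := lt_le_trans ltr01 L1.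
have LL2 : L <= L ^+ 2 by rewrite expr2 ler_peMl // ltW.
pose d2 := (L ^+ 2)^-1.
have d20 : 0 < d2 by rewrite invr_gt0 exprn_gt0.
have d21 : d2 <= 1 by rewrite invf_le1 ?exprn_gt0 // exprn_ege1.
have small_d2 : 344%:R * k%:R ^+ 2 * d2 * s ^+ 2 <= 8%:R^-1.
  have -> : 344%:R * k%:R ^+ 2 * d2 * s ^+ 2 = b / 8%:R / L ^+ 2 by rewrite /b /d2; field; rewrite gt_eqF.
  rewrite ler_pdivrMr ?exprn_gt0 // mulrC ler_wpM2l ?invr_ge0 // (le_trans _ LL2) //.
  by rewrite /L -addrA addrCA lerDl addr_ge0.
pose phi := solution k sg d2 eps.
have phi_smooth : smooth_slab T0 phi.
  exact: (solution_smooth hk3 sg1 hT0 Tr d20 eps0 small_d2 small_eps).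
have zT : 0 \in `[0, T0] by rewrite in_itv /= lexx ltW.
exists (phi 0), (dt T0 phi 0); split.
- by move=> n; exact: Cn_slab_slice zT (phi_smooth n).
- by move=> n; have [_ [_ _ h _]] := phi_smooth n.+1; exact: Cn_slab_slice zT h.
have phi_sol : is_solution sg k T0 (phi 0) (dt T0 phi 0) phi.
  split => // t x tT.
  exact: (solution_pde hk3 hkodd sg1 hT0 Tr d20 eps0 small_d2 small_eps).
exists phi; split => //.
- by move=> psi psi_sol t x; exact: (solution_unique hT0 hkodd sg1 psi_sol phi_sol).
move=> t tT.
have [C C0 hC] := density_upper hk3 sg1 hT0 Tr d20 eps0 small_d2 small_eps.
have low x := density_lower hk3 sg1 hT0 Tr d20 eps0 small_d2 small_eps x tT.
have d2b : 0 < d2 <= 1 by rewrite d20.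
have fin : finite_energy sg k T0 phi t.
  by apply: (finite_energy_of_decay phi_smooth d2b tT C0) => x; exact: hC.
split => //.
have := @energy_lower R sg T0 k phi phi_smooth t c L tT fin (ltW c0) (ltW L0).
have hump_ge0 x : 0 <= hump d2 x := ltW (hump_gt0 (ltW d20) x).
have e80 : 0 <= eps ^+ 2 / 8%:R by rewrite divr_ge0 ?sqr_ge0.
move=> h; apply: le_trans (h _ _).
- have L3 : L <= L ^+ 3 by rewrite exprS ler_peMr ?(ltW L0) // exprn_ege1.
  have cL : 2 * E0 <= c * L.
    by rewrite -ler_pdivrMl // mulrC /L lerDr addr_ge0.
  have := ler_wpM2l (ltW c0) L3; lra.
- move=> x; apply: le_trans (low x).
  by rewrite mulr_ge0 // exprn_ge0.
- move=> x xB; apply: le_trans (low x); rewrite /c ler_wpM2l //.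
  have hx := hump_ge L0 (erefl _) xB.
  by rewrite lerXn2r ?nnegrE ?hump_ge0 ?invr_ge0.
Qed.
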